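(* Let $\nu>-1$ and $-1<\mu<\nu+2$ be real, and let $f$ be a real-valued integrable function on $(0,1)$ such that, in the case $\nu<-1/2$, $\int_0^1 t^{\nu+1/2}|f(t)|\,dt<\infty$. Put $\lambda=\nu-\mu+3/2$ and $\mathcal{D}_\mu=\mathbb{C}\setminus\{0,\pm j_{\mu,1},\pm j_{\mu,2},\dots\}$. Then for all $z\in\mathcal{D}_\mu$ $$\frac{\mathcal{H}_\nu(f)(z)}{z^{\lambda}J_\mu(z)}=\frac{b}{z}-\sum_{m=1}^\infty a_m\left(\frac{1}{z-j_{\mu,m}}+\frac{1}{z+j_{\mu,m}}\right),$$ where $$b=\frac{\Gamma(\mu+1)}{2^{\nu-\mu}\Gamma(\nu+1)}\int_0^1 t^{\nu+1/2}f(t)\,dt,\qquad a_m=\frac{\mathcal{H}_\nu(f)(j_{\mu,m})}{j_{\mu,m}^{\lambda}J_{\mu+1}(j_{\mu,m})},\quad m=1,2,\dots.$$ In addition, the series converges absolutely for each $z\in\mathcal{D}_\mu$ and the convergence is uniform on each compact subset of $\mathcal{D}_\mu$.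
   Context: $J_\nu$ denotes the Bessel function of the first kind of order $\nu$. For real $\mu>-1$, $(j_{\mu,m})_{m\ge1}$ denotes the sequence of all positive zeros of $J_\mu$ in ascending order. The Hankel transform of $f$ is $\mathcal{H}_\nu(f)(z)=\int_0^1 f(t)J_\nu(zt)\sqrt{zt}\,dt$ for $z\in\mathbb{C}\setminus\{0\}$. All multivalued powers of $z$ (in $J_\nu(zt)$, $\sqrt{zt}$, $z^\lambda$, $J_\mu(z)$) are taken with the same branch of $\arg z$ (e.g. the principal one); the quotient $\mathcal{H}_\nu(f)(z)/(z^\lambda J_\mu(z))$ is then single-valued. *)

(* Defs.v *)
From HB Require Import structures.
From mathcomp Require Import all_boot all_order all_algebra complex.
From mathcomp Require Import all_classical all_reals all_analysis.

Set Implicit Arguments.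
Unset Strict Implicit.
Unset Printing Implicit Defensive.

Import Order.TTheory GRing.Theory Num.Theory.
Import numFieldNormedType.Exports.
Import ComplexField.

Local Open Scope classical_set_scope.
Local Open Scope ring_scope.
Local Open Scope complex_scope.

(* MathComp and MathComp-Analysis over an arbitrary R : realType.  The complex
   plane is R[i]; its norm topology is carried by the alias R[i]^o. *)

Section ComplexPowers.
Variable R : realType.
Implicit Types (arg : R[i] -> R) (z : R[i]).

(* The condition arg (t z) = arg z for t > 0 says that z and z * t are evaluated
   on the same branch.  Continuity of arg is not required, so the branch cut is
   arbitrary; the values at 0 are irrelevant. *)
Definition arg_branch arg : Prop :=
  forall z, z != 0 ->
    z = (Normc.normc z)%:C * (cos (arg z) +i* sin (arg z)) /\
    forall t : R, 0 < t -> arg (t%:C * z) = arg z.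

(* z^s = exp (s (ln |z| + i arg z)), used for z != 0 only *)
Definition cpow arg z (s : R) : R[i] :=
  (Normc.normc z `^ s)%:C * (cos (s * arg z) +i* sin (s * arg z)).

(* the principal branch, with values in ]-pi, pi] *)
Definition principal_arg z : R :=
  if 0 <= complex.Im z then acos (complex.Re z / Normc.normc z)
  else - acos (complex.Re z / Normc.normc z).

Lemma principal_arg_branch : arg_branch principal_arg.
Proof.
case=> a b z0; have r0 : 0 < Num.sqrt (a ^+ 2 + b ^+ 2).
  rewrite lt_neqAle sqrtr_ge0 andbT eq_sym; apply: contra z0 => /eqP h.
  by apply/eqP; apply: Normc.eq0_normc; rewrite /Normc.normc h.
have r2 : Num.sqrt (a ^+ 2 + b ^+ 2) ^+ 2 = a ^+ 2 + b ^+ 2.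
  by rewrite sqr_sqrtr// addr_ge0// sqr_ge0.
split.
  rewrite /principal_arg /Normc.normc /=.
  move: (Num.sqrt _) r0 r2 => r r0 r2.
  have r0' : r != 0 by rewrite gt_eqF.
  have xE : (a / r) ^+ 2 = 1 - (b / r) ^+ 2.
    rewrite !expr_div_n r2; apply/eqP.
    rewrite eq_sym subr_eq -mulrDl divff// -r2.
    by rewrite expf_neq0.
  have x1 : -1 <= a / r <= 1.
    rewrite -ler_norml -(@expr_le1 _ 2)// real_normK ?num_real// xE.
    by rewrite lerBlDr lerDl sqr_ge0.
  have sx : sin (acos (a / r)) = `|b| / r.
    rewrite sin_acos// xE opprB addrC subrK sqrtr_sqr normrM normfV.
    by rewrite (gtr0_norm r0).
  have E c s : c = a / r -> s = b / r -> a +i* b = r%:C * (c +i* s).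
    move=> -> ->; apply/eqP; rewrite eq_complex /=.
    by rewrite !mul0r subr0 addr0 ![r * _]mulrC !divfK// !eqxx.
  case: ifPn => [b0|]; last rewrite -ltNge => b0.
    by apply: E; rewrite ?acosK// sx ger0_norm.
  by apply: E; rewrite ?cosN ?acosK// sinN sx ltr0_norm// mulNr opprK.
move=> t t0; rewrite /principal_arg /Normc.normc /=.
rewrite !mul0r subr0 addr0 pmulr_rge0//.
rewrite !exprMn -mulrDr sqrtrM ?sqr_ge0// sqrtr_sqr gtr0_norm//.
by rewrite -mulf_div divff ?gt_eqF// mul1r.
Qed.
End ComplexPowers.

Section Bessel.
Variable R : realType.
Implicit Types (arg : R[i] -> R) (z : R[i]) (x nu mu : R).

Definition Gamma x : R :=
  \int[lebesgue_measure]_(t in `]0, +oo[) (t `^ (x - 1) * expR (- t)).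

(* J_nu(z) = (z/2)^nu sum_k (-1)^k / (k! Gamma(nu+k+1)) (z/2)^(2k), for
   nu > -1 (so that Gamma is only evaluated on positive reals) and z != 0 *)
Definition bessel_term nu z (k : nat) : R[i]^o :=
  ((-1) ^+ k / (k`!%:R * Gamma (nu + k%:R + 1)))%:C * (z / 2) ^+ k.*2.

Definition bessel arg nu z : R[i] :=
  cpow arg (z / 2) nu * limn (series (bessel_term nu z)).

(* j m is the (m+1)-st positive zero of J_mu; on x > 0 the vanishing of J_mu
   does not depend on the branch *)
Definition bessel_positive_zeros arg mu (j : nat -> R) : Prop :=
  {homo j : m n / (m < n)%N >-> m < n} /\
  forall x, (0 < x /\ bessel arg mu x%:C = 0) <-> exists m, j m = x.

Definition complex_integral (A : set R) (g : R -> R[i]) : R[i] :=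
  (\int[lebesgue_measure]_(t in A) complex.Re (g t)) +i*
  (\int[lebesgue_measure]_(t in A) complex.Im (g t)).

Definition hankel arg nu (f : R -> R) z : R[i] :=
  complex_integral `]0, 1[
    (fun t => (f t)%:C * bessel arg nu (z * t%:C) * cpow arg (z * t%:C) 2^-1).

Definition bessel_domain (j : nat -> R) : set R[i]^o :=
  [set z | z <> 0 /\ forall m, z <> (j m)%:C /\ z <> - (j m)%:C].

Definition coef_b nu mu (f : R -> R) : R :=
  Gamma (mu + 1) / (2 `^ (nu - mu) * Gamma (nu + 1)) *
  \int[lebesgue_measure]_(t in `]0, 1[) (t `^ (nu + 2^-1) * f t).

Definition coef_a arg nu mu (f : R -> R) (j : nat -> R) (m : nat) : R[i] :=
  hankel arg nu f (j m)%:C /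
  (cpow arg (j m)%:C (nu - mu + 3 / 2) * bessel arg (mu + 1) (j m)%:C).

Definition expansion_term arg nu mu f (j : nat -> R) z (m : nat) : R[i]^o :=
  coef_a arg nu mu f j m * ((z - (j m)%:C)^-1 + (z + (j m)%:C)^-1).

End Bessel.

(* Main.v *)
(* Everything is expressed in w = z^2. With Q(z^2) = (2/z)^mu J_mu(z) and P the
   entire function such that H_nu f (z) = 2^-nu z^(nu+1/2) P(z^2), the left-hand
   side is 2^(mu-nu) P(z^2) / (z Q(z^2)), so the theorem is the partial fraction
   expansion of P/Q. Remove from P/Q its value at 0 and its principal parts at
   the first n zeros, and divide by w: the result is analytic on the disc
   |w| <= c_n^2, where c_n is a critical point of sqrt(x) J_mu(x) between
   consecutive zeros, and the maximum principle (instead of a contour integral)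
   bounds it by its values on the circle. There |Q(z^2)| is at least a constant
   times |z|^(-mu-1/2) e^|Im z| while |P(z^2)| is at most a constant times
   |z|^(-nu-1/2) e^|Im z|; both follow from the Bessel equation integrated along
   the arc z = c_n e^(it). The zeros are simple and positive with gaps bounded
   below, which controls the principal parts on the circle; as mu < nu + 2, the
   remainder tends to 0. *)

Require Import Defs.
From HB Require Import structures.
From mathcomp Require Import all_boot all_order all_algebra complex ring lra.
From mathcomp Require Import all_classical all_reals all_analysis.
From mathcomp Require Import measurable_realfun.

Set Implicit Arguments.
Unset Strict Implicit.
Unset Printing Implicit Defensive.

Import Order.TTheory GRing.Theory Num.Theory.
Import numFieldNormedType.Exports.
Import ComplexField.

Local Open Scope classical_set_scope.
Local Open Scope ring_scope.
Local Open Scope complex_scope.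

(** Analytic functions occur only as coefficient sequences with infinite radius of convergence, and
    the basic operation is exact division: (a(z) - a(w)) / (z - w) is again such a series. Dividing
    out zeros and interpolating the numerator turns P/Q minus finitely many principal parts into a
    quotient of two entire series with a denominator free of zeros in the disc; no theory of
    removable singularities and no Cauchy theorem is involved. The delicate point is the lower bound
    of |Q| on the whole circle, since near the real axis e^(iz) and e^(-iz) have comparable size.
    Starting the arc at a critical point means that both exponential components start with equal
    modulus; then |q| hardly decreases while Im z <= 2, and beyond that the growing component
    dominates. Division by w gains c_n^2. Against this stand c_n^(mu-nu) from P/Q and
    c_n^(1+max(mu-nu-1,0)) log n from the principal parts; both are of smaller order exactly when mu
    < nu + 2. *)

Local Notation nc := (Normc.normc).

(** * Norms and limits of complex numbers *)

Section ComplexNorm.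
Variable R : realType.
Implicit Types (x y z : R[i]) (u : R[i] ^nat).

Lemma nc_ge0 z : 0 <= nc z.
Proof. by case: z => a b; rewrite /nc sqrtr_ge0. Qed.

Lemma ncM x y : nc (x * y) = nc x * nc y.
Proof. exact: Normc.normcM. Qed.

Lemma ncD x y : nc (x + y) <= nc x + nc y.
Proof. exact: le_normcD. Qed.

Lemma ncN x : nc (- x) = nc x.
Proof. exact: normcN. Qed.

Lemma ncB x y : nc (x - y) <= nc x + nc y.
Proof. by rewrite -(ncN y); exact: ncD. Qed.

Lemma ncC x y : nc (x - y) = nc (y - x).
Proof. by rewrite -ncN opprB. Qed.

Lemma ler_ncB x y : nc x - nc y <= nc (x - y).
Proof. by rewrite lerBlDr (le_trans _ (ncD _ _))// subrK. Qed.

Lemma ncV x : nc x^-1 = (nc x)^-1.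
Proof. exact: Normc.normcV. Qed.

Lemma nc0 : nc 0 = 0 :> R. Proof. exact: Normc.normc0. Qed.

Lemma nc1 : nc 1 = 1 :> R. Proof. exact: Normc.normc1. Qed.

Lemma ncX x n : nc (x ^+ n) = nc x ^+ n.
Proof. by elim: n => [|n IH]; rewrite ?expr0 ?nc1// !exprS ncM IH. Qed.

Lemma nc_real (r : R) : nc r%:C = `|r|.
Proof. by rewrite /nc /= expr0n addr0 sqrtr_sqr. Qed.

Lemma nc_eq0 z : (nc z == 0) = (z == 0).
Proof.
apply/eqP/eqP => [|->]; last exact: nc0.
exact: Normc.eq0_normc.
Qed.

Lemma nc_gt0 z : (0 < nc z) = (z != 0).
Proof. by rewrite lt_def nc_ge0 andbT nc_eq0. Qed.

Lemma sqr_nc z : nc z ^+ 2 = complex.Re z ^+ 2 + complex.Im z ^+ 2.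
Proof. by case: z => a b; rewrite /nc /= sqr_sqrtr ?addr_ge0// sqr_ge0. Qed.

Lemma nc_Re z : `|complex.Re z| <= nc z.
Proof.
rewrite -(@ler_pXn2r _ 2) ?nnegrE ?nc_ge0// sqr_nc real_normK ?num_real//.
by rewrite lerDl sqr_ge0.
Qed.

Lemma nc_Im z : `|complex.Im z| <= nc z.
Proof.
rewrite -(@ler_pXn2r _ 2) ?nnegrE ?nc_ge0// sqr_nc real_normK ?num_real//.
by rewrite lerDr sqr_ge0.
Qed.

Lemma nc_le z : nc z <= `|complex.Re z| + `|complex.Im z|.
Proof.
rewrite -(@ler_pXn2r _ 2) ?nnegrE ?nc_ge0 ?addr_ge0// sqr_nc sqrrD.
rewrite !real_normK ?num_real// -addrA lerD2l lerDr.
by rewrite mulrn_wge0// mulr_ge0.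
Qed.

Lemma ncJ z : nc z^* = nc z.
Proof. by case: z => a b; rewrite /nc /= sqrrN. Qed.

Lemma cReD x y : complex.Re (x + y) = complex.Re x + complex.Re y.
Proof. by case: x y => [? ?] [? ?]. Qed.

Lemma cImD x y : complex.Im (x + y) = complex.Im x + complex.Im y.
Proof. by case: x y => [? ?] [? ?]. Qed.

Lemma cReN x : complex.Re (- x) = - complex.Re x.
Proof. by case: x. Qed.

Lemma cImN x : complex.Im (- x) = - complex.Im x.
Proof. by case: x. Qed.

Lemma cReM x y : complex.Re (x * y) =
  complex.Re x * complex.Re y - complex.Im x * complex.Im y.
Proof. by case: x y => [? ?] [? ?]. Qed.

Lemma cImM x y : complex.Im (x * y) =
  complex.Re x * complex.Im y + complex.Im x * complex.Re y.
Proof. by case: x y => [? ?] [? ?]. Qed.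

Lemma Re_sum u n :
  complex.Re (\sum_(k < n) u k) = \sum_(k < n) complex.Re (u k).
Proof.
by elim: n => [|n IH]; rewrite ?big_ord0// !big_ord_recr /= cReD IH.
Qed.

Lemma Im_sum u n :
  complex.Im (\sum_(k < n) u k) = \sum_(k < n) complex.Im (u k).
Proof.
by elim: n => [|n IH]; rewrite ?big_ord0// !big_ord_recr /= cImD IH.
Qed.

Lemma nc_sum u n : nc (\sum_(k < n) u k) <= \sum_(k < n) nc (u k).
Proof.
elim: n => [|n IH]; rewrite ?big_ord0 ?nc0// !big_ord_recr /=.
by rewrite (le_trans (ncD _ _))// lerD2r.
Qed.

Lemma eq_ReIm x y : complex.Re x = complex.Re y -> complex.Im x = complex.Im y ->
  x = y.
Proof. by case: x y => [? ?] [? ?] /= -> ->. Qed.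

(** Transfers limits in the norm topology of [R[i]^o], whose norm and radii are complex numbers, to
    limits of real sequences. *)
Lemma cvgP_nc (u : (R[i]^o) ^nat) (l : R[i]^o) :
  u @ \oo --> l <-> (fun n => nc (u n - l)) @ \oo --> (0 : R).
Proof.
have ncE n : nc (u n - l) = nc (l - u n) := ncC _ _.
split=> [/cvgrPdist_lt ul|/cvgrPdist_lt ul].
  apply/cvgrPdist_lt => e e0.
  have e0' : 0 < e%:C :> R[i] by rewrite ltcR.
  have := ul _ e0'; apply: filterS => n.
  move=> h; rewrite sub0r normrN ger0_norm ?nc_ge0// ncE -ltcR.
  exact: h.
apply/cvgrPdist_lt => e e0.
(* In the order of [R[i]] a positive element is real, so real radii suffice. *)
have eE : e = (complex.Re e)%:C.
  by rewrite RRe_real// realE (ltW e0).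
move: e0; rewrite eE ltcR => e0.
have := ul _ e0; apply: filterS => n /=; rewrite sub0r normrN => h.
have : nc (l - u n) < complex.Re e by rewrite -ncE -[nc _]ger0_norm ?nc_ge0.
by rewrite -ltcR; exact.
Qed.

Lemma cvgP_ReIm (u : (R[i]^o) ^nat) (l : R[i]^o) :
  u @ \oo --> l <->
  (fun n => complex.Re (u n)) @ \oo --> complex.Re l /\
  (fun n => complex.Im (u n)) @ \oo --> complex.Im l.
Proof.
have ncE n : nc (u n - l) = nc (l - u n) := ncC _ _.
split=> [/cvgP_nc/cvgrPdist_lt ul|].
  split; apply/cvgrPdist_lt => e e0; have := ul _ e0; apply: filterS => n h;
    move: h; rewrite sub0r normrN ger0_norm ?nc_ge0// ncE; apply: le_lt_trans.
  - by rewrite -cReN -cReD nc_Re.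
  - by rewrite -cImN -cImD nc_Im.
move=> [/cvgrPdist_lt hr /cvgrPdist_lt hi]; apply/cvgP_nc/cvgrPdist_lt => e e0.
have e2 : 0 < e / 2 by rewrite divr_gt0.
near=> n; rewrite sub0r normrN ger0_norm ?nc_ge0// ncE.
rewrite (le_lt_trans (nc_le _))// cReD cReN cImD cImN [ltRHS]splitr.
by apply: ltrD; near: n; [exact: hr|exact: hi].
Unshelve. all: by end_near. Qed.

(* Limits of complex sequences, phrased on R[i] itself: the algebraic structure
   of the alias R[i]^o is convertible to that of R[i] but does not match it
   syntactically. *)
Definition clim u (l : R[i]) := (u : (R[i]^o) ^nat) @ \oo --> (l : R[i]^o).

Lemma clim_lim (u : (R[i]^o) ^nat) (l : R[i]^o) : clim u l -> limn u = l.
Proof. exact/cvg_lim/norm_hausdorff. Qed.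

Lemma clim_unique u l l' : clim u l -> clim u l' -> l = l'.
Proof. by move=> /clim_lim <- /clim_lim <-. Qed.

Lemma clim_ext u (v : nat -> R[i]) l :
  (forall n, u n = v n) -> clim u l -> clim v l.
Proof. by move=> /funext ->. Qed.

Lemma clim_cst x : clim (fun=> x) x.
Proof. exact: cvg_cst. Qed.

Lemma climD u (v : nat -> R[i]) x y :
  clim u x -> clim v y -> clim (fun n => u n + v n) (x + y).
Proof. exact: cvgD. Qed.

Lemma climB u (v : nat -> R[i]) x y :
  clim u x -> clim v y -> clim (fun n => u n - v n) (x - y).
Proof. exact: cvgB. Qed.

Lemma climM u (v : nat -> R[i]) x y :
  clim u x -> clim v y -> clim (fun n => u n * v n) (x * y).
Proof. exact: (@cvgM R[i]). Qed.

Lemma climMl c u x : clim u x -> clim (fun n => c * u n) (c * x).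
Proof. by apply: climM; exact: clim_cst. Qed.

Lemma clim_shiftS u x : clim u x -> clim (fun n => u n.+1) x.
Proof. by rewrite /clim => h; rewrite -cvg_shiftS in h. Qed.

Lemma climP_nc u x : clim u x <-> (fun n => nc (u n - x)) @ \oo --> (0 : R).
Proof. exact: cvgP_nc. Qed.

Lemma climP_ReIm u x : clim u x <->
  (fun n => complex.Re (u n)) @ \oo --> complex.Re x /\
  (fun n => complex.Im (u n)) @ \oo --> complex.Im x.
Proof. exact: cvgP_ReIm. Qed.

Lemma conjc_Im0 z : complex.Im z = 0 -> z^* = z.
Proof. by case: z => p q /= ->; rewrite oppr0. Qed.

Lemma nc_lim_le u (l : R[i]) (M : R) :
  clim u l -> (forall n, nc (u n) <= M) -> nc l <= M.
Proof.
move=> /climP_nc ul uM; rewrite leNgt; apply/negP => Ml.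
have e0 : 0 < nc l - M by rewrite subr_gt0.
move/cvgrPdist_lt : ul => /(_ _ e0) [N _ /(_ N (leqnn _))].
rewrite ncC sub0r normrN ger0_norm ?nc_ge0//; apply/negP; rewrite -leNgt.
by rewrite (le_trans _ (ler_ncB _ _))// lerB.
Qed.

Lemma seriesE (V : zmodType) (u : V ^nat) n : series u n = \sum_(k < n) u k.
Proof. by rewrite /series /= big_mkord. Qed.

(** The real and imaginary parts converge absolutely, so that only the completeness of the reals is
    needed. *)
Lemma cseries_cvg u (v : R ^nat) :
  (forall n, nc (u n) <= v n) -> cvgn (series v) ->
  exists l, clim (fun n => \sum_(k < n) u k) l.
Proof.
move=> uv cv.
have v0 n : 0 <= v n by exact: le_trans (nc_ge0 _) (uv n).
have H (w : R ^nat) : (forall n, `|w n| <= v n) -> cvgn (series w).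
  move=> wv; apply: normed_cvg.
  apply: (@series_le_cvg _ _ v) => //= n; exact: wv.
have hr : cvgn (series (fun n => complex.Re (u n))).
  by apply: H => n; rewrite (le_trans (nc_Re _)).
have hi : cvgn (series (fun n => complex.Im (u n))).
  by apply: H => n; rewrite (le_trans (nc_Im _)).
exists (limn (series (fun n => complex.Re (u n))) +i*
  limn (series (fun n => complex.Im (u n)))).
apply/climP_ReIm; split => /=.
  rewrite (_ : (fun n => _) = series (fun n => complex.Re (u n)))//.
  by apply/funext => n; rewrite !seriesE Re_sum.
rewrite (_ : (fun n => _) = series (fun n => complex.Im (u n)))//.
by apply/funext => n; rewrite !seriesE Im_sum.
Qed.

End ComplexNorm.
Arguments clim_cst {R} x.
Arguments climMl {R} c [u x] _.

(** * Entire power series *)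

Section EntireSeries.
Variable R : realType.
Implicit Types (a b : nat -> R[i]) (z w c : R[i]).

(** An infinite radius of convergence, phrased as a bound at every radius: a bound at radius 2|z| or
    more gives a geometric majorant of ratio 1/2 at z. *)
Definition entire a := forall rho : R, 0 < rho ->
  exists C : R, forall k, nc (a k) * rho ^+ k <= C.

Definition pser a z n : R[i] := \sum_(k < n) a k * z ^+ k.

Definition ev a z : R[i] := limn (series (fun k => a k * z ^+ k : R[i]^o)).

Lemma evE a z : ev a z = limn (series (fun k => a k * z ^+ k : R[i]^o)).
Proof. by []. Qed.

Definition shift a n k := a (n + k)%N.

(* Coefficients of (a(z) - a(w)) / (z - w), as a series in z. *)
Definition quo a w k := ev (shift a k.+1) w.

Definition der a k := k.+1%:R * a k.+1.

Lemma sum_geo2 n : \sum_(k < n) (2^-1 : R) ^+ k <= 2.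
Proof.
suff -> : \sum_(k < n) (2^-1 : R) ^+ k = 2 - 2 * 2^-1 ^+ n.
  by rewrite gerBl mulr_ge0// exprn_ge0.
elim: n => [|n IH]; first by rewrite big_ord0 expr0 mulr1 subrr.
by rewrite big_ord_recr /= IH exprS; field.
Qed.

Lemma cvg_geo2 : cvgn (series (fun k => (2^-1 : R) ^+ k)).
Proof.
have := @is_cvg_geometric_series R 1 2^-1.
rewrite /geometric /= => H; under eq_fun do rewrite -(mul1r (2^-1 ^+ _)).
apply: H; rewrite ger0_norm//; lra.
Qed.

Lemma term_le a z (rho C : R) k : 0 < rho -> 2 * nc z <= rho ->
  nc (a k) * rho ^+ k <= C -> nc (a k * z ^+ k) <= C * 2^-1 ^+ k.
Proof.
move=> rho0 zr aC; rewrite ncM ncX.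
apply: (@le_trans _ _ (nc (a k) * (rho ^+ k * 2^-1 ^+ k))).
  rewrite ler_wpM2l ?nc_ge0// -exprMn lerXn2r ?nnegrE ?nc_ge0//.
    by rewrite divr_ge0 ?(ltW rho0).
  by rewrite ler_pdivlMr// mulrC.
by rewrite mulrA ler_wpM2r// exprn_ge0.
Qed.

Lemma cvgn_series_scale (c : R) (u : R ^nat) :
  cvgn (series u) -> cvgn (series (fun k => c * u k)).
Proof.
move=> /(cvgMr (a := c)) cu; apply/cvg_ex; eexists.
suff -> : series (fun k => c * u k) = (fun n => c * series u n) by exact: cu.
by apply/funext => n; rewrite !seriesE mulr_sumr.
Qed.

Lemma series_pser a z :
  series (fun k => a k * z ^+ k : R[i]^o) = (fun n => pser a z n : R[i]^o).
Proof. by apply/funext => n; rewrite seriesE. Qed.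

Arguments cvgn_series_scale c [u] _.

Lemma ev_cvg a z : entire a -> clim (pser a z) (ev a z).
Proof.
move=> ea; pose rho := 2 * nc z + 1.
have rho0 : 0 < rho by rewrite ltr_wpDl// mulr_ge0// nc_ge0.
have [C aC] := ea _ rho0.
have [|l hl] := @cseries_cvg R (fun k => a k * z ^+ k)
    (fun k => C * 2^-1 ^+ k) _ (cvgn_series_scale C cvg_geo2).
  by move=> k; apply: (term_le (rho := rho)) => //; rewrite lerDl.
rewrite /ev series_pser (clim_lim (u := pser a z) (l := l))//.
Qed.

Arguments ev_cvg [a] z _.

Lemma ev_le a z (rho C : R) : entire a -> 0 < rho -> 2 * nc z <= rho ->
  (forall k, nc (a k) * rho ^+ k <= C) -> nc (ev a z) <= 2 * C.
Proof.
move=> ea rho0 zr aC; apply: nc_lim_le (ev_cvg z ea) _ => n.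
rewrite /pser (le_trans (nc_sum (fun k => a k * z ^+ k) _))//.
apply: (@le_trans _ _ (\sum_(k < n) C * 2^-1 ^+ k)).
  by apply: ler_sum => k _; exact: (term_le (rho := rho)).
rewrite -mulr_sumr mulrC ler_wpM2r ?sum_geo2//.
by apply: le_trans (aC 0%N); rewrite mulr_ge0 ?nc_ge0// exprn_ge0// ltW.
Qed.

Lemma entire_ge0 a (rho C : R) : 0 < rho ->
  (forall k, nc (a k) * rho ^+ k <= C) -> 0 <= C.
Proof.
by move=> r0 /(_ 0%N); apply: le_trans; rewrite mulr_ge0 ?nc_ge0// exprn_ge0// ltW.
Qed.

Lemma entire_shift a n : entire a -> entire (shift a n).
Proof.
move=> ea rho r0; have [C aC] := ea _ r0.
exists (C / rho ^+ n) => k.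
rewrite ler_pdivlMr ?exprn_gt0// -mulrA -exprD addnC; exact: aC.
Qed.

Lemma entire_add a b : entire a -> entire b -> entire (fun k => a k + b k).
Proof.
move=> ea eb rho r0; have [C aC] := ea _ r0; have [D bD] := eb _ r0.
exists (C + D) => k.
rewrite (@le_trans _ _ ((nc (a k) + nc (b k)) * rho ^+ k))//.
  by rewrite ler_wpM2r ?exprn_ge0 ?(ltW r0)// ncD.
by rewrite mulrDl lerD.
Qed.

Lemma entire_scale a c : entire a -> entire (fun k => c * a k).
Proof.
move=> ea rho r0; have [C aC] := ea _ r0.
by exists (nc c * C) => k; rewrite ncM -mulrA ler_wpM2l ?nc_ge0.
Qed.

Lemma ev_add a b z : entire a -> entire b ->
  ev (fun k => a k + b k) z = ev a z + ev b z.
Proof.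
move=> ea eb; apply: (clim_unique (ev_cvg z (entire_add ea eb))).
apply: clim_ext (climD (ev_cvg z ea) (ev_cvg z eb)) => n.
rewrite /pser -big_split /=.
by apply: eq_bigr => k _; rewrite -mulrDl.
Qed.

Lemma ev_scale a c z : entire a -> ev (fun k => c * a k) z = c * ev a z.
Proof.
move=> ea; apply: (clim_unique (ev_cvg z (entire_scale c ea))).
apply: clim_ext (climMl c (ev_cvg z ea)) => n.
rewrite /pser mulr_sumr.
by apply: eq_bigr => k _; rewrite mulrA.
Qed.

Lemma ev_shift a z : entire a -> ev a z = a 0%N + z * ev (shift a 1) z.
Proof.
move=> ea; have e1 := entire_shift 1 ea.
apply: (clim_unique (clim_shiftS (ev_cvg z ea))).
apply: clim_ext (climD (clim_cst (a 0%N)) (climMl z (ev_cvg z e1))) => n.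
rewrite /pser big_ord_recl /= expr0 mulr1.
rewrite mulr_sumr; congr (_ + _); apply: eq_bigr => k _.
by rewrite /shift /bump /= exprS; ring.
Qed.

Lemma shiftD a m n : shift (shift a m) n = shift a (m + n).
Proof. by apply/funext => k; rewrite /shift addnA. Qed.

Lemma ev_tail a w n : entire a ->
  ev (shift a n) w = a n + w * ev (shift a n.+1) w.
Proof.
move=> ea; rewrite (ev_shift _ (entire_shift n ea)) shiftD addn1.
by rewrite /shift addn0.
Qed.

(** The hypothesis at the larger radius rho + 2|w| leaves room both for the convergence of the tails
    at w and for the factor rho^k. It makes [quo] entire. *)
Lemma ev_tail_bound a w (rho : R) : entire a -> 0 < rho ->
  exists C, forall k, nc (ev (shift a k) w) * rho ^+ k <= C.
Proof.
move=> ea r0; pose r := rho + 2 * nc w.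
have rr : 0 < r by rewrite ltr_pwDl// mulr_ge0// nc_ge0.
have [C aC] := ea _ rr; exists (2 * C) => k.
apply: (@le_trans _ _ (nc (ev (shift a k) w) * r ^+ k)).
  rewrite ler_wpM2l ?nc_ge0// lerXn2r ?nnegrE ?(ltW r0) ?(ltW rr)//.
  by rewrite lerDl mulr_ge0// nc_ge0.
rewrite -ler_pdivlMr ?exprn_gt0// -mulrA.
apply: (@ev_le _ _ r) => //; first exact: entire_shift.
  by rewrite lerDr ltW.
move=> i; rewrite ler_pdivlMr ?exprn_gt0// -mulrA -exprD addnC; exact: aC.
Qed.

Lemma entire_quo a w : entire a -> entire (quo a w).
Proof.
move=> ea rho r0; have [C aC] := ev_tail_bound w ea r0.
exists (C / rho) => k; rewrite ler_pdivlMr// -mulrA -exprSr; exact: aC.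
Qed.

Lemma entire_natmul_term_cvg0 (b : nat -> R[i]) z : entire b ->
  clim (fun n => n%:R * (b n * z ^+ n)) 0.
Proof.
(* The estimate n <= 2^n costs a factor 2 per step, and the radius 4|z| still leaves the ratio
   1/2. *)
move=> eb; pose rho := 4 * nc z + 1.
have rho0 : 0 < rho by rewrite ltr_wpDl// mulr_ge0// nc_ge0.
have [C bC] := eb _ rho0.
apply/climP_nc; under eq_fun do rewrite subr0.
have C0 := entire_ge0 rho0 bC.
have b2 n : nc (n%:R * (b n * z ^+ n)) <= C * 2^-1 ^+ n.
  have -> : (n%:R : R[i]) = n%:R%:C by rewrite rmorph_nat.
  rewrite ncM nc_real ger0_norm// ncM ncX.
  have h : n%:R <= 2 ^+ n :> R by rewrite -natrX ler_nat ltnW// ltn_expl.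
  apply: (@le_trans _ _ (2 ^+ n * (nc (b n) * (rho ^+ n * 4^-1 ^+ n)))).
    apply: ler_pM; rewrite ?mulr_ge0 ?nc_ge0 ?exprn_ge0 ?nc_ge0//.
    rewrite ler_wpM2l ?nc_ge0// -exprMn lerXn2r ?nnegrE ?nc_ge0//.
      by rewrite divr_ge0 ?(ltW rho0).
    by rewrite ler_pdivlMr// mulrC lerDl.
  rewrite (_ : _ * _ = nc (b n) * rho ^+ n * (2 ^+ n * 4^-1 ^+ n)); last by ring.
  rewrite -exprMn (_ : 2 * 4^-1 = 2^-1 :> R); last by field.
  by rewrite ler_wpM2r// exprn_ge0.
apply: (@squeeze_cvgr _ _ _ _ (fun=> 0) (fun n => C * 2^-1 ^+ n)).
- by near=> n; rewrite nc_ge0 b2.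
- exact: cvg_cst.
- rewrite -[X in _ --> X](mulr0 C); apply: cvgMr; apply: cvg_expr.
  by rewrite ger0_norm//; lra.
Unshelve. all: by end_near. Qed.

Arguments entire_natmul_term_cvg0 [b] z _.

Lemma entire_term_cvg0 (b : nat -> R[i]) z : entire b ->
  clim (fun n => b n * z ^+ n) 0.
Proof.
move=> eb; have h := ev_cvg z eb.
rewrite -[X in clim _ X](subrr (ev b z)).
apply: clim_ext (climB (clim_shiftS h) h) => n.
by rewrite /pser big_ord_recr /= addrAC subrr add0r.
Qed.

Arguments entire_term_cvg0 [b] z _.

(** The tails T_k = [ev (shift a k) w] satisfy T_k = a_k + w T_(k+1). Hence the n-th partial sums
    obey the identity up to the single term T_n z^n, which tends to 0. *)
Lemma ev_quo a w z : entire a -> ev a z = ev a w + (z - w) * ev (quo a w) z.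
Proof.
move=> ea; apply: (clim_unique (ev_cvg z ea)).
have eT : entire (fun k => ev (shift a k) w).
  by move=> rho r0; exact: ev_tail_bound.
have h := climD (climB (clim_cst (ev a w)) (entire_term_cvg0 z eT))
  (climMl (z - w) (ev_cvg z (entire_quo w ea))).
rewrite subr0 in h; apply: clim_ext h => n.
rewrite /pser mulr_sumr /quo.
elim: n => [|n IH].
  rewrite !big_ord0 expr0 mulr1 addr0.
  by rewrite (_ : shift a 0 = a) ?subrr//; apply/funext.
rewrite !big_ord_recr /= -IH (ev_tail w n ea) exprS.
move: (\sum_(i < n) _) (ev a w) (ev (shift a n.+1) w) => S e T.
ring.
Qed.

(** With T_k the tails at w, the partial sums of [quo] at w and those of [der] differ by n T_(n+1)
    w^n, which tends to 0; the derivative thus appears without a limit of difference quotients. *)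
Lemma ev_quo_diag a w : entire a -> entire (der a) ->
  ev (quo a w) w = ev (der a) w.
Proof.
move=> ea ed; have eT := entire_quo w ea.
have h := climB (ev_cvg w eT) (entire_natmul_term_cvg0 w eT).
rewrite subr0 in h; apply: esym; apply: (clim_unique (ev_cvg w ed)).
apply: clim_ext h => n; rewrite /pser.
elim: n => [|n IH]; first by rewrite !big_ord0 mul0r subrr.
rewrite !big_ord_recr /= -IH /der /quo (ev_tail w n.+1 ea) exprS.
move: (\sum_(i < n) _) (ev (shift a n.+2) w) => S T.
rewrite -[n.+1]addn1 natrD; ring.
Qed.

Lemma entire_der a : entire a -> entire (der a).
Proof.
move=> ea rho r0; have r20 : 0 < 2 * rho by rewrite mulr_gt0.
have [C aC] := ea _ r20; exists (C / rho) => k.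
have C0 := entire_ge0 r20 aC.
rewrite /der ler_pdivlMr// -mulrA -exprSr.
have -> : (k.+1%:R : R[i]) = k.+1%:R%:C by rewrite rmorph_nat.
rewrite ncM nc_real ger0_norm//.
apply: le_trans (aC k.+1); rewrite exprMn mulrCA -mulrA mulrCA.
rewrite [leRHS]mulrCA ler_wpM2r ?mulr_ge0 ?nc_ge0 ?exprn_ge0 ?(ltW r0)//.
by rewrite -natrX ler_nat ltnW// ltn_expl.
Qed.

(** Applied to a [quo], such a bound is a local Lipschitz estimate at w and replaces continuity
    arguments. *)
Lemma ev_locbound a w : entire a -> exists2 K, 0 < K &
  forall z, nc (z - w) <= 1 -> nc (ev a z) <= K.
Proof.
move=> ea; pose rho := 2 * (nc w + 1).
have r0 : 0 < rho by rewrite mulr_gt0// ltr_wpDl ?nc_ge0.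
have [C aC] := ea _ r0; exists (2 * C + 1).
  by rewrite ltr_wpDl// mulr_ge0// (entire_ge0 r0 aC).
move=> z zw; apply: (@le_trans _ _ (2 * C)); last by rewrite lerDl.
apply: (ev_le (rho := rho)) => //; rewrite ler_wpM2l//.
by rewrite -[z](subrK w) (le_trans (ncD _ _))// addrC lerD2l.
Qed.

Lemma ev_bounded a (M : R) : entire a -> exists2 K, 0 < K &
  forall z, nc z <= M -> nc (ev a z) <= K.
Proof.
move=> ea; pose rho := 2 * (`|M| + 1).
have r0 : 0 < rho by rewrite mulr_gt0// ltr_wpDl.
have [C aC] := ea _ r0; exists (2 * C + 1).
  by rewrite ltr_wpDl// mulr_ge0// (entire_ge0 r0 aC).
move=> z zw; apply: (@le_trans _ _ (2 * C)); last by rewrite lerDl.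
apply: (ev_le (rho := rho)) => //; rewrite ler_wpM2l//.
by rewrite (le_trans zw)// (le_trans (ler_norm _))// lerDl.
Qed.

Lemma ev0 a : entire a -> ev a 0 = a 0%N.
Proof. by move=> ea; rewrite ev_shift// mul0r addr0. Qed.

Lemma ev_conj a z : (forall k, complex.Im (a k) = 0) -> entire a ->
  ev a z^* = (ev a z)^*.
Proof.
move=> ar ea; apply: (clim_unique (ev_cvg _ ea)).
have /climP_ReIm[hr hi] := ev_cvg z ea; apply/climP_ReIm.
have E n : pser a z^* n = (pser a z n)^*.
  rewrite /pser rmorph_sum /=; apply: eq_bigr => k _.
  by rewrite rmorphM rmorphXn /= (conjc_Im0 (ar k)).
have RJ (x : R[i]) : complex.Re x^* = complex.Re x by case: x.
have IJ (x : R[i]) : complex.Im x^* = - complex.Im x by case: x.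
split; under eq_fun do rewrite E; rewrite ?RJ ?IJ.
  by under eq_fun do rewrite RJ; exact: hr.
by under eq_fun do rewrite IJ; apply: cvgN; exact: hi.
Qed.

Lemma ev_real a (x : R) : (forall k, complex.Im (a k) = 0) -> entire a ->
  complex.Im (ev a x%:C) = 0.
Proof.
move=> ar ea; have := ev_conj x%:C ar ea; rewrite conjc_real.
case: (ev a x%:C) => p q [] /= h; lra.
Qed.

End EntireSeries.
Arguments ev_cvg {R} [a] z _.
Arguments cvgn_series_scale {R} c [u] _.

#[local] Opaque ev quo.

(** * The Gamma function *)

Section RealDerive.
Variable R : realType.
Implicit Types (f df : R -> R) (x a b d : R).

Lemma is_derive_cts f x d : is_derive x 1 f d -> {for x, continuous f}.
Proof.
move=> [h _]; apply: differentiable_continuous; exact/derivable1_diffP.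
Qed.

Lemma is_derive_within f df a b :
  (forall x, a <= x <= b -> is_derive x 1 f (df x)) ->
  {within `[a, b], continuous f}.
Proof.
move=> h; apply: derivable_within_continuous => x; rewrite in_itv /= => /h.
by case.
Qed.

Lemma is_derive_ge0_le f df a b : a <= b ->
  (forall x, a <= x <= b -> is_derive x 1 f (df x)) ->
  (forall x, a <= x <= b -> 0 <= df x) -> f a <= f b.
Proof.
move=> ab h h0.
have [|c cab E] := @MVT_segment _ f df a b ab _ (is_derive_within h).
  by move=> x; rewrite in_itv /= => /andP[ax xb]; apply: h; rewrite !ltW.
by rewrite -subr_ge0 E mulr_ge0 ?subr_ge0// h0.
Qed.

Lemma is_derive_le0_le f df a b : a <= b ->
  (forall x, a <= x <= b -> is_derive x 1 f (df x)) ->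
  (forall x, a <= x <= b -> df x <= 0) -> f b <= f a.
Proof.
move=> ab h h0; rewrite -lerN2.
apply: (@is_derive_ge0_le (fun x => - f x) (fun x => - df x)) => //.
  by move=> x /h hx; exact: is_deriveN.
by move=> x /h0; rewrite oppr_ge0.
Qed.

Lemma is_derive_expRc (c x : R) :
  is_derive x 1 (fun t => expR (c * t)) (c * expR (c * x)).
Proof.
have h : is_derive x 1 (fun t => c * t) c.
  have := is_deriveZ c (is_derive_id x (1 : R)).
  by rewrite /GRing.scale /= mulr1.
have := @is_derive1_comp _ expR (fun t => c * t) x _ _ (is_derive_expR _) h.
by rewrite mulrC.
Qed.

Lemma Rintegral_FTC f df a b : a < b ->
  (forall x, a <= x <= b -> is_derive x 1 f (df x)) ->
  {within `[a, b], continuous df} ->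
  \int[lebesgue_measure]_(t in `[a, b]) df t = f b - f a.
Proof.
move=> ab h cdf; rewrite /Rintegral (@continuous_FTC2 _ df f)//.
  split.
  - by move=> x; rewrite in_itv /= => /andP[ax xb]; have [] := h x _;
      rewrite ?(ltW ax) ?(ltW xb).
  - apply: cvg_at_right_filter; apply: is_derive_cts; apply: h.
    by rewrite lexx ltW.
  - apply: cvg_at_left_filter; apply: is_derive_cts; apply: h.
    by rewrite lexx ltW.
move=> x; rewrite in_itv /= => /andP[ax xb].
have [] := h x _; first by rewrite !ltW.
by rewrite derive1E.
Qed.

End RealDerive.

(** * Functional equation and positivity of Gamma *)

Section GammaFunction.
Variable R : realType.
Implicit Types (x t : R) (n : nat).

Local Notation mu := (@lebesgue_measure R).
Let ker x t := t `^ (x - 1) * expR (- t).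
(** These segments exhaust the half-line and stay away from 0, so the kernel is continuous on each
    of them even for x < 1. The segment of index 0 is the single point 1. *)
Let seg n : set R := `[n.+1%:R^-1, n.+1%:R]%classic.
Let GI n x := \int[mu]_(t in seg n) ker x t.

Let ker_ge0 x t : 0 <= ker x t.
Proof. by rewrite mulr_ge0 ?powR_ge0 ?expR_ge0. Qed.

Let segP n t : seg n t -> 0 < t.
Proof.
by rewrite /seg /= in_itv /= => /andP[+ _]; apply: lt_le_trans; rewrite invr_gt0.
Qed.

Lemma is_derive_expRN t : is_derive t 1 (fun u : R => expR (- u)) (- expR (- t)).
Proof.
have := is_derive_expRc (-1) t; rewrite !mulN1r.
by under eq_fun do rewrite mulN1r.
Qed.

Let mseg n : measurable (seg n : set (measurableTypeR R)).
Proof. exact: measurable_itv. Qed.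

Let ker_der x t : 0 < t -> is_derive t 1 (fun u => u `^ x * expR (- u))
  (x * ker x t - ker (x + 1) t).
Proof.
move=> t0.
apply: is_derive_eq (is_deriveM (is_derive1_powR x t0) (is_derive_expRN t)) _.
by rewrite /ker addrK /GRing.scale /=; ring.
Qed.

Let ker_cts n x : {within seg n, continuous (ker x)}.
Proof.
apply: (@is_derive_within _ _ (fun t => (x - 1) * ker (x - 1) t - ker (x - 1 + 1) t)).
move=> t h; apply: ker_der; apply: (@segP n).
by rewrite /seg /= in_itv.
Qed.

Let ker_int n x : mu.-integrable (seg n) (EFin \o ker x).
Proof.
by apply: continuous_compact_integrable; [exact: segment_compact|exact: ker_cts].
Qed.

Let GI0 x : GI 0 x = 0.
Proof. by rewrite /GI (_ : seg 0 = [set 1]) ?Rintegral_set1// /seg invr1 set_itv1. Qed.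

(** Integration by parts on one segment. The boundary terms are kept because the identity serves
    twice: for a bound when x is small, and in the limit for the functional equation. *)
Let GI_rec n x :
  x * GI n x - GI n (x + 1) =
  n.+1%:R `^ x * expR (- n.+1%:R) - n.+1%:R^-1 `^ x * expR (- n.+1%:R^-1).
Proof.
case: n => [|n]; first by rewrite !GI0 invr1; ring.
have i1 : mu.-integrable (seg n.+1) (EFin \o (fun t => x * ker x t)).
  exact: (integrableZl (mseg n.+1) x (ker_int n.+1 x)).
have -> : x * GI n.+1 x = \int[mu]_(t in seg n.+1) (x * ker x t).
  by rewrite (RintegralZl _ (mseg n.+1) (ker_int n.+1 x)).
rewrite /GI -(RintegralB (mseg n.+1) i1 (ker_int n.+1 (x + 1))).
apply: (@Rintegral_FTC _ (fun u => u `^ x * expR (- u))).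
- have n1 : 1 < n.+2%:R :> R by rewrite ltr1n ltnS.
  by rewrite (lt_trans _ n1)// invf_lt1// (lt_trans _ n1).
- by move=> t h; apply: ker_der; apply: (@segP n.+1); rewrite /seg /= in_itv.
- apply: is_derive_within => t h.
  have t0 : 0 < t by apply: (@segP n.+1); rewrite /seg /= in_itv.
  exact: (is_deriveB (is_deriveZ x (ker_der (x - 1) t0)) (ker_der (x + 1 - 1) t0)).
Qed.

Let mono_seg : nondecreasing_seq seg.
Proof.
move=> m n mn; apply/subsetPset => t; rewrite /seg /= !in_itv /= => /andP[h1 h2].
rewrite (le_trans _ h1) ?(le_trans h2) ?ler_nat ?ltnS//.
by rewrite lef_pV2 ?posrE// ler_nat ltnS.
Qed.

Let bigcup_seg : \bigcup_n seg n = `]0, +oo[%classic.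
Proof.
apply/seteqP; split => t /=.
  by move=> [n _] /segP; rewrite in_itv /= andbT.
rewrite in_itv /= andbT => t0.
have [n nt] : exists n, Num.max t t^-1 <= n.+1%:R.
  exists (Num.truncn (Num.max t t^-1)).
  by rewrite ltW// truncnS_gt.
move: nt; rewrite ge_max => /andP[h1 h2]; exists n => //.
rewrite /seg /= in_itv /= h1 andbT -[leRHS]invrK lef_pV2 ?posrE ?invr_gt0//.
Qed.

Let GI_cvgE x : (GI n x)%:E @[n --> \oo] -->
  (\int[mu]_(t in `]0%R, +oo[) (ker x t)%:E)%E.
Proof.
rewrite -bigcup_seg.
rewrite (_ : (fun n => _) = (fun n => \int[mu]_(t in seg n) (ker x t)%:E)%E).
  2: by apply/funext => m; rewrite /GI /Rintegral fineK//; apply: integrable_fin_num; [exact: mseg|exact: ker_int].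
apply: ge0_nondecreasing_set_cvg_integral => //.
- by move=> n; have /integrableP[] := ker_int n x.
- by move=> n t _; rewrite lee_fin.
Qed.

(** A bound on the truncated integrals makes the extended-real integral finite; an infinite one
    would be sent to the default value 0 by [Gamma]. *)
Let Gamma_cvg x (M : R) : (forall n, GI n x <= M) ->
  GI n x @[n --> \oo] --> Gamma x.
Proof.
move=> GM; have h := @GI_cvgE x.
have fin : (\int[mu]_(t in `]0%R, +oo[) (ker x t)%:E)%E \is a fin_num.
  rewrite ge0_fin_numE; last by apply: integral_ge0 => t _; rewrite lee_fin.
  rewrite (le_lt_trans _ (ltry M))// -(cvg_lim _ h)//.
  apply: lime_le; first by apply/cvg_ex; eexists; exact: h.
  by apply: nearW => n; rewrite lee_fin.
have := @fine_cvg R _ _ _ (fun n => (GI n x)%:E) (Gamma x). by apply; rewrite /Gamma /Rintegral fineK.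
Qed.

(** t^x <= 1 + t^m for an integer m >= x, and t^m is bounded by the m-th term of the exponential
    series at t / 2. The half exponent leaves e^(-t/2) for integration. *)
Let powR_le_exp x : 0 <= x -> exists2 C : R, 0 < C &
  forall t, 0 < t -> t `^ x <= C * expR (t / 2).
Proof.
move=> x0; pose m := (Num.truncn x).+1.
have xm : x <= m%:R by rewrite ltW// truncnS_gt.
have m0 : 0 < m`!%:R :> R by rewrite ltr0n fact_gt0.
exists (1 + 2 ^+ m * m`!%:R) => [|t t0].
  by rewrite ltr_pwDl// mulr_ge0// exprn_ge0.
have t20 : 0 <= t / 2 by rewrite divr_ge0// ltW.
have e1 : 1 <= expR (t / 2) by rewrite -[leLHS](@expR0 R) ler_expR.
have tm : t `^ x <= 1 + t ^+ m.
  have [t1|t1] := leP t 1.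
    rewrite (le_trans (_ : _ <= 1))//; last by rewrite lerDl exprn_ge0// ltW.
    by rewrite -(powRr0 t) ger_powR// t0.
  rewrite (le_trans (_ : _ <= t `^ m%:R))//; first by rewrite ler_powR// ltW.
  by rewrite powR_mulrn ?ltW// ltrDr.
apply: (le_trans tm); rewrite mulrDl mul1r lerD//.
have h : 1 + (t / 2) ^+ m / m`!%:R <= expR (t / 2) by exact: expR_ge1Dxn.
have {}h : (t / 2) ^+ m / m`!%:R <= expR (t / 2).
  by rewrite (le_trans _ h)// lerDr.
rewrite ler_pdivrMr// expr_div_n ler_pdivrMr ?exprn_gt0// in h.
by rewrite (le_trans h)// le_eqVlt; apply/orP; left; apply/eqP; ring.
Qed.

Let GI_bound1 x : 1 <= x -> exists M, forall n, GI n x <= M.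
Proof.
move=> x1; have [|C C0 hC] := @powR_le_exp (x - 1); first by rewrite subr_ge0.
exists (C * 2) => n.
have kle t : 0 < t -> ker x t <= C * expR (- 2^-1 * t).
  move=> t0; rewrite /ker (le_trans (ler_wpM2r (expR_ge0 _) (hC _ t0)))//.
  rewrite -mulrA -expRD ler_wpM2l ?(ltW C0)// ler_expR; lra.
have dF (t : R) : is_derive t 1 (fun u => - 2 * C * expR (- 2^-1 * u))
    (C * expR (- 2^-1 * t)).
  have := is_deriveZ (- 2 * C) (is_derive_expRc (- 2^-1) t).
  move=> h; apply: is_derive_eq h _; by rewrite /GRing.scale /=; field.
have cF : {within seg n, continuous (fun t => C * expR (- 2^-1 * t))}.
  apply: (@is_derive_within _ _ (fun t => C * (- 2^-1 * expR (- 2^-1 * t)))) => u _.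
  exact: (is_deriveZ C (is_derive_expRc (- 2^-1) u)).
have h : GI n x <= \int[mu]_(t in seg n) (C * expR (- 2^-1 * t)).
  apply: (le_Rintegral (mseg n) (ker_int n x)).
    by apply: continuous_compact_integrable => //; exact: segment_compact.
  by move=> u /segP; exact: kle.
apply: (le_trans h); move: cF {h}.
case: n => [|n] cF.
  have -> : seg 0 = [set 1].
    by rewrite /seg invr1 set_itv1.
  by rewrite Rintegral_set1 mulr_ge0// ltW.
rewrite (@Rintegral_FTC _ (fun u => - 2 * C * expR (- 2^-1 * u)))//; last first.
  have n1 : 1 < n.+2%:R :> R by rewrite ltr1n ltnS.
  by rewrite (lt_trans _ n1)// invf_lt1// (lt_trans _ n1).
have e1 : 0 < expR (- 2^-1 * n.+2%:R :> R) by exact: expR_gt0.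
have e2 : expR (- 2^-1 * n.+2%:R^-1 : R) <= 1.
  by rewrite -[leRHS]expR0 ler_expR mulNr oppr_le0 mulr_ge0.
nra.
Qed.

(** For x < 1 the kernel is singular at 0; [GI_rec] reduces the question to x + 1 >= 1. *)
Let GI_bound x : 0 < x -> exists M, forall n, GI n x <= M.
Proof.
move=> x0; have [|M hM] := @GI_bound1 (x + 1); first by rewrite lerDr ltW.
have [C C0 hC] := powR_le_exp (ltW x0).
exists ((`|M| + C) / x) => -[|n].
  by rewrite GI0 divr_ge0 ?addr_ge0// ?ltW.
rewrite ler_pdivlMr// mulrC -lerBlDl -(subrK (GI n.+1 (x + 1)) (x * _)).
have := @GI_rec n.+1 x; set g1 := GI _ x; set g2 := GI _ _ => ->.
have hM' : g2 <= `|M| by rewrite (le_trans (hM n.+1))// ler_norm.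
have : n.+2%:R `^ x * expR (- n.+2%:R) <= C.
  rewrite (le_trans (ler_wpM2r (expR_ge0 _) (hC _ (ltr0Sn _ _))))//.
  rewrite -mulrA -expRD -[leRHS]mulr1 ler_wpM2l ?(ltW C0)//.
  rewrite -[leRHS](@expR0 R) ler_expR; have : 0 <= n.+2%:R :> R by []. lra.
have : 0 <= n.+2%:R^-1 `^ x * expR (- n.+2%:R^-1) :> R.
  by rewrite mulr_ge0 ?powR_ge0 ?expR_ge0.
lra.
Qed.

Lemma GammaS x : 0 < x -> Gamma (x + 1) = x * Gamma x.
Proof.
move=> x0; have [M hM] := GI_bound x0.
have [|M1 hM1] := @GI_bound (x + 1); first by rewrite addr_gt0.
have h1 := Gamma_cvg hM; have h2 := Gamma_cvg hM1.
have [C C0 hC] := powR_le_exp (ltW x0).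
have b1 : (n.+1%:R `^ x * expR (- n.+1%:R) : R) @[n --> \oo] --> 0.
  apply: (@squeeze_cvgr _ _ _ _ (fun=> 0) (fun n => C * expR (- 2^-1) ^+ n)).
  - apply: nearW => n; rewrite mulr_ge0 ?powR_ge0 ?expR_ge0//=.
    rewrite (le_trans (ler_wpM2r (expR_ge0 _) (hC _ (ltr0Sn _ _))))//.
    rewrite -mulrA -expRD ler_wpM2l ?(ltW C0)// -expRM_natl ler_expR.
    rewrite -[n.+1]addn1 natrD; have : 0 <= n%:R :> R by []. lra.
  - exact: cvg_cst.
  - rewrite -[X in _ --> X](mulr0 C); apply: cvgMr; apply: cvg_expr.
    by rewrite ger0_norm ?expR_ge0// expR_lt1; lra.
have b2 : (n.+1%:R^-1 `^ x * expR (- n.+1%:R^-1) : R) @[n --> \oo] --> 0.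
  apply: (@squeeze_cvgr _ _ _ _ (fun=> 0) (fun n => n.+1%:R^-1 `^ x)).
  - apply: nearW => n; rewrite mulr_ge0 ?powR_ge0 ?expR_ge0//=.
    rewrite -[leRHS]mulr1 ler_wpM2l ?powR_ge0//.
  - exact: cvg_cst.
  - have /cvg_at_rightP := @powR_cvg0 R x x0; apply; split=> //.
    exact: cvg_harmonic.
have h3 : x * GI n x - GI n (x + 1) @[n --> \oo] --> x * Gamma x - Gamma (x + 1).
  by apply: cvgB h2; exact: cvgMr.
have : x * GI n x - GI n (x + 1) @[n --> \oo] --> 0.
  by under eq_fun do rewrite GI_rec; rewrite -(subrr 0); exact: cvgB.
move=> /(@cvg_lim _ (@norm_hausdorff _ R) _ _ _) h5.
move/(@cvg_lim _ (@norm_hausdorff _ R) _ _ _) : h3; rewrite h5.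
by move=> /esym/eqP; rewrite subr_eq0 eq_sym => /eqP.
Qed.

Lemma Gamma_gt0 x : 0 < x -> 0 < Gamma x.
Proof.
move=> x0; have [M hM] := GI_bound x0; have h1 := Gamma_cvg hM.
have lt12 : 2^-1 < 2 :> R by lra.
(* [seg 1] is the interval from 1/2 to 2; the minimum of the kernel there is positive and bounds all
   later truncations from below. *)
have [c cs hc] := @EVT_min R (ker x) _ _ (ltW lt12) (@ker_cts 1%N x).
have k0 : 0 < ker x c.
  rewrite mulr_gt0 ?expR_gt0// powR_gt0//.
  by apply: (@segP 1); move: cs; rewrite in_itv /= /seg /= in_itv.
have g1 : 0 < GI 1 x.
  apply: (@lt_le_trans _ _ (\int[mu]_(t in seg 1) (ker x c))).
    rewrite Rintegral_cst /seg//= lebesgue_measure_itv/= lte_fin lt12.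
    by rewrite mulr_gt0//= subr_gt0.
  have ic : mu.-integrable (seg 1) (EFin \o (fun=> ker x c)).
    apply: continuous_compact_integrable; first exact: segment_compact.
    by move=> t; exact: cvg_cst.
  apply: (le_Rintegral (mseg 1) ic (ker_int 1 x)) => t ts.
  by apply: hc; move: ts; rewrite /seg /=.
rewrite (lt_le_trans g1)// -(cvg_lim _ h1)//.
apply: limr_ge; first by apply/cvg_ex; eexists; exact: h1.
near=> n; rewrite /GI.
rewrite -lee_fin /Rintegral !fineK ?(integrable_fin_num _ (ker_int _ x))//.
apply: ge0_subset_integral => //.
- by have /integrableP[] := ker_int n x.
- by move=> t _; rewrite lee_fin.
- by apply/subsetPset; apply: mono_seg; near: n; exact: nbhs_infty_ge.
Unshelve. all: by end_near. Qed.

End GammaFunction.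

(** * The maximum principle for quotients *)

Section MaximumPrinciple.
Variable R : realType.
Implicit Types (N Q : nat -> R[i]) (z w c d : R[i]).

Lemma dist_nc (u v : R[i]) : `|nc u - nc v| <= nc (u - v).
Proof.
rewrite ler_norml; have := ler_ncB u v; have := ler_ncB v u.
by rewrite (ncC v u); lra.
Qed.

(** One Taylor step for N/Q at w: N - cQ vanishes at w, hence is divisible by z - w as an entire
    series. Three such steps give [quot_jet], with no series for the quotient itself. *)
Lemma quot_step N Q w : entire N -> entire Q -> ev Q w != 0 ->
  exists c N1, [/\ entire N1, c = ev N w / ev Q w &
    forall z, ev N z = c * ev Q z + (z - w) * ev N1 z].
Proof.
move=> eN eQ Qw; pose c := ev N w / ev Q w.
pose M := fun k => N k + - c * Q k.
have eM : entire M by apply: entire_add => //; exact: entire_scale.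
have ME z : ev M z = ev N z - c * ev Q z.
  by rewrite ev_add ?ev_scale ?mulNr//; exact: entire_scale.
exists c, (quo M w); split => //; first exact: entire_quo.
have cE : ev N w = c * ev Q w by rewrite divfK.
have alg (a b d e g : R[i]) : d = c * e -> a - c * b = d - c * e + g -> a = c * b + g.
  by move=> -> ; rewrite subrr add0r => <-; rewrite addrC subrK.
by move=> z; apply: alg cE _; rewrite -!ME; exact: ev_quo.
Qed.

Lemma ev_neq0_near Q w : entire Q -> ev Q w != 0 -> exists2 e : R, 0 < e &
  forall d, nc d <= e -> nc (ev Q w) / 2 <= nc (ev Q (w + d)).
Proof.
move=> eQ Qw; have [K K0 hK] := ev_locbound w (entire_quo w eQ).
have q0 : 0 < nc (ev Q w) by rewrite nc_gt0.
exists (Num.min 1 (nc (ev Q w) / (2 * K))).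
  by rewrite lt_min ltr01 divr_gt0// mulr_gt0.
move=> d; rewrite le_min => /andP[d1 d2].
rewrite (ev_quo w (w + d) eQ) addrAC subrr add0r.
have h : nc (d * ev (quo Q w) (w + d)) <= nc (ev Q w) / 2.
  rewrite ncM (@le_trans _ _ (nc (ev Q w) / (2 * K) * K))//.
    apply: ler_pM; rewrite ?nc_ge0// hK//.
    by rewrite addrAC subrr add0r.
  by rewrite le_eqVlt; apply/orP; left; apply/eqP; field; rewrite gt_eqF.
have := ler_ncB (ev Q w) (- (d * ev (quo Q w) (w + d))).
rewrite opprK ncN; lra.
Qed.

Lemma quot_jet N Q w : entire N -> entire Q -> ev Q w != 0 ->
  exists (c1 c2 : R[i]) (e K : R), [/\ 0 < e, e <= 1, 0 < K &
    forall d, nc d <= e -> ev Q (w + d) != 0 /\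
    nc (ev N (w + d) / ev Q (w + d) - (ev N w / ev Q w + c1 * d + c2 * d ^+ 2))
      <= K * nc d ^+ 3].
Proof.
move=> eN eQ Qw.
have [c0 [N1 [eN1 c0E h0]]] := quot_step eN eQ Qw.
have [c1 [N2 [eN2 _ h1]]] := quot_step eN1 eQ Qw.
have [c2 [N3 [eN3 _ h2]]] := quot_step eN2 eQ Qw.
have [e e0 he] := ev_neq0_near eQ Qw.
have [K K0 hK] := ev_locbound w eN3.
have q0 : 0 < nc (ev Q w) by rewrite nc_gt0.
exists c1, c2, (Num.min 1 e), (K * (2 / nc (ev Q w))); split.
- by rewrite lt_min ltr01.
- by rewrite ge_min lexx.
- by rewrite mulr_gt0// divr_gt0.
move=> d; rewrite le_min => /andP[d1 de].
have qd : 0 < nc (ev Q (w + d)) by rewrite (lt_le_trans _ (he _ de))// divr_gt0.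
have Qd : ev Q (w + d) != 0 by rewrite -nc_gt0.
split=> //; rewrite -c0E h0 h1 h2.
have -> : w + d - w = d by ring.
set q := ev Q _ in qd Qd *; set n := ev N3 _.
have -> : (c0 * q + d * (c1 * q + d * (c2 * q + d * n))) / q -
    (c0 + c1 * d + c2 * d ^+ 2) = d ^+ 3 * (n / q) by field.
rewrite ncM ncX mulrC ler_wpM2r ?exprn_ge0 ?nc_ge0// ncM ncV.
apply: ler_pM; rewrite ?invr_ge0 ?nc_ge0//.
  by apply: hK; rewrite addrAC subrr add0r.
have q2 : 0 < nc (ev Q w) / 2 by rewrite divr_gt0.
have -> : 2 / nc (ev Q w) = (nc (ev Q w) / 2)^-1 by rewrite invf_div.
have -> : ((nc q)^-1 <= (nc (ev Q w) / 2)^-1) = (nc (ev Q w) / 2 <= nc q).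
  by apply: lef_pV2.
exact: he.
Qed.

(** The arithmetic behind [Laplacian_test]: h and the b's are |N/Q| at w and at four neighbours, w2
    and the a's the squared moduli of these points. Adding up gives e t2 <= k, although k is at most
    half of e t2. *)
Let four_point (h b1 b2 b3 b4 a1 a2 a3 a4 e w2 t2 k : R) :
  k <= e / 2 * t2 -> 0 < e * t2 ->
  a1 + a2 + a3 + a4 = 4 * w2 + 4 * t2 ->
  b4 <= h + e * w2 - e * a4 -> b3 <= h + e * w2 - e * a3 ->
  b2 <= h + e * w2 - e * a2 -> b1 <= h + e * w2 - e * a1 ->
  h *+ 4 <= 4 * k + (b1 + b2 + b3 + b4) -> False.
Proof.
move=> tt et aE s4 s3 s2 s1; rewrite -mulr_natr => s5.
have : e * (a1 + a2 + a3 + a4) = e * (4 * w2 + 4 * t2) by rewrite aE.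
rewrite !mulrDr => E.
have E' : e * (4 * w2) = 4 * (e * w2) by ring.
have E2 : e * (4 * t2) = 4 * (e * t2) by ring.
have E3 : e / 2 * t2 = (e * t2) / 2 by field.
rewrite E3 in tt; rewrite E' E2 in E.
move: (e * a1) (e * a2) (e * a3) (e * a4) (e * w2) (e * t2)
  s1 s2 s3 s4 s5 E tt et => *; lra.
Qed.

(** The mean over w + t, w - t, w + it, w - it kills the terms of the jet in d and d^2, since t^2
    and (it)^2 are opposite. So |N/Q| at w exceeds the mean over the neighbours by at most K t^3,
    whereas the mean of e|z|^2 exceeds its value at w by e t^2. *)
Lemma Laplacian_test N Q w (e r : R) : entire N -> entire Q ->
  ev Q w != 0 -> 0 < e -> nc w < r ->
  ~ (forall z, nc z <= r -> nc (ev N z / ev Q z) + e * nc z ^+ 2 <=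
       nc (ev N w / ev Q w) + e * nc w ^+ 2).
Proof.
move=> eN eQ Qw e0 wr hmax.
have [c1 [c2 [dl [K [dl0 dl1 K0 hj]]]]] := quot_jet eN eQ Qw.
(* The three bounds keep the jet valid, keep the neighbours in the disc, and make K t^3 at most half
   of e t^2. *)
pose t := Num.min (Num.min dl (r - nc w)) (e / (2 * K)).
have t0 : 0 < t by rewrite !lt_min dl0 subr_gt0 wr divr_gt0// mulr_gt0.
have tdl : t <= dl by rewrite !ge_min lexx.
have tr : t <= r - nc w by rewrite !ge_min lexx orbT.
have tK : t <= e / (2 * K) by rewrite ge_min lexx orbT.
have step d : nc d = t ->
    nc (ev N (w + d) / ev Q (w + d)) <=
    nc (ev N w / ev Q w) + e * nc w ^+ 2 - e * nc (w + d) ^+ 2.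
  move=> dt; rewrite -lerBDr opprK; apply: hmax.
  by rewrite (le_trans (ncD _ _))// dt -lerBrDl.
have jet d : nc d = t -> nc (ev N (w + d) / ev Q (w + d) -
    (ev N w / ev Q w + c1 * d + c2 * d ^+ 2)) <= K * t ^+ 3.
  by move=> dt; rewrite -[in leRHS]dt; apply: (hj _ _).2; rewrite dt.
have n1 : nc t%:C = t by rewrite nc_real gtr0_norm.
have n2 : nc (- t%:C) = t by rewrite ncN.
have n3 : nc (t *i) = t by rewrite /nc /= expr0n add0r sqrtr_sqr gtr0_norm.
have n4 : nc (- t *i) = t by rewrite ncN.
have i2 : t *i ^+ 2 = - (t%:C ^+ 2).
  rewrite !expr2; apply/eqP; rewrite eq_complex /=.
  by apply/andP; split; apply/eqP; ring.
have S (v u1 u2 u3 u4 x y : R[i]) : y ^+ 2 = - (x ^+ 2) ->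
    v *+ 4 = - ((u1 - (v + c1 * x + c2 * x ^+ 2)) +
       (u2 - (v + c1 * (- x) + c2 * (- x) ^+ 2)) +
       (u3 - (v + c1 * y + c2 * y ^+ 2)) +
       (u4 - (v + c1 * (- y) + c2 * (- y) ^+ 2))) + (u1 + u2 + u3 + u4).
  by rewrite !sqrrN => ->; rewrite -mulr_natr; ring.
have tri (a b c' d' : R[i]) : nc (a + b + c' + d') <= nc a + nc b + nc c' + nc d'.
  rewrite (le_trans (ncD _ _))// lerD2r (le_trans (ncD _ _))// lerD2r.
  exact: ncD.
have s5 : nc (ev N w / ev Q w) *+ 4 <= 4 * (K * t ^+ 3) +
    (nc (ev N (w + t%:C) / ev Q (w + t%:C)) + nc (ev N (w - t%:C) / ev Q (w - t%:C)) +
     nc (ev N (w + t *i) / ev Q (w + t *i)) + nc (ev N (w - t *i) / ev Q (w - t *i))).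
  rewrite -normcMn (S _ (ev N (w + t%:C) / ev Q (w + t%:C))
    (ev N (w - t%:C) / ev Q (w - t%:C)) (ev N (w + t *i) / ev Q (w + t *i))
    (ev N (w - t *i) / ev Q (w - t *i)) _ _ i2).
  rewrite (le_trans (ncD _ _))// lerD ?tri// ncN (le_trans (tri _ _ _ _))//.
  have := jet _ n1; have := jet _ n2; have := jet _ n3; have := jet _ n4.
  move=> h4 h3 h2 h1.
  have -> : 4 * (K * t ^+ 3) = K * t ^+ 3 + K * t ^+ 3 + K * t ^+ 3 + K * t ^+ 3.
    by ring.
  by rewrite !lerD.
have aE : nc (w + t%:C) ^+ 2 + nc (w - t%:C) ^+ 2 + nc (w + t *i) ^+ 2 +
    nc (w - t *i) ^+ 2 = 4 * nc w ^+ 2 + 4 * t ^+ 2.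
  by rewrite !sqr_nc !(cReD, cImD, cReN, cImN) /=; ring.
have tt : K * t ^+ 3 <= e / 2 * t ^+ 2.
  rewrite exprS mulrA ler_wpM2r ?sqr_ge0// mulrC -ler_pdivlMr//.
  by rewrite (le_trans tK)// invfM mulrA.
have et : 0 < e * t ^+ 2 by rewrite mulr_gt0// exprn_gt0.
exact: (four_point tt et aE (step _ n4) (step _ n3) (step _ n2) (step _ n1) s5).
Qed.

Lemma jet_lipschitz (u v c1 c2 d : R[i]) (K : R) : 0 <= K -> nc d <= 1 ->
  nc (u - (v + c1 * d + c2 * d ^+ 2)) <= K * nc d ^+ 3 ->
  nc (u - v) <= (nc c1 + nc c2 + K) * nc d.
Proof.
move=> K0 d1 hd.
have -> : u - v = (u - (v + c1 * d + c2 * d ^+ 2)) + (c1 * d + c2 * d ^+ 2) by ring.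
rewrite (le_trans (ncD _ _))// mulrDl addrC lerD//.
  rewrite (le_trans (ncD _ _))// !ncM mulrDl lerD2l ler_wpM2l ?nc_ge0//.
  by rewrite ler_piMr ?nc_ge0.
rewrite (le_trans hd)// ler_wpM2l// exprS.
by rewrite ler_piMr ?nc_ge0// exprn_ile1 ?nc_ge0.
Qed.

(** Points of the plane as real pairs: the disc is then compact as a closed subset of a product of
    segments. *)
Let toC (p : R * R) : R[i] := p.1 +i* p.2.

Lemma quot_cts N Q (p : R * R) : entire N -> entire Q -> ev Q (toC p) != 0 ->
  (fun q => nc (ev N (toC q) / ev Q (toC q))) q @[q --> p] -->
    nc (ev N (toC p) / ev Q (toC p)).
Proof.
move=> eN eQ Qp.
have [c1 [c2 [dl [K [dl0 dl1 K0 hj]]]]] := quot_jet eN eQ Qp.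
pose L := nc c1 + nc c2 + K.
have L0 : 0 < L by rewrite ltr_wpDl// addr_ge0// nc_ge0.
apply/cvgrPdist_lt => e e0.
have e1 : 0 < Num.min dl (e / (2 * L)) / 2.
  by rewrite divr_gt0// lt_min dl0 divr_gt0// mulr_gt0.
have c_1 : q.1 @[q --> p] --> p.1 by exact: cvg_fst.
have c_2 : q.2 @[q --> p] --> p.2 by exact: cvg_snd.
have near1 := (cvgrPdist_lt _ _).1 c_1 _ e1.
have near2 := (cvgrPdist_lt _ _).1 c_2 _ e1.
near=> q.
have d1 : `|p.1 - q.1| < Num.min dl (e / (2 * L)) / 2 by near: q; exact: near1.
have d2 : `|p.2 - q.2| < Num.min dl (e / (2 * L)) / 2 by near: q; exact: near2.
pose d := toC q - toC p.
have qE : toC q = toC p + d by rewrite /d addrC subrK.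
have dn : nc d < Num.min dl (e / (2 * L)).
  rewrite (le_lt_trans (nc_le _))// /d !(cReD, cImD, cReN, cImN) /toC /= [ltRHS]splitr.
  by rewrite ltrD// distrC.
move: dn; rewrite lt_min => /andP[ddl de].
have [_ hd] := hj d (ltW ddl).
rewrite qE.
have nd1 : nc d <= 1 by rewrite (le_trans (ltW ddl)).
have h := jet_lipschitz (ltW K0) nd1 hd.
have hL : L * nc d < e.
  rewrite mulrC -ltr_pdivlMr// (lt_le_trans de)// ler_wpM2l ?(ltW e0)//.
  by rewrite lef_pV2 ?posrE ?mulr_gt0// ler_peMl ?(ltW L0)// ler1n.
rewrite distrC; apply: le_lt_trans (dist_nc _ _) _.
exact: le_lt_trans h hL.
Unshelve. all: by end_near. Qed.

(* A maximum of |N/Q| + e|z|^2 cannot be interior, by [Laplacian_test]. *)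
Lemma maximum_principle N Q (r M : R) : entire N -> entire Q -> 0 < r ->
  (forall z, nc z <= r -> ev Q z != 0) ->
  (forall z, nc z = r -> nc (ev N z / ev Q z) <= M) ->
  forall z, nc z <= r -> nc (ev N z / ev Q z) <= M.
Proof.
move=> eN eQ r0 Q0 hM z zr; rewrite leNgt; apply/negP => Mz.
pose h w := nc (ev N w / ev Q w).
(* With this e, e r^2 is half of the excess of h z over M, which excludes a maximum on the boundary
   circle as well. *)
pose e := (h z - M) / (2 * r ^+ 2).
have r20 : 0 < r ^+ 2 by rewrite exprn_gt0.
have e0 : 0 < e by rewrite divr_gt0 ?subr_gt0// mulr_gt0.
pose D := [set p : R * R | p.1 ^+ 2 + p.2 ^+ 2 <= r ^+ 2].
have DE p : D p <-> nc (toC p) <= r.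
  have -> : (nc (toC p) <= r) = (nc (toC p) ^+ 2 <= r ^+ 2).
    by rewrite ler_pXn2r ?nnegrE ?nc_ge0 ?(ltW r0).
  by rewrite sqr_nc.
have csq (p : R * R) : (q.1 ^+ 2 + q.2 ^+ 2 : R) @[q --> p] --> p.1 ^+ 2 + p.2 ^+ 2.
  by apply: cvgD; rewrite !expr2; apply: cvgM;
    (exact: cvg_fst || exact: cvg_snd).
pose phi (p : R * R) := h (toC p) + e * (p.1 ^+ 2 + p.2 ^+ 2).
have cD : compact D.
  apply: (@subclosed_compact _ _ (`[- r, r]%classic `*` `[- r, r]%classic)).
  - rewrite (_ : D = (fun p : R * R => p.1 ^+ 2 + p.2 ^+ 2) @^-1` [set x | x <= r ^+ 2])//.
    apply: preimage_closed; last exact: closed_le.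
    by move=> p _; exact: csq.
  - by apply: compact_setX; exact: segment_compact.
  - move=> p Dp; have pr : nc (toC p) <= r by apply/DE.
    split => /=; rewrite in_itv /= -ler_norml (le_trans _ pr)//.
      exact: (nc_Re (toC p)).
    exact: (nc_Im (toC p)).
have cphi : {within D, continuous phi}.
  apply: continuous_in_subspaceT => p; rewrite inE => /DE pr.
  apply: cvgD; first exact: quot_cts eN eQ (Q0 _ pr).
  by apply: cvgMr; exact: csq.
have zD : D (complex.Re z, complex.Im z).
  by apply/DE; rewrite /toC /=; case: (z) zr.
have [|p0 /[!inE] Dp0 hp0] := compact_EVT_max _ cD cphi.
  by exists (complex.Re z, complex.Im z).
have p0r : nc (toC p0) <= r by apply/DE.
have hmax w : nc w <= r -> h w + e * nc w ^+ 2 <= h (toC p0) + e * nc (toC p0) ^+ 2.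
  case: w => x y wr; have xyD : D (x, y) by apply/DE.
  have := hp0 (x, y); rewrite /phi inE !sqr_nc => /(_ xyD).
  by rewrite /toC /=.
have [p0r'|p0r'] := ltP (nc (toC p0)) r.
  exact: (Laplacian_test eN eQ (Q0 _ p0r) e0 p0r' hmax).
have p0E : nc (toC p0) = r by apply/eqP; rewrite eq_le p0r.
have h1 := hmax _ zr; rewrite p0E in h1.
have h2 : h (toC p0) <= M := hM _ p0E.
have h3 : e * r ^+ 2 = (h z - M) / 2 by rewrite /e; field; rewrite gt_eqF.
have h4 : 0 <= e * nc z ^+ 2 by rewrite mulr_ge0 ?(ltW e0)// sqr_ge0.
have h5 : M < h z := Mz.
rewrite h3 in h1; move: (h z) (h (toC p0)) (e * nc z ^+ 2) h1 h2 h4 h5.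
by clear=> x y w *; lra.
Qed.

End MaximumPrinciple.

(** * Solutions of the Bessel equation along an arc *)

Section DeriveRules.
Variable R : realType.
Implicit Types (f g : R -> R) (t a b c : R).

Lemma derE f t a b : is_derive t 1 f a -> a = b -> is_derive t 1 f b.
Proof. by move=> h <-. Qed.

Lemma der_cst c t : is_derive t 1 (fun=> c) 0.
Proof. exact: is_derive_cst. Qed.

Lemma der_id t : is_derive t 1 (fun u : R => u) 1.
Proof. exact: is_derive_id. Qed.

Lemma derD f g t a b : is_derive t 1 f a -> is_derive t 1 g b ->
  is_derive t 1 (fun u => f u + g u) (a + b).
Proof. exact: is_deriveD. Qed.

Lemma derB f g t a b : is_derive t 1 f a -> is_derive t 1 g b ->
  is_derive t 1 (fun u => f u - g u) (a - b).
Proof. exact: is_deriveB. Qed.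

Lemma derM f g t a b : is_derive t 1 f a -> is_derive t 1 g b ->
  is_derive t 1 (fun u => f u * g u) (f t * b + g t * a).
Proof. exact: is_deriveM. Qed.

Lemma derZ c f t a : is_derive t 1 f a -> is_derive t 1 (fun u => c * f u) (c * a).
Proof. exact: is_deriveZ. Qed.

Lemma derN f t a : is_derive t 1 f a -> is_derive t 1 (fun u => - f u) (- a).
Proof. exact: is_deriveN. Qed.

Lemma derX2 f t a : is_derive t 1 f a ->
  is_derive t 1 (fun u => f u ^+ 2) (2 * f t * a).
Proof. by move=> h; apply: derE (derM h h) _; ring. Qed.

Lemma der_exp f t a : is_derive t 1 f a ->
  is_derive t 1 (fun u => expR (f u)) (a * expR (f t)).
Proof.
move=> h; have := @is_derive1_comp _ expR f t _ _ (is_derive_expR _) h.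
by rewrite mulrC.
Qed.

End DeriveRules.

(* Along z = r e^(it), with q = q1 + i q2 a solution of the Bessel equation and
   p = q' + s q / z, the combinations A = p + i q and B = p - i q are up to a
   relative error O(1/r) pure exponentials e^(iz) and e^(-iz); here f has the
   same modulus as q. *)
Section ArcEstimate.
Variable R : realType.
Implicit Types t u v : R.
Variables (q1 q2 p1 p2 f1 f2 : R -> R) (r s k : R).
Hypothesis r1 : 1 <= r.
Let x t := r * cos t.
Let y t := r * sin t.
Hypothesis dq1 : forall t, is_derive t 1 q1 (- y t * p1 t - x t * p2 t + s * q2 t).
Hypothesis dq2 : forall t, is_derive t 1 q2 (x t * p1 t - y t * p2 t - s * q1 t).
Hypothesis dp1 : forall t, is_derive t 1 p1
  (s * p2 t + y t * q1 t + x t * q2 t + k / r * f1 t).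
Hypothesis dp2 : forall t, is_derive t 1 p2
  (- s * p1 t - (x t * q1 t - y t * q2 t) + k / r * f2 t).
Hypothesis ff : forall t, f1 t ^+ 2 + f2 t ^+ 2 = q1 t ^+ 2 + q2 t ^+ 2.

(** Squared moduli of A = p + iq and B = p - iq. As y' = x, their leading behaviour is e^(-2y) and
    e^(2y). *)
Let a2 t := (p1 t - q2 t) ^+ 2 + (p2 t + q1 t) ^+ 2.
Let b2 t := (p1 t + q2 t) ^+ 2 + (p2 t - q1 t) ^+ 2.
Let S t := a2 t + b2 t.
Let K := `|k|.
(** A Gronwall factor: the arc has length pi / 2 <= 2 in t, and the error rate K / r is at most
    K. *)
Let M := expR (2 * K).

Let r0 : 0 < r. Proof. exact: lt_le_trans r1. Qed.

Let rN0 : r != 0. Proof. by rewrite gt_eqF. Qed.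

Let K0 : 0 <= K. Proof. exact: normr_ge0. Qed.

Let Kr0 : 0 <= K / r. Proof. by rewrite divr_ge0// ltW. Qed.

Let M1 : 1 <= M. Proof. by rewrite -[leLHS](@expR0 R) ler_expR mulr_ge0. Qed.

Let M0 : 0 <= M. Proof. exact: expR_ge0. Qed.

Let krK (u v : R) : u <= v -> - u <= v -> k / r * u <= K / r * v.
Proof.
move=> uv nuv; rewrite /K; have ri : 0 <= r^-1 by rewrite invr_ge0 ltW.
have [k0|k0] := leP 0 k.
  by rewrite ger0_norm// ler_wpM2l// mulr_ge0.
rewrite ltr0_norm//; have -> : k / r * u = - k / r * - u by ring.
by rewrite ler_wpM2l// mulr_ge0// oppr_ge0 ltW.
Qed.

Let a2_ge0 t : 0 <= a2 t. Proof. by rewrite addr_ge0// sqr_ge0. Qed.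

Let b2_ge0 t : 0 <= b2 t. Proof. by rewrite addr_ge0// sqr_ge0. Qed.

Let S_ge0 t : 0 <= S t. Proof. by rewrite addr_ge0. Qed.

Let SE t : S t = 2 * (p1 t ^+ 2 + p2 t ^+ 2 + q1 t ^+ 2 + q2 t ^+ 2).
Proof. by rewrite /S /a2 /b2; ring. Qed.

Let qS t : q1 t ^+ 2 + q2 t ^+ 2 <= S t / 2.
Proof. rewrite SE; have := sqr_ge0 (p1 t); have := sqr_ge0 (p2 t); lra. Qed.

Let cs (a b c d : R) :
  2 * (a * c + b * d) <= a ^+ 2 + b ^+ 2 + (c ^+ 2 + d ^+ 2) /\
  - (2 * (a * c + b * d)) <= a ^+ 2 + b ^+ 2 + (c ^+ 2 + d ^+ 2).
Proof.
have h1 := addr_ge0 (sqr_ge0 (a - c)) (sqr_ge0 (b - d)).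
have h2 := addr_ge0 (sqr_ge0 (a + c)) (sqr_ge0 (b + d)).
have e1 : (a - c) ^+ 2 + (b - d) ^+ 2 =
  a ^+ 2 + b ^+ 2 + (c ^+ 2 + d ^+ 2) - 2 * (a * c + b * d) by ring.
have e2 : (a + c) ^+ 2 + (b + d) ^+ 2 =
  a ^+ 2 + b ^+ 2 + (c ^+ 2 + d ^+ 2) + 2 * (a * c + b * d) by ring.
rewrite e1 subr_ge0 in h1; rewrite e2 -[2 * _]opprK subr_ge0 in h2.
by split.
Qed.

Let dy t : is_derive t 1 y (x t).
Proof. exact: (derZ r (is_derive_sin t)). Qed.

Let da2 t : is_derive t 1 a2 (- 2 * x t * a2 t +
  k / r * (2 * ((p1 t - q2 t) * f1 t + (p2 t + q1 t) * f2 t))).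
Proof.
apply: derE (derD (derX2 (derB (dp1 t) (dq2 t))) (derX2 (derD (dp2 t) (dq1 t)))) _.
by rewrite /a2; ring.
Qed.

Let db2 t : is_derive t 1 b2 (2 * x t * b2 t +
  k / r * (2 * ((p1 t + q2 t) * f1 t + (p2 t - q1 t) * f2 t))).
Proof.
apply: derE (derD (derX2 (derD (dp1 t) (dq2 t))) (derX2 (derB (dp2 t) (dq1 t)))) _.
by rewrite /b2; ring.
Qed.

Let x_ge0 t : 0 <= t <= pi / 2 -> 0 <= x t.
Proof.
move=> /andP[t0 tp]; rewrite mulr_ge0 ?(ltW r0)// cos_ge0_pihalf// tp andbT.
by rewrite (le_trans _ t0)// oppr_le0 divr_ge0// pi_ge0.
Qed.

Let theta2 t : 0 <= t <= pi / 2 -> t <= 2.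
Proof.
move=> /andP[_ tp]; rewrite (le_trans tp)//.
by have [/andP[]] := pihalf_02_cos_pihalf R.
Qed.

Let sub_theta u t : 0 <= t <= pi / 2 -> 0 <= u <= t -> 0 <= u <= pi / 2.
Proof. by move=> /andP[_ tp] /andP[-> ut]; rewrite (le_trans ut). Qed.

Let y_le u t : 0 <= t <= pi / 2 -> 0 <= u <= t -> y u <= y t.
Proof.
move=> ht hu; have /andP[u0 ut] := hu.
apply: (is_derive_ge0_le ut (fun v _ => dy v)) => v /andP[uv vt].
by apply: x_ge0; apply: (sub_theta ht); rewrite vt (le_trans u0).
Qed.

(** Gronwall: S' <= (2x + K / r) S, because the main terms contribute 2x (b2 - a2) and f has the
    modulus of q. *)
Lemma arc_growth t : 0 <= t <= pi / 2 -> S t <= S 0 * M * expR (2 * y t).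
Proof.
move=> ht; have /andP[t0 tp] := ht.
have := @is_derive_le0_le R (fun u => S u * expR (- (2 * y u + K / r * u)))
  (fun u => S u * (- (2 * x u + K / r * 1) * expR (- (2 * y u + K / r * u))) +
    expR (- (2 * y u + K / r * u)) *
    ((- 2 * x u * a2 u + k / r * (2 * ((p1 u - q2 u) * f1 u + (p2 u + q1 u) * f2 u))) +
    (2 * x u * b2 u + k / r * (2 * ((p1 u + q2 u) * f1 u + (p2 u - q1 u) * f2 u)))))
  0 t t0.
rewrite /= => H.
have {}H : S t * expR (- (2 * y t + K / r * t)) <=
    S 0 * expR (- (2 * y 0 + K / r * 0)).
  apply: H => u hu.
    exact: (derM (derD (da2 u) (db2 u))
      (der_exp (derN (derD (derZ 2 (dy u)) (derZ (K / r) (der_id u)))))).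
  have xu := x_ge0 (sub_theta ht hu).
  have h : k / r * (4 * (p1 u * f1 u + p2 u * f2 u)) <= K / r * S u.
    have := cs (p1 u) (p2 u) (f1 u) (f2 u); rewrite ff => -[h1 h2].
    by apply: krK; rewrite SE; lra.
  have h2 : 0 <= x u * a2 u by rewrite mulr_ge0.
  set X := expR _.
  rewrite (_ : _ + _ = X * (- 4 * (x u * a2 u) +
    (k / r * (4 * (p1 u * f1 u + p2 u * f2 u)) - K / r * S u))); last first.
    by rewrite /S; field.
  by rewrite pmulr_rle0 ?expR_gt0//; lra.
rewrite /y sin0 !mulr0 addr0 oppr0 expR0 mulr1 expRN ler_pdivrMr ?expR_gt0// in H.
apply: (le_trans H); rewrite -[S 0 * M * _]mulrA ler_wpM2l// expRD mulrC ler_wpM2r ?expR_ge0//.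
rewrite ler_expR mulrC; apply: ler_pM => //; first exact: theta2.
by rewrite ler_pdivrMr// ler_peMr.
Qed.

Let S0M := S 0 * M.

Let S0M_ge0 : 0 <= S0M. Proof. by rewrite mulr_ge0// ltW// expR_gt0. Qed.

(** The rescaled b2 e^(-2y) changes only through the error term, at rate at most 2 (K / r) S
    e^(-2y); [arc_growth] bounds S e^(-2y), and t <= 2. *)
Let arc_b t : 0 <= t <= pi / 2 ->
  b2 0 - 4 * (K / r) * S0M <= b2 t * expR (- (2 * y t)).
Proof.
move=> ht; have /andP[t0 tp] := ht.
have := @is_derive_ge0_le R (fun u => b2 u * expR (- (2 * y u)) + (2 * (K / r) * S0M) * u)
  (fun u => b2 u * (- (2 * x u) * expR (- (2 * y u))) + expR (- (2 * y u)) *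
    (2 * x u * b2 u + k / r * (2 * ((p1 u + q2 u) * f1 u + (p2 u - q1 u) * f2 u)))
    + (2 * (K / r) * S0M) * 1) 0 t t0.
rewrite /= => H.
have {}H : b2 0 * expR (- (2 * y 0)) + (2 * (K / r) * S0M) * 0 <=
    b2 t * expR (- (2 * y t)) + (2 * (K / r) * S0M) * t.
  apply: H => u hu.
    exact: (derD (derM (db2 u) (der_exp (derN (derZ 2 (dy u))))) (derZ _ (der_id u))).
  have e0 : 0 < expR (- (2 * y u)) by exact: expR_gt0.
  have h : k / r * - (2 * ((p1 u + q2 u) * f1 u + (p2 u - q1 u) * f2 u)) <=
      K / r * (2 * S u).
    have := cs (p1 u + q2 u) (p2 u - q1 u) (f1 u) (f2 u).
    have := a2_ge0 u; have := S_ge0 u; have := qS u; rewrite -ff => h1 h2 h3.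
    have bS : b2 u = S u - a2 u by rewrite /S; ring.
    by rewrite -/(b2 u) bS => -[h4 h5]; apply: krK; lra.
  have h2 : expR (- (2 * y u)) * S u <= S0M.
    rewrite expRN mulrC ler_pdivrMr ?expR_gt0//; apply: arc_growth.
    exact: sub_theta ht hu.
  have h3 : K / r * (expR (- (2 * y u)) * S u) <= K / r * S0M by rewrite ler_wpM2l.
  have h4 : expR (- (2 * y u)) *
     (k / r * - (2 * ((p1 u + q2 u) * f1 u + (p2 u - q1 u) * f2 u))) <=
     expR (- (2 * y u)) * (K / r * (2 * S u)) by rewrite ler_wpM2l// ltW.
  have E : b2 u * (- (2 * x u) * expR (- (2 * y u))) + expR (- (2 * y u)) *
    (2 * x u * b2 u + k / r * (2 * ((p1 u + q2 u) * f1 u + (p2 u - q1 u) * f2 u)))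
    + (2 * (K / r) * S0M) * 1 = 2 * (K / r * S0M) -
     expR (- (2 * y u)) *
     (k / r * - (2 * ((p1 u + q2 u) * f1 u + (p2 u - q1 u) * f2 u))) by ring.
  have E2 : expR (- (2 * y u)) * (K / r * (2 * S u)) =
    2 * (K / r * (expR (- (2 * y u)) * S u)) by ring.
  by rewrite E; rewrite E2 in h4; lra.
rewrite {1}/y sin0 !mulr0 oppr0 expR0 mulr1 addr0 in H.
have h5 : K / r * S0M * t <= K / r * S0M * 2.
  by rewrite ler_wpM2l ?theta2//; exact: mulr_ge0.
have E : 2 * (K / r) * S0M * t = 2 * (K / r * S0M * t) by ring.
by rewrite E in H; lra.
Qed.

(** The main term -2x a2 is dropped, being nonpositive. The error rate is bounded by its value with
    y taken at the end of the arc, where y is largest. *)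
Let arc_a t : 0 <= t <= pi / 2 ->
  a2 t <= a2 0 + 4 * (K / r) * S0M * expR (2 * y t).
Proof.
move=> ht; have /andP[t0 tp] := ht.
pose L := 2 * (K / r) * S0M * expR (2 * y t).
have := @is_derive_le0_le R (fun u => a2 u - L * u)
  (fun u => - 2 * x u * a2 u + k / r * (2 * ((p1 u - q2 u) * f1 u + (p2 u + q1 u) * f2 u))
    - L * 1) 0 t t0.
rewrite /= => H.
have {}H : a2 t - L * t <= a2 0 - L * 0.
  apply: H => u hu.
    exact: (derB (da2 u) (derZ L (der_id u))).
  have h : k / r * (2 * ((p1 u - q2 u) * f1 u + (p2 u + q1 u) * f2 u)) <=
      K / r * (2 * S u).
    have := cs (p1 u - q2 u) (p2 u + q1 u) (f1 u) (f2 u).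
    have := b2_ge0 u; have := S_ge0 u; have := qS u; rewrite -ff => h1 h2 h3.
    have bS : a2 u = S u - b2 u by rewrite /S; ring.
    by rewrite -/(a2 u) bS => -[h4 h5]; apply: krK; lra.
  have hu' := sub_theta ht hu.
  have h2 : S u <= S0M * expR (2 * y t).
    rewrite (le_trans (arc_growth hu'))// ler_wpM2l// ler_expR ler_wpM2l//.
    exact: y_le.
  have h3 : K / r * S u <= K / r * (S0M * expR (2 * y t)) by rewrite ler_wpM2l.
  have h4 : 0 <= x u * a2 u by rewrite mulr_ge0// x_ge0.
  have E : L * 1 = 2 * (K / r * (S0M * expR (2 * y t))) by rewrite /L; ring.
  by rewrite E; lra.
have h5 : L * t <= L * 2.
  by rewrite ler_wpM2l ?theta2// /L !mulr_ge0 ?expR_ge0 ?invr_ge0 ?(ltW r0).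
have E : 4 * (K / r) * S0M * expR (2 * y t) = L * 2 by rewrite /L; ring.
by rewrite E mulr0 in H *; lra.
Qed.

Lemma arc_upper t : 0 <= t <= pi / 2 -> q1 t ^+ 2 + q2 t ^+ 2 <=
  M * (p1 0 ^+ 2 + p2 0 ^+ 2 + q1 0 ^+ 2 + q2 0 ^+ 2) * expR (2 * (r * sin t)).
Proof.
move=> ht; have := arc_growth ht; have := qS t.
have -> : S 0 * M * expR (2 * y t) = 2 *
  (M * (p1 0 ^+ 2 + p2 0 ^+ 2 + q1 0 ^+ 2 + q2 0 ^+ 2) * expR (2 * (r * sin t))).
  by rewrite SE /y; ring.
lra.
Qed.

(** The arc starts at a critical point on the real axis, so a2 and b2 both start from q1(0)^2. *)
Hypotheses (p10 : p1 0 = 0) (p20 : p2 0 = 0) (q20 : q2 0 = 0).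

Let N t := q1 t ^+ 2 + q2 t ^+ 2.
Let N0 := q1 0 ^+ 2.
(** e^4 bounds e^(2y) as long as y <= 2, and 1 + 2K collects the two losses met in [near0]. For r >=
    128 c5 all errors of relative size c5 / r are small fractions of N0. *)
Let c5 := M * expR 4 * (1 + 2 * K).
Hypothesis r_large : 128 * c5 <= r.

Let c5_ge1 : 1 <= c5.
Proof.
have h1 : 1 <= expR 4 :> R by rewrite -[leLHS](@expR0 R) ler_expR.
have h2 : 1 <= 1 + 2 * K by rewrite lerDl mulr_ge0.
by rewrite !mulr_ege1.
Qed.

Let c5_ge0 : 0 <= c5. Proof. exact: le_trans ler01 c5_ge1. Qed.

Let KM_small : 4 * (K / r) * M <= 1 / 32.
Proof.
have e1 : 1 <= expR 4 :> R by rewrite -[leLHS](@expR0 R) ler_expR.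
have h : 2 * (K * M) <= c5.
  rewrite /c5 (_ : 2 * (K * M) = M * 1 * (2 * K)); last by ring.
  apply: ler_pM; rewrite ?mulr_ge0 ?(le_trans _ M1)//; last by rewrite lerDr.
  by rewrite ler_wpM2l// (le_trans _ M1).
rewrite (_ : 4 * (K / r) * M = 4 * (K * M) / r); last by field.
rewrite ler_pdivrMr//; have := mulr_ge0 K0 M0; have := r0.
by move: (K * M) h r_large => KM; lra.
Qed.

Let S0E : S 0 = 2 * N0.
Proof. by rewrite SE p10 p20 q20 /N0; ring. Qed.

Let N0_ge0 : 0 <= N0. Proof. exact: sqr_ge0. Qed.

(** Once y >= 2, e^(2y) is at least 9: b2 is at least 15/16 of N0 e^(2y), while a2 is at most N0
    plus 1/16 of N0 e^(2y). *)
Let far t : 0 <= t <= pi / 2 -> 2 <= y t -> N0 * expR (2 * y t) / 32 <= N t.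
Proof.
move=> ht yt.
have ha := arc_a ht; have hb := arc_b ht.
have e9 : 9 <= expR (2 * y t).
  have h := expR_ge1Dx (y t).
  have -> : expR (2 * y t) = expR (y t) ^+ 2 by rewrite -expRM_natl.
  have h3 : 3 <= expR (y t) by lra.
  have -> : (9 : R) = 3 ^+ 2 by ring.
  by rewrite lerXn2r ?nnegrE ?expR_ge0.
set E := expR (2 * y t) in ha e9 *.
have E0 : 0 < E by exact: expR_gt0.
rewrite expRN -/E in hb.
have small : 4 * (K / r) * S0M <= N0 / 16.
  rewrite /S0M S0E (_ : _ * (_ * M) = 4 * (K / r) * M * (2 * N0)); last by ring.
  have h : 4 * (K / r) * M * (2 * N0) <= 1 / 32 * (2 * N0).
    by rewrite ler_wpM2r ?KM_small// mulr_ge0.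
  by lra.
have a20 : a2 0 = N0 by rewrite /a2 p10 p20 q20 /N0; ring.
have b20 : b2 0 = N0 by rewrite /b2 p10 p20 q20 /N0; ring.
rewrite a20 in ha; rewrite b20 ler_pdivlMr// in hb.
have ha' : a2 t <= N0 + N0 / 16 * E.
  by rewrite (le_trans ha)// lerD2l ler_wpM2r// ltW.
have hb' : (N0 - N0 / 16) * E <= b2 t.
  by rewrite (le_trans _ hb)// ler_wpM2r ?(ltW E0)//; lra.
have h9 : N0 * 9 <= N0 * E by rewrite ler_wpM2l.
(* From B - A = -2iq, hence |B|^2 <= 2|A|^2 + 8|q|^2. *)
have hN : b2 t - 2 * a2 t <= 8 * N t.
  rewrite /b2 /a2 /N.
  have := sqr_ge0 (p1 t - 3 * q2 t); have := sqr_ge0 (p2 t + 3 * q1 t).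
  have -> : (p1 t - 3 * q2 t) ^+ 2 = p1 t ^+ 2 - 6 * (p1 t * q2 t) + 9 * q2 t ^+ 2 by ring.
  have -> : (p2 t + 3 * q1 t) ^+ 2 = p2 t ^+ 2 + 6 * (p2 t * q1 t) + 9 * q1 t ^+ 2 by ring.
  have -> : (p1 t + q2 t) ^+ 2 = p1 t ^+ 2 + 2 * (p1 t * q2 t) + q2 t ^+ 2 by ring.
  have -> : (p2 t - q1 t) ^+ 2 = p2 t ^+ 2 - 2 * (p2 t * q1 t) + q1 t ^+ 2 by ring.
  have -> : (p1 t - q2 t) ^+ 2 = p1 t ^+ 2 - 2 * (p1 t * q2 t) + q2 t ^+ 2 by ring.
  have -> : (p2 t + q1 t) ^+ 2 = p2 t ^+ 2 + 2 * (p2 t * q1 t) + q1 t ^+ 2 by ring.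
  lra.
have E1 : N0 / 16 * E = N0 * E / 16 by field.
have E2 : (N0 - N0 / 16) * E = N0 * E * 15 / 16 by field.
rewrite E1 in ha'; rewrite E2 in hb'.
by have := N0_ge0; move: (N0 * E) h9 hN ha' hb' => NE; lra.
Qed.

(** For y <= 2 the two exponentials could cancel, so N = |q|^2 itself is followed. Its derivative is
    x D / 2 - 2y Re(conj(q) p) with D = b2 - a2, and D starts from 0 with derivative 2x S up to the
    error. So N decreases at a rate at most of order N0, while y advances at rate x >= r / 2: up to
    y = 2 the loss is of order N0 / r. *)
Let near0 t : 0 <= t <= pi / 2 -> y t <= 2 -> N0 / 2 <= N t.
Proof.
move=> ht yt; have /andP[t0 tp] := ht.
have r4 : 4 <= r by rewrite (le_trans _ r_large)//; have := c5_ge1; lra.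
have Sle u : 0 <= u <= t -> S u <= 2 * N0 * (M * expR 4).
  move=> hu; have hu' := sub_theta ht hu; have yu := y_le ht hu.
  rewrite (le_trans (arc_growth hu'))// S0E -mulrA.
  apply: ler_wpM2l; first by rewrite mulr_ge0.
  by apply: ler_wpM2l; rewrite ?(le_trans _ M1)// ler_expR; lra.
have KS u : 0 <= u <= t -> K / r * S u <= K / r * (2 * N0 * (M * expR 4)).
  by move=> hu; rewrite ler_wpM2l// Sle.
have xr u : 0 <= u <= t -> r / 2 <= x u /\ x u <= r.
  move=> hu; split; last by rewrite ler_piMr ?(ltW r0)// cos_le1.
  have cu : 0 <= cos u.
    by have := x_ge0 (sub_theta ht hu); rewrite pmulr_rge0.
  have su : sin u <= 2^-1.
    have := y_le ht hu; rewrite {1}/y => h.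
    have : r * sin u <= 2 by exact: le_trans yt.
    rewrite -ler_pdivlMl// => h2; rewrite (le_trans h2)//.
    by rewrite mulrC ler_pdivrMr//; lra.
  have su0 : 0 <= sin u.
    rewrite sin_ge0_pi//; have /andP[-> h] := sub_theta ht hu.
    by rewrite (le_trans h)// ler_pdivrMr// ler_peMr// ?pi_ge0// ler1n.
  rewrite ler_wpM2l ?(ltW r0)//.
  have := cos2Dsin2 u; nra.
pose D u := b2 u - a2 u.
have hD u : 0 <= u <= t -> - (8 * (K / r) * (N0 * (M * expR 4))) <= D u.
  move=> hu; have /andP[u0 ut] := hu.
  pose L := 4 * (K / r) * (N0 * (M * expR 4)).
  have := @is_derive_ge0_le R (fun v => b2 v - a2 v + L * v)
    (fun v => (2 * x v * b2 v + k / r * (2 * ((p1 v + q2 v) * f1 v + (p2 v - q1 v) * f2 v)))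
      - (- 2 * x v * a2 v + k / r * (2 * ((p1 v - q2 v) * f1 v + (p2 v + q1 v) * f2 v)))
      + L * 1) 0 u u0.
  rewrite /= => H.
  have {}H : b2 0 - a2 0 + L * 0 <= b2 u - a2 u + L * u.
    apply: H => v hv.
      exact: (derD (derB (db2 v) (da2 v)) (derZ L (der_id v))).
    have hv' : 0 <= v <= t by have /andP[-> /le_trans->] := hv.
    have [xv _] := xr _ hv'; have KSv := KS _ hv'.
    have h : k / r * - (4 * (q2 v * f1 v - q1 v * f2 v)) <= K / r * (2 * S v).
      have := cs (q2 v) (- q1 v) (f1 v) (f2 v); have := qS v; rewrite ff sqrrN.
      by move=> h1 [h2 h3]; apply: krK; lra.
    have h2 : 0 <= x v * S v by rewrite mulr_ge0// (le_trans _ xv)// divr_ge0// ltW.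
    have E1 : (2 * x v * b2 v + k / r * (2 * ((p1 v + q2 v) * f1 v + (p2 v - q1 v) * f2 v)))
      - (- 2 * x v * a2 v + k / r * (2 * ((p1 v - q2 v) * f1 v + (p2 v + q1 v) * f2 v)))
      + L * 1 = 2 * (x v * S v) - k / r * - (4 * (q2 v * f1 v - q1 v * f2 v)) + L.
      by rewrite /S; ring.
    have E2 : K / r * (2 * S v) = 2 * (K / r * S v) by ring.
    have E3 : L = 2 * (K / r * (2 * N0 * (M * expR 4))) by rewrite /L; ring.
    by rewrite E1 E3; rewrite E2 in h; lra.
  have ab0 : b2 0 - a2 0 = 0 by rewrite /b2 /a2 p10 p20 q20; ring.
  rewrite ab0 mulr0 addr0 in H.
  have L0 : 0 <= L.
    apply: mulr_ge0; first by rewrite mulr_ge0.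
    by apply: mulr_ge0 => //; rewrite mulr_ge0 ?expR_ge0.
  have h5 : L * u <= L * 2 by rewrite ler_wpM2l// theta2// (sub_theta ht hu).
  have E3 : 8 * (K / r) * (N0 * (M * expR 4)) = L * 2 by rewrite /L; ring.
  by rewrite E3 /D; lra.
(* L y compensates the loss: L x >= 2 c5 N0 outweighs the decrease of N, and 2 L <= N0 / 2. *)
pose L := 4 * c5 * N0 / r.
have := @is_derive_ge0_le R (fun u => N u + L * y u)
  (fun u => 2 * q1 u * (- y u * p1 u - x u * p2 u + s * q2 u) +
    2 * q2 u * (x u * p1 u - y u * p2 u - s * q1 u) + L * x u) 0 t t0.
rewrite /= => H.
have {}H : N 0 + L * y 0 <= N t + L * y t.
  apply: H => u hu.
    exact: (derD (derD (derX2 (dq1 u)) (derX2 (dq2 u))) (derZ L (dy u))).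
  have [xu xur] := xr _ hu; have yu := y_le ht hu; have Du := hD _ hu.
  have Su := Sle _ hu.
  have E : 2 * q1 u * (- y u * p1 u - x u * p2 u + s * q2 u) +
    2 * q2 u * (x u * p1 u - y u * p2 u - s * q1 u) + L * x u =
    x u * D u / 2 - y u * (2 * (q1 u * p1 u + q2 u * p2 u)) + L * x u.
    by rewrite /D /a2 /b2; field.
  rewrite E.
  have x0 : 0 <= x u by rewrite (le_trans _ xu)// divr_ge0// ltW.
  have yu0 : 0 <= y u.
    rewrite mulr_ge0 ?(ltW r0)// sin_ge0_pi//; have /andP[-> h] := sub_theta ht hu.
    by rewrite (le_trans h)// ler_pdivrMr// ler_peMr// ?pi_ge0// ler1n.
  have qp : 2 * (q1 u * p1 u + q2 u * p2 u) <= S u / 2.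
    by have [+ _] := cs (q1 u) (q2 u) (p1 u) (p2 u); rewrite SE; lra.
  have h1 : y u * (2 * (q1 u * p1 u + q2 u * p2 u)) <= y u * (S u / 2).
    by rewrite ler_wpM2l.
  have h2 : y u * (S u / 2) <= 2 * (S u / 2).
    by rewrite ler_wpM2r ?divr_ge0// (le_trans yu).
  have h3 : r / 2 * L <= L * x u.
    rewrite mulrC ler_wpM2l// /L divr_ge0 ?(ltW r0)//.
    by apply: mulr_ge0 => //; exact: mulr_ge0.
  have h3' : r / 2 * L = 2 * c5 * N0 by rewrite /L; field.
  set Z := N0 * (M * expR 4) in Du.
  have Z0 : 0 <= Z by apply: mulr_ge0 => //; apply: mulr_ge0 => //; exact: expR_ge0.
  have h4 : - (8 * K * Z) <= x u * D u.
    have h : x u * - (8 * (K / r) * Z) <= x u * D u by rewrite ler_wpM2l.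
    rewrite (le_trans _ h)// mulrN lerN2.
    have h' : x u * (8 * (K / r) * Z) <= r * (8 * (K / r) * Z).
      by apply: ler_wpM2r => //; apply: mulr_ge0 => //; exact: mulr_ge0.
    by rewrite (le_trans h')// le_eqVlt; apply/orP; left; apply/eqP; field.
  have E5 : 2 * c5 * N0 = 2 * Z + 4 * (K * Z) by rewrite /c5 /Z; ring.
  have E6 : 8 * K * Z = 8 * (K * Z) by ring.
  have E7 : 2 * N0 * (M * expR 4) = 2 * Z by rewrite /Z; ring.
  rewrite h3' E5 in h3; rewrite E6 in h4; rewrite E7 in Su.
  by move: (L * x u) (x u * D u) (K * Z) h1 h2 h3 h4 Su => *; lra.
rewrite {1}/y sin0 !mulr0 addr0 in H.
have N00 : N 0 = N0 by rewrite /N q20 /N0; ring.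
have L0 : 0 <= L.
  by rewrite /L divr_ge0 ?(ltW r0)//; apply: mulr_ge0 => //; exact: mulr_ge0.
have hL : L * y t <= L * 2 by rewrite ler_wpM2l.
have hL2 : L * 2 <= N0 / 2.
  rewrite (_ : L * 2 = 8 * c5 / r * N0); last by rewrite /L; field.
  rewrite mulrC ler_wpM2l// ler_pdivrMr//; have := c5_ge0; have := r_large; lra.
by rewrite N00 in H; lra.
Qed.

(** [far] and [near0] combined; the factor e^(-4) absorbs e^(2y) when y <= 2. *)
Lemma arc_lower t : 0 <= t <= pi / 2 ->
  expR (- 4) / 32 * q1 0 ^+ 2 * expR (2 * (r * sin t)) <= q1 t ^+ 2 + q2 t ^+ 2.
Proof.
move=> ht; rewrite -/N0 -/(y t) -/(N t).
have e4 : 0 < expR (- 4) :> R by exact: expR_gt0.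
have e41 : expR (- 4) <= 1 :> R by rewrite -[leRHS](@expR0 R) ler_expR; lra.
have E0 : 0 < expR (2 * y t) by exact: expR_gt0.
have NE : 0 <= N0 * expR (2 * y t) by rewrite mulr_ge0// ltW.
have [y2|y2] := leP 2 (y t).
  rewrite (le_trans _ (far ht y2))//.
  rewrite (_ : _ * _ * _ = expR (- 4) * (N0 * expR (2 * y t) / 32)); last by field.
  by rewrite ler_piMl// divr_ge0.
rewrite (le_trans _ (near0 ht (ltW y2)))//.
rewrite (_ : _ * _ * _ = N0 / 32 * (expR (- 4) * expR (2 * y t))); last by field.
have h : expR (- 4) * expR (2 * y t) <= 1.
  by rewrite -expRD -[leRHS](@expR0 R) ler_expR; lra.
rewrite (@le_trans _ _ (N0 / 32 * 1))//; first by rewrite ler_wpM2l// divr_ge0.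
have := N0_ge0; lra.
Qed.

End ArcEstimate.

(** * The Bessel series and its zeros *)

Section CurveDerivative.
Variable R : realType.
Implicit Types (g h : R -> R[i]) (a b : nat -> R[i]) (t : R) (d e z w c : R[i]).

Definition cder g t d :=
  is_derive t 1 (fun u => complex.Re (g u)) (complex.Re d) /\
  is_derive t 1 (fun u => complex.Im (g u)) (complex.Im d).

Lemma cderE g t d e : cder g t d -> d = e -> cder g t e.
Proof. by move=> h <-. Qed.

Lemma cder_cst c t : cder (fun=> c) t 0.
Proof. by split; exact: der_cst. Qed.

Lemma cderD g h t d e : cder g t d -> cder h t e ->
  cder (fun u => g u + h u) t (d + e).
Proof.
move=> [g1 g2] [h1 h2]; split.
  by rewrite cReD; under eq_fun do rewrite cReD; exact: derD.
by rewrite cImD; under eq_fun do rewrite cImD; exact: derD.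
Qed.

Lemma cderM g h t d e : cder g t d -> cder h t e ->
  cder (fun u => g u * h u) t (d * h t + g t * e).
Proof.
move=> [g1 g2] [h1 h2]; split.
  under eq_fun do rewrite cReM; apply: derE (derB (derM g1 h1) (derM g2 h2)) _.
  by rewrite cReD !cReM; ring.
under eq_fun do rewrite cImM; apply: derE (derD (derM g1 h2) (derM g2 h1)) _.
by rewrite cImD !cImM; ring.
Qed.

Lemma cderMl c h t e : cder h t e -> cder (fun u => c * h u) t (c * e).
Proof.
by move=> hh; apply: cderE (cderM (cder_cst c t) hh) _; rewrite mul0r add0r.
Qed.

Lemma cder_conj g t d : cder g t d -> cder (fun u => conjc (g u)) t (conjc d).
Proof.
have RJ (x : R[i]) : complex.Re (conjc x) = complex.Re x by case: x.
have IJ (x : R[i]) : complex.Im (conjc x) = - complex.Im x by case: x.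
move=> [g1 g2]; split.
  by rewrite RJ; under eq_fun do rewrite RJ.
by rewrite IJ; under eq_fun do rewrite IJ; exact: derN.
Qed.

Lemma cder_real (f : R -> R) t (d : R) : is_derive t 1 f d ->
  cder (fun u => (f u)%:C) t d%:C.
Proof. by move=> h; split => //=; exact: der_cst. Qed.

(** Chain rule through the criterion of Caratheodory: the slope function of [ev a] at g t is
    [quo a (g t)], and it is continuous along g because a second [quo] bounds its increments. *)
Lemma cder_ev a g t d : entire a -> cder g t d ->
  cder (fun u => ev a (g u)) t (ev (der a) (g t) * d).
Proof.
move=> ea [/is_derive1_caratheodory[f1 [f1E cf1 f1t]]
  /is_derive1_caratheodory[f2 [f2E cf2 f2t]]].
pose w := g t; pose b := quo a w; pose k u := ev b (g u).
have eb : entire b by exact: entire_quo.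
have [K K0 hK] := ev_locbound w (entire_quo w eb).
have gE u : g u - w = (f1 u * (u - t)) +i* (f2 u * (u - t)).
  by apply: eq_ReIm; rewrite ?cReD ?cReN ?cImD ?cImN.
have kE u : k u - k t = (g u - w) * ev (quo b w) (g u).
  by rewrite /k (ev_quo w (g u) eb) -/w addrAC subrr add0r.
have FE u : ev a (g u) - ev a (g t) = (g u - w) * k u.
  by rewrite (ev_quo w (g u) ea) -/w addrAC subrr add0r.
have kt : k t = ev (der a) w by rewrite /k /b ev_quo_diag//; exact: entire_der.
have cg : (fun u => nc (g u - w)) u @[u --> t] --> 0.
  have c1 : (f1 u * (u - t)) @[u --> t] --> 0.
    rewrite -(mulr0 (f1 t)) -(subrr t); apply: cvgM; first exact: cf1.
    by apply: cvgB; [exact: cvg_id|exact: cvg_cst].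
  have c2 : (f2 u * (u - t)) @[u --> t] --> 0.
    rewrite -(mulr0 (f2 t)) -(subrr t); apply: cvgM; first exact: cf2.
    by apply: cvgB; [exact: cvg_id|exact: cvg_cst].
  apply: (@squeeze_cvgr _ _ _ _ (fun=> 0)
    (fun u => `|f1 u * (u - t)| + `|f2 u * (u - t)|)).
  - by apply: nearW => u; rewrite nc_ge0/= gE; exact: nc_le.
  - exact: cvg_cst.
  - have n1 : `|f1 u * (u - t)| @[u --> t] --> (0 : R).
      by have h := cvg_norm c1; rewrite normr0 in h; exact: h.
    have n2 : `|f2 u * (u - t)| @[u --> t] --> (0 : R).
      by have h := cvg_norm c2; rewrite normr0 in h; exact: h.
    by have h := cvgD n1 n2; rewrite addr0 in h; exact: h.
have near1 : \forall u \near t, nc (g u - w) <= 1.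
  have h := (cvgrPdist_lt _ _).1 cg 1 ltr01; near=> u.
  have hu : `|0 - nc (g u - w)| < 1 by near: u; exact: h.
  by rewrite sub0r normrN ger0_norm ?nc_ge0// in hu; exact: ltW.
have cnk : (fun u => nc (k u - k t)) u @[u --> t] --> 0.
  apply: (@squeeze_cvgr _ _ _ _ (fun=> 0) (fun u => K * nc (g u - w))).
  - near=> u; rewrite nc_ge0/= kE ncM mulrC ler_wpM2r ?nc_ge0// hK//.
    by near: u; exact: near1.
  - exact: cvg_cst.
  - have h : K * nc (g u - w) @[u --> t] --> K * 0 by apply: cvgMr; exact: cg.
    by rewrite mulr0 in h; exact: h.
have sq (F : R -> R) : (forall u, `|F t - F u| <= nc (k u - k t)) -> {for t, continuous F}.
  move=> hF; apply/cvgrPdist_lt => e e0.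
  have h := (cvgrPdist_lt _ _).1 cnk _ e0; near=> u.
  have hu : `|0 - nc (k u - k t)| < e by near: u; exact: h.
  by rewrite sub0r normrN ger0_norm ?nc_ge0// in hu; exact: le_lt_trans (hF u) hu.
have cRk : {for t, continuous (fun u => complex.Re (k u))}.
  by apply: sq => u; rewrite ncC -cReN -cReD nc_Re.
have cIk : {for t, continuous (fun u => complex.Im (k u))}.
  by apply: sq => u; rewrite ncC -cImN -cImD nc_Im.
rewrite -/w -kt; split; apply/is_derive1_caratheodory.
  exists (fun u => f1 u * complex.Re (k u) - f2 u * complex.Im (k u)); split.
  - by move=> u; rewrite -cReN -cReD FE gE cReM /=; ring.
  - exact: (cvgB (cvgM cf1 cRk) (cvgM cf2 cIk)).
  - by rewrite f1t f2t cReM; ring.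
exists (fun u => f1 u * complex.Im (k u) + f2 u * complex.Re (k u)); split.
- by move=> u; rewrite -cImN -cImD FE gE cImM /=; ring.
- exact: (cvgD (cvgM cf1 cIk) (cvgM cf2 cRk)).
- by rewrite f1t f2t cImM; ring.
Unshelve. all: by end_near. Qed.

End CurveDerivative.

(** * The Bessel series in w and its differential equation *)

Section BesselSeries.
Variables (R : realType) (mu : R).
Hypothesis mu1 : -1 < mu.
Implicit Types (z w : R[i]) (x : R).

(* [BQ (z ^+ 2)] is (2 / z)^mu J_mu(z), and [BD] is the derivative of [BQ]. *)
Definition bcr k : R := (-1) ^+ k / (4 ^+ k * k`!%:R * Gamma (mu + k%:R + 1)).

Definition bc k : R[i] := (bcr k)%:C.

Let s := mu + 2^-1.

Let mu_gt0 k : 0 < mu + k%:R + 1.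
Proof. by have k0 : 0 <= k%:R :> R by []; have := mu1; lra. Qed.

Let G0 k : 0 < Gamma (mu + k%:R + 1).
Proof. by apply: Gamma_gt0; exact: mu_gt0. Qed.

(** The functional equation of Gamma as a recurrence for the coefficients; it is the Bessel equation
    read coefficientwise. *)
Lemma bcrS k : k.+1%:R * (mu + k%:R + 1) * bcr k.+1 = - bcr k / 4.
Proof.
have -> : bcr k.+1 = (-1) ^+ k.+1 / (4 ^+ k.+1 * (k.+1)`!%:R *
   ((mu + k%:R + 1) * Gamma (mu + k%:R + 1))).
  have E : mu + k.+1%:R + 1 = mu + k%:R + 1 + 1 by rewrite -(natr1 k) addrA.
  by rewrite /bcr -(GammaS (mu_gt0 k)) E.
rewrite /bcr factS natrM !exprS.
have h1 := mu_gt0 k; have h2 := G0 k.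
have h3 : k`!%:R != 0 :> R by rewrite pnatr_eq0 -lt0n fact_gt0.
have h4 : (4 : R) ^+ k != 0 by rewrite expf_neq0.
field; rewrite h3 h4 /=.
by rewrite (gt_eqF h2) (gt_eqF h1) addrC natr1 pnatr_eq0.
Qed.

Lemma eventually_nonincreasing_bounded (u : nat -> R) m : (forall k, 0 <= u k) ->
  (forall k, (m <= k)%N -> u k.+1 <= u k) -> exists C, forall k, u k <= C.
Proof.
move=> u0 um; exists (\sum_(i < m.+1) u i) => k.
have le_sum i : (i < m.+1)%N -> u i <= \sum_(i < m.+1) u i.
  move=> im; rewrite (bigD1 (Ordinal im)) //= lerDl; exact: sumr_ge0.
have [km|mk] := ltnP k m.+1; first exact: le_sum.
have : u k <= u m.
  elim: k mk => // k IH mk; have [e|km] := eqVneq k m; first by rewrite e um.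
  have mk' : (m < k)%N by rewrite ltn_neqAle eq_sym km.
  by rewrite (le_trans (um _ (ltnW mk')))// IH.
by move/le_trans; apply; apply: le_sum.
Qed.

Lemma entire_bc : entire bc.
Proof.
(* For k >= m the ratio of |bcr k| to |bcr (k+1)|, which is 4 (k + 1) (mu + k + 1), is at least rho,
   so the terms decrease from m on. *)
move=> rho r0; pose m := (Num.truncn rho).+1.
have rm : rho <= m%:R by rewrite ltW// truncnS_gt.
apply: (@eventually_nonincreasing_bounded (fun k => nc (bc k) * rho ^+ k) m).
  by move=> k; rewrite mulr_ge0 ?nc_ge0// exprn_ge0// ltW.
move=> k mk; rewrite /bc !nc_real.
have h1 := mu_gt0 k; have k1 : 0 < k.+1%:R :> R by [].
have -> : `|bcr k| = 4 * (k.+1%:R * (mu + k%:R + 1)) * `|bcr k.+1|.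
  have h0 : 0 <= 4 * (k.+1%:R * (mu + k%:R + 1)).
    by rewrite !mulr_ge0 ?(ltW h1).
  rewrite -{1}(ger0_norm h0) -normrM -normrN; congr (`|_|).
  by rewrite -[RHS]mulrA bcrS; field.
have hA : rho <= 4 * (k.+1%:R * (mu + k%:R + 1)).
  have kk : m%:R <= k%:R :> R by rewrite ler_nat.
  have k2 : rho <= mu + k%:R + 1 by have := mu1; lra.
  have k3 : mu + k%:R + 1 <= k.+1%:R * (mu + k%:R + 1).
    by rewrite ler_peMl ?(ltW h1)// ler1n.
  lra.
set A := 4 * _ in hA *.
rewrite (_ : _ * rho ^+ k.+1 = rho * (`|bcr k.+1| * rho ^+ k)); last by rewrite exprS; ring.
by rewrite -mulrA ler_wpM2r// mulr_ge0// exprn_ge0// ltW.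
Qed.

Lemma bc_real k : complex.Im (bc k) = 0.
Proof. by []. Qed.

Let ebc := entire_bc.

Definition BQ w := ev bc w.

Definition BD w := ev (der bc) w.

Definition BDD w := ev (der (der bc)) w.

(** Coefficientwise this is [bcrS]; [b] is the coefficient sequence of w [BDD] w, with constant term
    0. *)
Lemma Bessel_ode w : w * BDD w = - (mu + 1)%:C * BD w - BQ w / 4.
Proof.
have ed := entire_der ebc.
pose b k := k%:R * der bc k.
have bE k : b k = - (mu + 1)%:C * der bc k - bc k / 4.
  rewrite /b /der /bc.
  have -> : (k%:R : R[i]) = k%:R%:C by rewrite rmorph_nat.
  have -> : (k.+1%:R : R[i]) = k.+1%:R%:C by rewrite rmorph_nat.
  have -> : (4 : R[i]) = 4%:C by rewrite rmorph_nat.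
  rewrite -fmorphV -!rmorphM -rmorphN -!rmorphM -rmorphB /=; congr (_ %:C).
  have := bcrS k; rewrite -mulNr => <-; rewrite -natr1; ring.
have eb : entire b.
  rewrite (_ : b = (fun k => - (mu + 1)%:C * der bc k + (- 4^-1) * bc k)).
    by apply: entire_add; exact: entire_scale.
  by apply/funext => k; rewrite bE; ring.
have := ev_shift w eb; rewrite {1 2}/b mul0r add0r => h.
have -> : w * BDD w = ev b w by rewrite h.
rewrite (_ : b = (fun k => - (mu + 1)%:C * der bc k + (- 4^-1) * bc k)).
  rewrite (ev_add w (entire_scale (- (mu + 1)%:C) ed) (entire_scale (- 4^-1) ebc)).
  rewrite (ev_scale _ w ed) (ev_scale _ w ebc).
  by rewrite /BD /BQ; ring.
by apply/funext => k; rewrite bE; ring.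
Qed.

Lemma BQ_conj w : BQ (conjc w) = conjc (BQ w).
Proof. exact: ev_conj. Qed.

Lemma BQ_real x : complex.Im (BQ x%:C) = 0.
Proof. exact: ev_real. Qed.

Lemma der_bc_real k : complex.Im (der bc k) = 0.
Proof.
have E : (k.+1%:R : R[i]) = k.+1%:R%:C by rewrite rmorph_nat.
by rewrite /der E cImM /= mulr0 mul0r addr0.
Qed.

Lemma BD_real x : complex.Im (BD x%:C) = 0.
Proof.
apply: ev_real; last exact: entire_der.
exact: der_bc_real.
Qed.

(* [x `^ s * bq x] is 2^mu sqrt(x) J_mu(x), and [x `^ s * bp x] its derivative. *)
Definition bq x := complex.Re (BQ (x ^+ 2)%:C).

Definition bp x := 2 * x * complex.Re (BD (x ^+ 2)%:C) + s * (bq x / x).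

Let bd x := complex.Re (BD (x ^+ 2)%:C).

Let bdd x := complex.Re (BDD (x ^+ 2)%:C).

Let real_ode x : x ^+ 2 * bdd x = - (mu + 1) * bd x - bq x / 4.
Proof.
have := congr1 (@complex.Re R) (Bessel_ode (x ^+ 2)%:C).
rewrite cReM /= mul0r subr0 -/(bdd x) => ->.
have -> : (4 : R[i])^-1 = (4^-1)%:C by rewrite fmorphV rmorph_nat.
rewrite -rmorphN /= cReD cReN (cReM _%:C) (cReM _ _%:C) /= mul0r mulr0 !subr0.
by rewrite -/(bd x) -/(bq x).
Qed.

Lemma der_ev_sq (a : nat -> R[i]) x : entire a -> (forall k, complex.Im (a k) = 0) ->
  is_derive x 1 (fun u => complex.Re (ev a (u ^+ 2)%:C))
    (2 * x * complex.Re (ev (der a) (x ^+ 2)%:C)).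
Proof.
move=> ea ar; have [h _] := cder_ev ea (cder_real (derX2 (der_id x))).
by apply: derE h _; rewrite cReM /= mulr1 mulr0 subr0 mulrC.
Qed.

Lemma der_bq x : 0 < x -> is_derive x 1 bq (bp x - s * (bq x / x)).
Proof.
move=> x0; apply: derE (der_ev_sq x ebc bc_real) _.
by rewrite /bp /bq /bd; ring.
Qed.

(** For u = x^s bq(x) this says u'' = -u + (s^2 - s) u / x^2, where s^2 - s = mu^2 - 1/4. *)
Lemma der_bp x : 0 < x -> is_derive x 1 bp
  (- s * (bp x / x) - bq x + (s ^+ 2 - s) * (bq x / x ^+ 2)).
Proof.
move=> x0; have xN0 : x != 0 by rewrite gt_eqF.
have dI : is_derive x 1 (fun u : R => u^-1) (- x ^- 2).
  have h := is_deriveV (f := fun u : R => u) xN0 (der_id x).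
  by apply: derE h _; rewrite /GRing.scale /= mulr1.
have dD := der_ev_sq x (entire_der ebc) der_bc_real.
have dQ := der_ev_sq x ebc bc_real.
apply: derE (derD (derM (derZ 2 (der_id x)) dD) (derZ s (derM dQ dI))) _.
rewrite -/(bd x) -/(bdd x) -/(bq x).
have h := real_ode x.
rewrite /bp -/(bd x) (_ : 2 * x * (2 * x * bdd x) = 4 * (x ^+ 2 * bdd x)); last by ring.
by rewrite h /s; field.
Qed.

Section Arc.
Variable r : R.
Hypothesis r0 : 0 < r.
Implicit Type t : R.

Definition carc t : R[i] := (r * cos t) +i* (r * sin t).

Definition arc_q t := BQ (carc t ^+ 2).

(** The complex counterpart of [bp]: the z-derivative of BQ(z^2) plus s BQ(z^2) / z, with 1 / z
    written as conj(z) / r^2 so that no inverse has to be differentiated. *)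
Definition arc_p t := 2 * carc t * BD (carc t ^+ 2) +
  (s / r ^+ 2)%:C * (conjc (carc t) * arc_q t).

Let ci : R[i] := 'i%C.

Lemma cder_arc t : cder carc t (ci * carc t).
Proof.
split; rewrite /carc.
  apply: derE (derZ r (is_derive_cos t)) _.
  by rewrite cReM /=; ring.
apply: derE (derZ r (is_derive_sin t)) _.
by rewrite cImM /=; ring.
Qed.

Lemma nc_arc t : nc (carc t) = r.
Proof.
rewrite /nc /carc !exprMn -mulrDr cos2Dsin2 mulr1 sqrtr_sqr ger0_norm//.
exact: ltW.
Qed.

Let arcJ t : carc t * conjc (carc t) = (r ^+ 2)%:C.
Proof.
apply: eq_ReIm; rewrite ?cReM ?cImM /carc /=; last by ring.
rewrite mulrN opprK -!expr2 !exprMn -mulrDr cos2Dsin2 mulr1//.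
Qed.

Let cder_sq t : cder (fun u => carc u ^+ 2) t (2 * ci * carc t ^+ 2).
Proof.
apply: cderE (cderM (cder_arc t) (cder_arc t)) _; ring.
Qed.

Let rN0 : (r ^+ 2)%:C != 0 :> R[i].
Proof. by rewrite fmorph_eq0 expf_neq0// gt_eqF. Qed.

Let ci2 : ci * ci = -1.
Proof. by apply: eq_ReIm; rewrite ?cReM ?cImM /=; ring. Qed.

Let srE : (s / r ^+ 2)%:C * (r ^+ 2)%:C = s%:C :> R[i].
Proof. by rewrite -rmorphM /= divfK// expf_neq0// gt_eqF. Qed.

Let cder_q0 t : cder arc_q t (BD (carc t ^+ 2) * (2 * ci * carc t ^+ 2)).
Proof. exact: cder_ev. Qed.

Lemma cder_arc_q t : cder arc_q t (ci * (carc t * arc_p t) - s%:C * ci * arc_q t).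
Proof.
apply: cderE (cder_q0 t) _; rewrite /arc_p.
have := arcJ t; have := srE.
move: (carc t) (conjc (carc t)) (BD (carc t ^+ 2)) (arc_q t) ((s / r ^+ 2)%:C : R[i]) => z zb D q sr h1 h2.
have E : ci * (z * (2 * z * D + sr * (zb * q))) = D * (2 * ci * z ^+ 2) +
  sr * (z * zb) * ci * q by ring.
by rewrite E h2 h1; ring.
Qed.

Lemma cder_arc_p t : cder arc_p t (- ci * s%:C * arc_p t - ci * (carc t * arc_q t) +
  ((s ^+ 2 - s) / r ^+ 2)%:C * (ci * (conjc (carc t) * arc_q t))).
Proof.
have hD : cder (fun u => BD (carc u ^+ 2)) t
    (BDD (carc t ^+ 2) * (2 * ci * carc t ^+ 2)).
  by apply: cder_ev; [exact: entire_der|exact: cder_sq].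
apply: cderE (cderD (cderM (cderMl 2 (cder_arc t)) hD)
  (cderMl _ (cderM (cder_conj (cder_arc t)) (cder_q0 t)))) _.
have ode := Bessel_ode (carc t ^+ 2).
have -> : conjc (ci * carc t) = - ci * conjc (carc t).
  by apply: eq_ReIm; rewrite !(rmorphM, cReM, cImM, cReN, cImN) /=; ring.
have kE : ((s ^+ 2 - s) / r ^+ 2)%:C = (s / r ^+ 2)%:C * (s%:C - 1) :> R[i].
  by rewrite -(rmorph1 (real_complex R)) -rmorphB -rmorphM /=; congr (_ %:C); ring.
have mE : (mu + 1)%:C = s%:C + 2^-1 :> R[i].
  have -> : (2^-1 : R[i]) = (2^-1)%:C by rewrite fmorphV rmorph_nat.
  by rewrite -rmorphD; congr (_ %:C); rewrite /s; field.
have h1 := arcJ t; have h2 := srE.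
rewrite kE /arc_p; rewrite mE in ode.
rewrite -/(arc_q t) in ode *.
move: (carc t) (conjc (carc t)) (BDD (carc t ^+ 2)) (BD (carc t ^+ 2)) (arc_q t)
  ((s / r ^+ 2)%:C : R[i]) (s%:C : R[i]) ode h1 h2
  => z zb DD D q sr sC ode h1 h2.
have -> : 2 * z * (DD * (2 * ci * z ^+ 2)) = 4 * ci * z * (z ^+ 2 * DD) by ring.
rewrite ode.
have -> : sr * (- ci * zb * q + zb * (D * (2 * ci * z ^+ 2))) =
  - ci * sr * zb * q + 2 * ci * z * D * (sr * (z * zb)) by ring.
by rewrite h1 h2; field.
Qed.

End Arc.

End BesselSeries.

(** * All zeros in w are real and positive *)

Section BesselZeros.
Variables (R : realType) (mu : R).
Hypothesis mu1 : -1 < mu.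
Implicit Types (z w : R[i]) (x t : R).

Let ebc := entire_bc mu1.

Lemma BQ0_gt0 : 0 < complex.Re (BQ mu 0).
Proof.
rewrite /BQ (ev0 ebc) /= /bcr expr0 fact0 expr0 mul1r mulr1 mul1r addr0.
by rewrite invr_gt0 Gamma_gt0//; have := mu1; lra.
Qed.

Lemma BQ0_real : BQ mu 0 = (complex.Re (BQ mu 0))%:C.
Proof. by rewrite /BQ (ev0 ebc). Qed.

Lemma BQ_near0 : exists2 e : R, 0 < e & forall w, nc w <= e -> BQ mu w != 0.
Proof.
have Q0 : BQ mu 0 != 0.
  rewrite BQ0_real; apply/eqP => /(congr1 (@complex.Re R)) /= h.
  by have := BQ0_gt0; rewrite h ltxx.
have [e e0 he] := ev_neq0_near ebc Q0; exists e; [exact: e0|move=> w we].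
rewrite -nc_gt0; have := he _ we; rewrite add0r; apply: lt_le_trans.
by rewrite divr_gt0// nc_gt0.
Qed.

(** At -y all terms of the series are nonnegative and the constant term is positive. *)
Lemma BQ_neg y : 0 <= y -> BQ mu (- y)%:C != 0.
Proof.
move=> y0; have /climP_ReIm[h _] := ev_cvg (- y)%:C ebc.
have pos j : 0 < bcr mu j * (- y) ^+ j \/ 0 <= bcr mu j * (- y) ^+ j.
  right; rewrite exprNn mulrA mulrC mulr_ge0 ?exprn_ge0//.
  rewrite /bcr mulrAC -expr2 sqrr_sign mul1r invr_ge0 mulr_ge0//.
  rewrite ltW// Gamma_gt0//; have : 0 <= j%:R :> R by [].
  by have := mu1; lra.
apply/eqP => E.
have Q0 : complex.Re (BQ mu 0) <= complex.Re (ev (bc mu) (- y)%:C).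
  rewrite -[leRHS](cvg_lim (@norm_hausdorff _ R) h).
  apply: limr_ge; first by apply/cvg_ex; eexists; exact: h.
  near=> n; have n0 : (0 < n)%N by near: n; exact: nbhs_infty_gt.
  rewrite (Re_sum (fun j => bc mu j * (- y)%:C ^+ j)).
  rewrite -(prednK n0) big_ord_recl expr0 mulr1 /BQ (ev0 ebc) lerDl sumr_ge0// => j _.
  rewrite /bc -rmorphXn -rmorphM /=.
  by have [/ltW|] := pos (bump 0 j).
by move: Q0; rewrite -/(BQ mu _) E /= leNgt BQ0_gt0.
Unshelve. all: by end_near. Qed.

Let ray_cder w t : cder (fun u => u%:C * w) t w.
Proof.
apply: cderE (cderM (cder_real (der_id t)) (cder_cst w t)) _.
by rewrite rmorph1 mul1r mulr0 addr0.
Qed.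

(** Up to a constant factor, the Wronskian of t |-> BQ mu (t w) and its conjugate, with the weight
    t^(mu + 1) of the self-adjoint form of the equation. *)
Let W w t := t `^ (mu + 1) *
  complex.Im (w * BD mu (t%:C * w) * conjc (BQ mu (t%:C * w))).

(* The Lagrange identity of the Bessel operator with complex parameter w. *)
Let dW w t : 0 < t -> is_derive t 1 (W w)
  (- (t `^ mu * nc (BQ mu (t%:C * w)) ^+ 2 * complex.Im w / 4)).
Proof.
move=> t0.
have hQ := cder_ev ebc (ray_cder w t).
have hD := cder_ev (entire_der ebc) (ray_cder w t).
have [_ hI] := cderM (cderMl w hD) (cder_conj hQ).
apply: derE (derM (is_derive1_powR (mu + 1) t0) hI) _.
rewrite addrK.
have -> : t `^ (mu + 1) = t * t `^ mu.
  by rewrite powRD ?(gt_eqF t0) ?implybT// powRr1 ?ltW// mulrC.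
have ode := Bessel_ode mu1 (t%:C * w).
rewrite -/(BQ mu _) -/(BD mu _) -/(BDD mu _).
move: (BQ mu (t%:C * w)) (BD mu (t%:C * w)) (BDD mu (t%:C * w)) ode
  => Q D DD ode.
have ImZ (r : R) z : complex.Im (r%:C * z) = r * complex.Im z.
  by rewrite cImM /= mul0r addr0.
have QQ : Q * conjc Q = (nc Q ^+ 2)%:C.
  rewrite sqr_nc; case: (Q) => q1 q2; apply: eq_ReIm; rewrite ?cReM ?cImM /=; ring.
have E : t * complex.Im (w * (DD * w) * conjc Q) =
    - (mu + 1) * complex.Im (w * D * conjc Q) - nc Q ^+ 2 / 4 * complex.Im w.
  rewrite -!ImZ -cImN -cImD; congr complex.Im.
  have -> : t%:C * (w * (DD * w) * conjc Q) = w * (t%:C * w * DD) * conjc Q by ring.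
  rewrite ode.
  have -> : (nc Q ^+ 2 / 4)%:C = Q * conjc Q / 4.
    by rewrite QQ rmorphM fmorphV rmorph_nat.
  by rewrite rmorphN; field.
have E2 : complex.Im (w * D * conjc (D * w)) = 0.
  by case: (w) => ? ?; case: (D) => ? ?; rewrite /=; ring.
rewrite cImD E2 addr0.
have -> : t * t `^ mu * complex.Im (w * (DD * w) * conjc Q) =
  t `^ mu * (t * complex.Im (w * (DD * w) * conjc Q)) by ring.
by rewrite E; field.
Qed.

Let half_lt (y : R) : 0 < y -> y <= y / 2 -> False.
Proof. lra. Qed.

(** At a zero w, W is 0 at t = 1; it is nonincreasing and at most C t^(mu + 1), which tends to 0
    with t because mu + 1 > 0. So W is 0 on the whole interval, its derivative vanishes, and BQ has
    a zero c w so close to 0 that [BQ_near0] excludes it. *)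
Let nonreal w : 0 < complex.Im w -> BQ mu w != 0.
Proof.
move=> w0; apply/eqP => Qw.
have m0 : 0 < mu + 1 by have := mu1; lra.
have W1 : W w 1 = 0.
  by rewrite /W powR1 mul1r mul1r Qw conjc0 mulr0.
have Wle (a b : R) : 0 < a -> a <= b -> W w b <= W w a.
  move=> a0 ab; apply: (is_derive_le0_le ab (df := fun t =>
    - (t `^ mu * nc (BQ mu (t%:C * w)) ^+ 2 * complex.Im w / 4))).
    by move=> t /andP[at_ _]; apply: dW; exact: lt_le_trans at_.
  move=> t _; rewrite oppr_le0 divr_ge0// mulr_ge0 ?(ltW w0)//.
  by rewrite mulr_ge0 ?powR_ge0// sqr_ge0.
have [C C0 hC] : exists2 C, 0 < C & forall t, 0 < t <= 1 -> W w t <= C * t `^ (mu + 1).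
  have [K1 K10 h1] := ev_bounded (nc w) (entire_der ebc).
  have [K2 K20 h2] := ev_bounded (nc w) ebc.
  exists (nc w * K1 * K2 + 1).
    by rewrite ltr_wpDl// !mulr_ge0 ?nc_ge0// ltW.
  move=> t /andP[t0 t1]; rewrite /W mulrC ler_wpM2r ?powR_ge0//.
  have tw : nc (t%:C * w) <= nc w.
    by rewrite ncM nc_real gtr0_norm// ler_piMl ?nc_ge0.
  rewrite (le_trans (ler_norm _))// (le_trans (nc_Im _))// !ncM ncJ.
  rewrite (@le_trans _ _ (nc w * K1 * K2))//; last by rewrite lerDl.
  apply: ler_pM; rewrite ?mulr_ge0 ?nc_ge0//; last exact: h2.
  by rewrite ler_wpM2l ?nc_ge0// h1.
have W0 t : 0 < t <= 1 -> W w t = 0.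
  move=> /andP[t0 t1]; apply/eqP; rewrite eq_le; apply/andP; split; last first.
    by rewrite -W1 Wle.
  rewrite leNgt; apply/negP => Wt.
  (* Chosen so that C u^(mu + 1) is half of the value of W at t, against monotonicity. *)
  pose u := (W w t / (2 * C)) `^ (mu + 1)^-1.
  have d0 : 0 < W w t / (2 * C) by rewrite divr_gt0// mulr_gt0.
  have u0 : 0 < u by rewrite powR_gt0.
  have uE : u `^ (mu + 1) = W w t / (2 * C).
    by rewrite /u -powRrM mulVf ?gt_eqF// powRr1 ?ltW.
  pose v := Num.min t u.
  have v0 : 0 < v by rewrite lt_min t0 u0.
  have vt : v <= t by rewrite ge_min lexx.
  have vu : v <= u by rewrite ge_min lexx orbT.
  have h1 := Wle _ _ v0 vt.
  have h2 : W w v <= C * v `^ (mu + 1) by apply: hC; rewrite v0 (le_trans vt).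
  have h3 : C * v `^ (mu + 1) <= C * u `^ (mu + 1).
    by rewrite ler_wpM2l ?(ltW C0)// ge0_ler_powR ?nnegrE ?(ltW m0) ?(ltW v0) ?(ltW u0).
  have h4 : C * u `^ (mu + 1) = W w t / 2 by rewrite uE; field; rewrite gt_eqF.
  rewrite h4 in h3; exact: (half_lt Wt (le_trans h1 (le_trans h2 h3))).
have [e e0 he] := BQ_near0.
pose b := Num.min 1 (e / (nc w + 1)).
have nw : 0 < nc w + 1 by rewrite ltr_wpDl ?nc_ge0.
have b0 : 0 < b by rewrite lt_min ltr01 divr_gt0.
have b1 : b <= 1 by rewrite ge_min lexx.
have bb : b / 2 < b by lra.
have [||c cI] := @MVT R (W w) (fun t =>
    - (t `^ mu * nc (BQ mu (t%:C * w)) ^+ 2 * complex.Im w / 4)) _ _ bb.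
- move=> t; rewrite in_itv /= => /andP[t0 _]; apply: dW.
  by rewrite (lt_trans _ t0)// divr_gt0.
- apply: is_derive_within => t /andP[t0 _]; apply: dW.
  by rewrite (lt_le_trans _ t0)// divr_gt0.
move: cI; rewrite in_itv /= => /andP[c1 c2].
have c0 : 0 < c by rewrite (lt_trans _ c1)// divr_gt0.
rewrite !W0 ?b0 ?b1 ?divr_gt0 ?(le_trans (ltW bb))// subrr.
move/esym/eqP; rewrite mulf_eq0 oppr_eq0 (gt_eqF (_ : 0 < b - b / 2)) ?orbF; last by lra.
have Qc : 0 < nc (BQ mu (c%:C * w)).
  rewrite nc_gt0 he// ncM nc_real gtr0_norm//.
  rewrite (@le_trans _ _ (e / (nc w + 1) * (nc w + 1)))//; last by rewrite divfK// gt_eqF.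
  apply: ler_pM; rewrite ?nc_ge0 ?(ltW c0) ?lerDl//.
  by rewrite (le_trans (ltW c2))// ge_min lexx orbT.
by apply/negP; rewrite gt_eqF// divr_gt0// mulr_gt0// mulr_gt0 ?powR_gt0 ?exprn_gt0.
Qed.

Lemma BQ_zero_real w : BQ mu w = 0 -> exists2 x, 0 < x & w = (x ^+ 2)%:C.
Proof.
move=> Qw.
have [wI|wI|wI] := ltgtP (complex.Im w) 0.
- have : 0 < complex.Im (conjc w) by case: (w) wI => a b /=; rewrite oppr_gt0.
  by move/nonreal; rewrite BQ_conj// Qw conjc0 eqxx.
- by have := nonreal wI; rewrite Qw eqxx.
- have wE : w = (complex.Re w)%:C by case: (w) wI => a b /= ->.
  have [r0|r0] := leP (complex.Re w) 0.
    have := @BQ_neg (- complex.Re w); rewrite oppr_ge0 opprK -wE Qw eqxx.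
    by move/(_ r0).
  exists (Num.sqrt (complex.Re w)); first by rewrite sqrtr_gt0.
  by rewrite sqr_sqrtr// ltW.
Qed.

End BesselZeros.

(** * Energy of the Bessel function, gaps between zeros, growth off the real axis *)

Section BesselEnergy.
Variables (R : realType) (mu : R).
Hypothesis mu1 : -1 < mu.
Implicit Types (z w : R[i]) (x t : R).

Let s := mu + 2^-1.
Let k := s ^+ 2 - s.
Let K := `|k|.

Let E x := bq mu x ^+ 2 + bp mu x ^+ 2.

(** This is u^2 + u'^2 for u = 2^mu sqrt(x) J_mu(x). The oscillation drops out of its derivative,
    which is at most K / x^2 times the energy, so multiplying by e^(K/x) or e^(-K/x) makes it
    monotone. *)
Definition energy x := x `^ (2 * s) * E x.

Let dL x : 0 < x ->
  is_derive x 1 energy (x `^ (2 * s) * (2 * k * (bp mu x * bq mu x)) / x ^+ 2).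
Proof.
move=> x0; have xN0 : x != 0 by rewrite gt_eqF.
apply: derE (derM (is_derive1_powR (2 * s) x0)
  (derD (derX2 (der_bq mu1 x0)) (derX2 (der_bp mu1 x0)))) _.
have -> : x `^ (2 * s - 1) = x `^ (2 * s) / x.
  by rewrite powRB ?powRr1 ?ltW// xN0 implybT.
by rewrite /E /k /s; field.
Qed.

Let E_ge0 x : 0 <= E x. Proof. by rewrite addr_ge0// sqr_ge0. Qed.

Let amgm (a b : R) : `|2 * (a * b)| <= b ^+ 2 + a ^+ 2.
Proof.
have h1 := sqr_ge0 (a - b); have h2 := sqr_ge0 (a + b).
have e1 : (a - b) ^+ 2 = b ^+ 2 + a ^+ 2 - 2 * (a * b) by ring.
have e2 : (a + b) ^+ 2 = b ^+ 2 + a ^+ 2 + 2 * (a * b) by ring.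
rewrite e1 subr_ge0 in h1; rewrite e2 in h2.
by rewrite ler_norml h1 andbT -subr_ge0 opprK addrC.
Qed.

Let kE x : `|2 * k * (bp mu x * bq mu x)| <= K * E x.
Proof.
rewrite (_ : _ * _ = k * (2 * (bp mu x * bq mu x))); last by ring.
by rewrite normrM ler_wpM2l// amgm.
Qed.

Let dI (c : R) x : 0 < x -> is_derive x 1 (fun u => expR (c * u^-1))
  (- (c / x ^+ 2) * expR (c * x^-1)).
Proof.
move=> x0; have xN0 : x != 0 by rewrite gt_eqF.
have h := is_deriveV (f := fun u : R => u) xN0 (der_id x).
apply: der_exp; apply: derE (derZ c h) _.
by rewrite /GRing.scale /= mulr1; ring.
Qed.

Lemma energy_upper a b : 0 < a -> a <= b ->
  energy b * expR (K * b^-1) <= energy a * expR (K * a^-1).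
Proof.
move=> a0 ab; apply: (is_derive_le0_le ab (f := fun x => energy x * expR (K * x^-1))).
  move=> x /andP[ax _]; have x0 := lt_le_trans a0 ax.
  exact: derM (dL x0) (dI K x0).
move=> x /andP[ax _]; have x0 := lt_le_trans a0 ax.
have := kE x; rewrite ler_norml => /andP[_ h].
have x20 : 0 < x ^+ 2 by rewrite exprn_gt0.
rewrite (_ : _ + _ = expR (K * x^-1) * x `^ (2 * s) / x ^+ 2 *
  (2 * k * (bp mu x * bq mu x) - K * E x)); last by rewrite /energy; ring.
rewrite mulr_ge0_le0 ?subr_le0//.
by rewrite divr_ge0 ?(ltW x20)// mulr_ge0 ?expR_ge0 ?powR_ge0.
Qed.

Lemma energy_lower a b : 0 < a -> a <= b ->
  energy a * expR (- K * a^-1) <= energy b * expR (- K * b^-1).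
Proof.
move=> a0 ab; apply: (is_derive_ge0_le ab (f := fun x => energy x * expR (- K * x^-1))).
  move=> x /andP[ax _]; have x0 := lt_le_trans a0 ax.
  exact: derM (dL x0) (dI (- K) x0).
move=> x /andP[ax _]; have x0 := lt_le_trans a0 ax.
have := kE x; rewrite ler_norml => /andP[h _].
have x20 : 0 < x ^+ 2 by rewrite exprn_gt0.
rewrite (_ : _ + _ = expR (- K * x^-1) * x `^ (2 * s) / x ^+ 2 *
  (2 * k * (bp mu x * bq mu x) + K * E x)); last by rewrite /energy; ring.
rewrite mulr_ge0//; last by rewrite -lerBlDr sub0r.
by rewrite divr_ge0 ?(ltW x20)// mulr_ge0 ?expR_ge0 ?powR_ge0.
Qed.

(** It is positive near 0, where BQ does not vanish, and the two monotone forms carry this to the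
    right and to the left. In particular u and u' have no common zero. *)
Lemma energy_gt0 x : 0 < x -> 0 < energy x.
Proof.
move=> x0; have [e e0 he] := BQ_near0 mu1.
pose y := Num.min 1 e; have y0 : 0 < y by rewrite lt_min ltr01.
have y1 : y <= 1 by rewrite ge_min lexx.
have Ly : 0 < energy y.
  rewrite mulr_gt0 ?powR_gt0// /E ltr_pwDl ?sqr_ge0// lt_def sqr_ge0 andbT.
  rewrite expf_neq0// /bq; apply/eqP => h.
  have : BQ mu (y ^+ 2)%:C = 0 by apply: eq_ReIm => //; exact: BQ_real.
  apply/eqP; apply: he; rewrite nc_real ger0_norm ?sqr_ge0//.
  rewrite (@le_trans _ _ y)//; last by rewrite ge_min lexx orbT.
  by rewrite expr2 ler_piMr ?(ltW y0).
have [yx|/ltW xy] := leP y x.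
  have := energy_lower y0 yx; rewrite -ler_pdivrMr ?expR_gt0//.
  by apply: lt_le_trans; rewrite divr_gt0 ?expR_gt0// mulr_gt0 ?expR_gt0.
have := energy_upper x0 xy; rewrite -ler_pdivrMr ?expR_gt0//.
by apply: lt_le_trans; rewrite divr_gt0 ?expR_gt0// mulr_gt0 ?expR_gt0.
Qed.

Lemma energy_bounds a : 0 < a -> exists c C, [/\ 0 < c, 0 < C &
  forall x, a <= x -> c <= energy x <= C].
Proof.
move=> a0; exists (energy a * expR (- K * a^-1)), (energy a * expR (K * a^-1)).
have La := energy_gt0 a0.
split; [by rewrite mulr_gt0 ?expR_gt0|by rewrite mulr_gt0 ?expR_gt0|].
move=> x ax; have x0 := lt_le_trans a0 ax; have Lx := energy_gt0 x0.
have Kx : 0 <= K * x^-1 by rewrite mulr_ge0 ?invr_ge0 ?(ltW x0)// normr_ge0.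
apply/andP; split.
  rewrite (le_trans (energy_lower a0 ax))// ler_piMr ?(ltW Lx)//.
  by rewrite -[leRHS](@expR0 R) ler_expR mulNr oppr_le0.
rewrite (le_trans _ (energy_upper a0 ax))// ler_peMr ?(ltW Lx)//.
by rewrite -[leLHS](@expR0 R) ler_expR.
Qed.

Lemma energyE x : 0 < x -> energy x = (x `^ s * bq mu x) ^+ 2 + (x `^ s * bp mu x) ^+ 2.
Proof.
move=> x0; rewrite /energy /E !exprMn -mulrDr; congr (_ * _).
by rewrite -powR_mulrn ?powR_ge0// -powRrM mulrC.
Qed.

(** At a critical point between two zeros of u the energy is all in u, so u^2 >= l there. On the way
    to either zero the slope of u is at most sqrt M, so the distance is at least sqrt(l / M). *)
Lemma zero_gap a0 : 0 < a0 -> exists2 d, 0 < d & forall a b, a0 <= a -> a < b ->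
  bq mu a = 0 -> bq mu b = 0 ->
  exists2 c, bp mu c = 0 & a + d <= c /\ c + d <= b.
Proof.
move=> a00; have [l [M [l0 M0 h]]] := energy_bounds a00.
exists (Num.sqrt (l / M)); first by rewrite sqrtr_gt0 divr_gt0.
move=> a b aa ab qa qb.
pose u x := x `^ s * bq mu x.
have du x : 0 < x -> is_derive x 1 u (x `^ s * bp mu x).
  move=> x0; have xN0 : x != 0 by rewrite gt_eqF.
  apply: derE (derM (is_derive1_powR s x0) (der_bq mu1 x0)) _.
  have -> : x `^ (s - 1) = x `^ s / x.
    by rewrite powRB ?powRr1 ?ltW// xN0 implybT.
  by rewrite /s; field.
have a_0 : 0 < a by exact: lt_le_trans aa.
have [|||x] := @Rolle R u a b ab.
- move=> x; rewrite in_itv /= => /andP[ax _].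
  by have [] := du x (lt_trans a_0 ax).
- apply: is_derive_within => x /andP[ax _]; apply: du; exact: lt_le_trans ax.
- by rewrite /u qa qb !mulr0.
rewrite in_itv /= => /andP[ax xb] dx0.
have x0 : 0 < x by exact: lt_trans ax.
have pE : x `^ s * bp mu x = 0.
  have [_ <-] := du x x0; by have [_ <-] := dx0.
have p0 : bp mu x = 0.
  by apply/eqP; move/eqP : pE; rewrite mulf_eq0 (gt_eqF (powR_gt0 _ x0)).
have ux : l <= u x ^+ 2.
  have /andP[+ _] := h x (le_trans aa (ltW ax)).
  by rewrite energyE// p0 mulr0 expr0n addr0.
have gap (y v : R) : a0 <= y -> y < v -> u y = 0 \/ u v = 0 -> l <= u y ^+ 2 + u v ^+ 2 ->
    Num.sqrt (l / M) <= v - y.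
  move=> ay yz u0 ul; have y_0 : 0 < y by exact: lt_le_trans ay.
  have [||c] := @MVT R u (fun x => x `^ s * bp mu x) y v yz.
  - move=> t; rewrite in_itv /= => /andP[yt _]; apply: du; exact: lt_trans yt.
  - apply: is_derive_within => t /andP[yt _]; apply: du; exact: lt_le_trans yt.
  rewrite in_itv /= => /andP[yc cz] E0.
  have uu : u y ^+ 2 + u v ^+ 2 = (c `^ s * bp mu c) ^+ 2 * (v - y) ^+ 2.
    rewrite -exprMn -E0; case: u0 => ->; rewrite expr0n /= ?add0r ?addr0 ?subr0//.
    by rewrite sqrrN.
  have cM : (c `^ s * bp mu c) ^+ 2 <= M.
    have c0 : 0 < c by exact: lt_trans yc.
    have /andP[_] := h c (le_trans ay (ltW yc)).
    by rewrite energyE//; apply: le_trans; rewrite lerDr sqr_ge0.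
  have zy : 0 <= v - y by rewrite subr_ge0 ltW.
  rewrite -(@ler_pXn2r _ 2) ?nnegrE ?sqrtr_ge0// sqr_sqrtr ?divr_ge0 ?(ltW l0) ?(ltW M0)//.
  by rewrite ler_pdivrMr// mulrC (le_trans ul)// uu ler_wpM2r// sqr_ge0.
have ua : u a = 0 by rewrite /u qa mulr0.
have ub : u b = 0 by rewrite /u qb mulr0.
exists x => //; split.
  rewrite addrC -lerBrDr; apply: gap => //; first by left.
  by rewrite ua expr0n add0r.
rewrite addrC -lerBrDr; apply: gap => //; first exact: le_trans (ltW ax).
  by right.
by rewrite ub expr0n addr0.
Qed.

(* A nonzero z is carried to the first quadrant by conjugation and z |-> -z,
   which change BQ (z ^ 2) at most by conjugation. *)
Lemma first_quadrant z : z != 0 -> exists t, [/\ 0 <= t <= pi / 2,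
  nc z * sin t = `|complex.Im z| & nc (BQ mu (z ^+ 2)) = nc (arc_q mu (nc z) t)].
Proof.
move=> z0; have r0 : 0 < nc z by rewrite nc_gt0.
have rN0 : nc z != 0 by rewrite gt_eqF.
pose c := `|complex.Re z| / nc z.
have c0 : 0 <= c by rewrite divr_ge0// ltW.
have c1 : c <= 1 by rewrite ler_pdivrMr// mul1r nc_Re.
have cI : -1 <= c <= 1 by rewrite c1 (le_trans _ c0)// lerN10.
have [/andP[t0 tpi] ct] := acos_def cI.
set t := acos c in t0 tpi ct *.
have st : nc z * sin t = `|complex.Im z|.
  have s0 : 0 <= nc z * sin t by rewrite mulr_ge0 ?nc_ge0// sin_ge0_pi// t0.
  apply/eqP; rewrite -(@eqrXn2 _ 2)// real_normK ?num_real// exprMn sin2cos2 ct.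
  rewrite /c expr_div_n real_normK ?num_real// mulrBr mulr1.
  by rewrite mulrCA divff ?expf_neq0// mulr1 sqr_nc addrC addKr.
have tp : t <= pi / 2.
  rewrite leNgt; apply/negP => pt.
  have := sin_gt0_pi (x := t - pi / 2).
  rewrite subr_gt0 pt /= => /(_ _) h.
  have : cos (t - pi / 2 + pi / 2) < 0.
    rewrite cosDpihalf oppr_lt0 h//.
    by rewrite (le_lt_trans (_ : _ <= pi - pi / 2))// ?lerB// ltrBlDr ltrDl divr_gt0// pi_gt0.
  by rewrite subrK ct ltNge c0.
exists t; split; [by rewrite t0|exact: st|].
rewrite /arc_q.
have aE : carc (nc z) t = `|complex.Re z| +i* `|complex.Im z|.
  by rewrite /carc st ct /c mulrC divfK.
rewrite aE.
have [ri|ri] := leP 0 (complex.Re z * complex.Im z).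
  congr (nc (BQ mu _)); rewrite !expr2; apply: eq_ReIm; rewrite ?cReM ?cImM /=.
    by rewrite -!expr2 !real_normK ?num_real.
  rewrite [complex.Im z * _]mulrC [`|complex.Im z| * _]mulrC -normrM.
  by rewrite ger0_norm.
have <- : conjc (z ^+ 2) = (`|complex.Re z| +i* `|complex.Im z|) ^+ 2.
  rewrite !expr2; apply: eq_ReIm.
    rewrite cReM /= -!expr2 !real_normK ?num_real//.
    by case: (z) => a b /=; rewrite -!expr2.
  rewrite cImM /= [`|complex.Im z| * _]mulrC -normrM ltr0_norm//.
  by case: (z) => a b /=; ring.
by rewrite (BQ_conj mu1) ncJ.
Qed.

(** * The arc estimates for the Bessel function *)

Section OnArc.
Variable r : R.
Hypothesis r1 : 1 <= r.

Let r0 : 0 < r. Proof. exact: lt_le_trans r1. Qed.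

Let rN0 : r != 0. Proof. by rewrite gt_eqF. Qed.

Let q1 t := complex.Re (arc_q mu r t).
Let q2 t := complex.Im (arc_q mu r t).
Let p1 t := complex.Re (arc_p mu r t).
Let p2 t := complex.Im (arc_p mu r t).
(** The error term of [cder_arc_p] without its coefficient, scaled by 1 / r so that its modulus is
    that of q. *)
Let f t := 'i%C * (conjc (carc r t) * arc_q mu r t) * (r^-1)%:C.
Let f1 t := complex.Re (f t).
Let f2 t := complex.Im (f t).

Let dq1 t : is_derive t 1 q1 (- (r * sin t) * p1 t - (r * cos t) * p2 t + s * q2 t).
Proof.
have [h _] := cder_arc_q mu1 r0 t; apply: derE h _.
by rewrite cReD cReN !cReM !cImM /carc /=; rewrite /q2 /p1 /p2 /s; ring.
Qed.

Let dq2 t : is_derive t 1 q2 ((r * cos t) * p1 t - (r * sin t) * p2 t - s * q1 t).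
Proof.
have [_ h] := cder_arc_q mu1 r0 t; apply: derE h _.
by rewrite cImD cImN !cImM !cReM /carc /=; rewrite /q1 /p1 /p2 /s; ring.
Qed.

Let dp1 t : is_derive t 1 p1
  (s * p2 t + (r * sin t) * q1 t + (r * cos t) * q2 t + k / r * f1 t).
Proof.
have [h _] := cder_arc_p mu1 r0 t; apply: derE h _.
rewrite !cReD !cReN !cReM !cImM !cReN !cImN /=.
by rewrite /f1 /f !cReM !cImM /= /q1 /q2 /p2 /k /s; field.
Qed.

Let dp2 t : is_derive t 1 p2
  (- s * p1 t - ((r * cos t) * q1 t - (r * sin t) * q2 t) + k / r * f2 t).
Proof.
have [_ h] := cder_arc_p mu1 r0 t; apply: derE h _.
rewrite !cImD !cImN !cImM !cReM !cReN !cImN /=.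
by rewrite /f2 /f !cImM !cReM /= /q1 /q2 /p1 /k /s; field.
Qed.

Let ff t : f1 t ^+ 2 + f2 t ^+ 2 = q1 t ^+ 2 + q2 t ^+ 2.
Proof.
rewrite -!sqr_nc /f !ncM ncJ nc_arc// nc_real ger0_norm ?invr_ge0 ?(ltW r0)//.
have -> : nc ('i%C : R[i]) = 1 by rewrite /nc /= expr0n add0r expr1n sqrtr1.
by rewrite mul1r mulrAC mulfV// mul1r.
Qed.

Let arc0 : carc r 0 = r%:C.
Proof. by rewrite /carc cos0 sin0 mulr1 mulr0. Qed.

Let q10 : q1 0 = bq mu r.
Proof. by rewrite /q1 /arc_q arc0 -rmorphXn. Qed.

Let q20 : q2 0 = 0.
Proof. by rewrite /q2 /arc_q arc0 -rmorphXn /= BQ_real. Qed.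

Let arc_p0 : arc_p mu r 0 = (bp mu r)%:C.
Proof.
rewrite /arc_p /arc_q arc0 conjc_real -rmorphXn /bp /bq.
have := BQ_real mu1 (r ^+ 2); have := BD_real mu1 (r ^+ 2).
move: (BQ mu _) (BD mu _) => [a b] [c d] /= -> ->.
have -> : (2 : R[i]) = 2%:C by rewrite rmorph_nat.
by apply: eq_ReIm; rewrite /= ?mul0r ?mulr0 ?subr0 ?addr0 ?add0r ?oppr0 /s; field.
Qed.

Let p10 : p1 0 = bp mu r. Proof. by rewrite /p1 arc_p0. Qed.

Let p20 : p2 0 = 0. Proof. by rewrite /p2 arc_p0. Qed.

Lemma arc_q_upper t : 0 <= t <= pi / 2 -> nc (arc_q mu r t) ^+ 2 <=
  expR (2 * K) * E r * expR (2 * (r * sin t)).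
Proof.
move=> ht; rewrite sqr_nc.
have h := arc_upper r1 dq1 dq2 dp1 dp2 ff ht.
have E0 : p1 0 ^+ 2 + p2 0 ^+ 2 + q1 0 ^+ 2 + q2 0 ^+ 2 = E r.
  by rewrite p10 p20 q10 q20 expr0n /= !addr0 /E addrC.
by rewrite E0 in h; exact: h.
Qed.

Lemma arc_q_lower t : 128 * (expR (2 * K) * expR 4 * (1 + 2 * K)) <= r ->
  bp mu r = 0 -> 0 <= t <= pi / 2 ->
  expR (- 4) / 32 * bq mu r ^+ 2 * expR (2 * (r * sin t)) <= nc (arc_q mu r t) ^+ 2.
Proof.
move=> rl pr ht; rewrite sqr_nc -q10.
have p100 : p1 0 = 0 by rewrite p10.
exact: (arc_lower r1 dq1 dq2 dp1 dp2 ff p100 p20 q20 rl ht).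
Qed.

End OnArc.

Lemma BQ_upper : exists2 C, 0 < C & forall z, 1 <= nc z ->
  nc (BQ mu (z ^+ 2)) * nc z `^ s <= C * expR `|complex.Im z|.
Proof.
have [c [C [c0 C0 hC]]] := energy_bounds (@ltr01 R).
exists (Num.sqrt (expR (2 * K) * C)).
  by rewrite sqrtr_gt0 mulr_gt0 ?expR_gt0.
move=> z z1; have r0 : 0 < nc z by exact: lt_le_trans z1.
have [|t [ht st ->]] := @first_quadrant z; first by rewrite -nc_gt0.
have CK : 0 <= expR (2 * K) * C by rewrite mulr_ge0 ?expR_ge0 ?(ltW C0).
rewrite -(@ler_pXn2r _ 2) ?nnegrE ?mulr_ge0 ?nc_ge0 ?powR_ge0 ?expR_ge0 ?sqrtr_ge0//.
rewrite exprMn [leRHS]exprMn sqr_sqrtr// -expRM_natl -st.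
have h := arc_q_upper z1 ht.
have ps : (nc z `^ s) ^+ 2 = nc z `^ (2 * s).
  by rewrite -powR_mulrn ?powR_ge0// -powRrM mulrC.
rewrite ps (le_trans (ler_wpM2r (powR_ge0 _ _) h))//.
rewrite mulrAC ler_wpM2r ?expR_ge0// -mulrA ler_wpM2l ?expR_ge0// mulrC.
by have /andP[] := hC _ z1.
Qed.

Lemma BQ_lower : exists r0 c, [/\ 1 <= r0, 0 < c & forall x, r0 <= x -> bp mu x = 0 ->
  forall z, nc z = x -> c * expR `|complex.Im z| <= nc (BQ mu (z ^+ 2)) * x `^ s].
Proof.
have [l [M [l0 M0 hl]]] := energy_bounds (@ltr01 R).
pose r0 := Num.max 1 (128 * (expR (2 * K) * expR 4 * (1 + 2 * K))).
pose c := expR (- 4) / 32 * l.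
have c0 : 0 < c by rewrite !mulr_gt0 ?expR_gt0.
exists r0, (Num.sqrt c); split.
- by rewrite le_max lexx.
- by rewrite sqrtr_gt0.
move=> x xr px z zx.
have x1 : 1 <= x by rewrite (le_trans _ xr)// le_max lexx.
have xl : 128 * (expR (2 * K) * expR 4 * (1 + 2 * K)) <= x.
  by rewrite (le_trans _ xr)// le_max lexx orbT.
have x0 : 0 < x by exact: lt_le_trans x1.
have [|t [ht st ->]] := @first_quadrant z; first by rewrite -nc_gt0 zx.
rewrite -(@ler_pXn2r _ 2) ?nnegrE ?mulr_ge0 ?nc_ge0 ?powR_ge0 ?expR_ge0 ?sqrtr_ge0//.
rewrite exprMn [leRHS]exprMn sqr_sqrtr ?(ltW c0)// -expRM_natl -st zx.
have h := arc_q_lower x1 xl px ht.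
apply: le_trans (ler_wpM2r (sqr_ge0 _) h).
have /andP[+ _] := hl _ x1.
rewrite energyE// px mulr0 expr0n addr0 => lx.
rewrite (_ : _ * (x `^ s) ^+ 2 = expR (- 4) / 32 * (x `^ s * bq mu x) ^+ 2 *
  expR (2 * (x * sin t))); last by rewrite exprMn; ring.
by rewrite ler_wpM2r ?expR_ge0// /c ler_wpM2l// divr_ge0// expR_ge0.
Qed.

End BesselEnergy.

(** * Partial fractions *)

Section PartialFractions.
Variable R : realType.
Implicit Types (a b : nat -> R[i]) (z w c : R[i]) (n m : nat).

(** Continuity: at z close to w, a(w) equals -(z - w) times a bounded value of [quo]. *)
Lemma ev_eq0_off a w : entire a -> (forall z, z != w -> ev a z = 0) ->
  ev a w = 0.
Proof.
move=> ea h; have [K K0 hK] := ev_locbound w (entire_quo w ea).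
apply/eqP; rewrite -nc_eq0 eq_le nc_ge0 andbT leNgt; apply/negP => aw.
pose d := Num.min 1 (nc (ev a w) / (2 * K)).
have d0 : 0 < d by rewrite lt_min ltr01 divr_gt0// mulr_gt0.
pose z := w + d%:C.
have zw : z - w = d%:C by rewrite /z addrAC subrr add0r.
have dn : nc (d%:C : R[i]) = d by rewrite nc_real gtr0_norm.
have az : ev a z = 0.
  by apply: h; rewrite -subr_eq0 zw -nc_eq0 dn gt_eqF.
have := ev_quo w z ea; rewrite az zw => /esym/eqP; rewrite addr_eq0 => /eqP E.
have h1 : nc (ev a w) <= d * K.
  rewrite E ncN ncM dn ler_wpM2l ?(ltW d0)// hK// zw dn.
  by rewrite /d ge_min lexx.
have h2 : d * K <= nc (ev a w) / 2.
  have -> : nc (ev a w) / 2 = nc (ev a w) / (2 * K) * K by field; rewrite gt_eqF.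
  by rewrite ler_wpM2r ?(ltW K0)// ge_min lexx orbT.
have := le_trans h1 h2; rewrite leNgt => /negP; apply.
by rewrite ltr_pdivrMr// ltr_pMr// ltr1n.
Qed.

Lemma quo_unique a b w : entire a -> entire b ->
  (forall z, ev a z = (z - w) * ev b z) -> forall z, ev (quo a w) z = ev b z.
Proof.
move=> ea eb h.
have eq := entire_quo w ea.
have aw : ev a w = 0 by rewrite h subrr mul0r.
pose d k := quo a w k + (-1) * b k.
have ed : entire d by apply: entire_add => //; exact: entire_scale.
have dE z : ev d z = ev (quo a w) z - ev b z.
  by rewrite ev_add ?ev_scale ?mulN1r//; exact: entire_scale.
have d0 z : z != w -> ev d z = 0.
  move=> zw; apply/eqP; rewrite dE subr_eq0.
  have zw0 : z - w != 0 by rewrite subr_eq0.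
  apply/eqP/(mulfI zw0).
  by have := ev_quo w z ea; rewrite aw add0r h => <-.
move=> z; apply/eqP; rewrite -subr_eq0 -dE; apply/eqP.
have [->|zw] := eqVneq z w; [exact: ev_eq0_off|exact: d0].
Qed.

Lemma ev_der_factor a b w : entire a -> entire b ->
  (forall z, ev a z = (z - w) * ev b z) -> ev (der a) w = ev b w.
Proof.
move=> ea eb h; rewrite -(quo_unique ea eb h) ev_quo_diag//.
exact: entire_der.
Qed.

Lemma entire_mul_linear a w : entire a -> exists2 b, entire b &
  forall z, ev b z = (z - w) * ev a z.
Proof.
move=> ea; pose up k := if k is k'.+1 then a k' else 0.
have eup : entire up.
  move=> rho r0; have [C aC] := ea _ r0; exists (C * rho); case=> [|k]; rewrite /up.
    by rewrite nc0 mul0r mulr_ge0 ?(ltW r0)// (entire_ge0 r0 aC).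
  by rewrite exprSr mulrA ler_wpM2r ?(ltW r0).
exists (fun k => up k + - w * a k).
  by apply: entire_add => //; exact: entire_scale.
move=> z; rewrite ev_add ?ev_scale//; last exact: entire_scale.
by rewrite (ev_shift z eup) add0r mulrBl mulNr.
Qed.

Lemma entire_mul_linears (I : Type) (s : seq I) (P : pred I) (x : I -> R[i]) a :
  entire a -> exists2 b, entire b &
  forall z, ev b z = \prod_(i <- s | P i) (z - x i) * ev a z.
Proof.
move=> ea; elim: s => [|i s [b eb hb]].
  by exists a => // z; rewrite big_nil mul1r.
have [Pi|Pi] := boolP (P i); last first.
  by exists b => // z; rewrite big_cons (negbTE Pi).
have [c ec hc] := entire_mul_linear (x i) eb.
by exists c => // z; rewrite big_cons Pi hc hb mulrA.
Qed.

Variables (P Q : nat -> R[i]) (x : nat -> R[i]).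
Hypotheses (eP : entire P) (eQ : entire Q) (xI : injective x).
Hypothesis Qx : forall m, ev Q (x m) = 0.
Hypothesis dQx : forall m, ev (der Q) (x m) != 0.
Hypothesis Qzero : forall z, ev Q z = 0 -> exists m, z = x m.
Hypothesis Q0 : ev Q 0 != 0.

Definition residue m := ev P (x m) / ev (der Q) (x m).

Let Pi n z := \prod_(i < n) (z - x i).

Let Pi_neq0 n m : (n <= m)%N -> Pi n (x m) != 0.
Proof.
move=> nm; apply/prodf_neq0 => i _; rewrite subr_eq0; apply/eqP => /xI E.
by move: (ltn_ord i); rewrite -E ltnNge nm.
Qed.

(** Zeros are removed one at a time so that everything stays entire. Since [quo Q (x i)] is Q / (z -
    x i), dividing by Q exhibits P/Q as the sum of the first n principal parts plus N/Q1. *)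
Lemma partial_fractions n : exists N Q1, [/\ entire N, entire Q1,
  forall z, ev Q z = Pi n z * ev Q1 z &
  forall z, ev P z = \sum_(i < n) residue i * ev (quo Q (x i)) z + Pi n z * ev N z].
Proof.
elim: n => [|n [N [Q1 [eN eQ1 hQ hP]]]].
  exists P, Q; split => // z; rewrite /Pi big_ord0 mul1r//.
  by rewrite big_ord0 add0r.
have Q1x : ev Q1 (x n) = 0.
  apply/eqP; have /eqP := Qx n; rewrite hQ mulf_eq0.
  by rewrite (negbTE (Pi_neq0 (leqnn n))).
have [Q2 eQ2 hQ2] : exists2 b, entire b & forall z, ev Q1 z = (z - x n) * ev b z.
  exists (quo Q1 (x n)); first exact: entire_quo.
  by move=> z; rewrite (ev_quo (x n) z eQ1) Q1x add0r.
have [G eG hG] := entire_mul_linears (index_enum 'I_n) xpredT (fun i : 'I_n => x i) eQ2.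
have QG z : ev Q z = (z - x n) * ev G z by rewrite hG hQ hQ2 mulrCA.
have quoE := quo_unique eQ eG QG.
have derE := ev_der_factor eQ eG QG.
have Q2x : ev Q2 (x n) != 0.
  by have := dQx n; rewrite derE hG mulf_eq0 negb_or => /andP[].
(* At x n every earlier [quo Q (x i)] vanishes, so P alone determines N there; this value makes the
   residue the constant split off by [quot_step]. *)
have Nx : ev N (x n) = residue n * ev Q2 (x n).
  have := hP (x n); rewrite big1 ?add0r => [E|i _].
    rewrite /residue derE hG E -/(Pi n (x n)).
    by field; rewrite Q2x Pi_neq0.
  have := ev_quo (x i) (x n) eQ; rewrite !Qx add0r => /esym/eqP.
  rewrite mulf_eq0 subr_eq0 => /orP[/eqP/xI E|/eqP ->]; last by rewrite mulr0.
  by have := ltn_ord i; rewrite -E ltnn.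
have [c1 [N1 [eN1 c1E hN]]] := quot_step eN eQ2 Q2x.
have {}c1E : c1 = residue n by rewrite c1E Nx mulfK.
have PiS z : Pi n.+1 z = Pi n z * (z - x n) by rewrite /Pi big_ord_recr.
have PiQ2 z : ev (quo Q (x n)) z = Pi n z * ev Q2 z.
  exact: etrans (quoE z) (hG z).
exists N1, Q2; split; [exact: eN1|exact: eQ2| |] => z.
  by rewrite PiS hQ hQ2; exact: mulrA.
rewrite PiS big_ord_recr /= PiQ2 (hP z) (hN z) c1E.
by ring.
Qed.

(* (z - x)^-1 + x^-1 is the principal part normalised to vanish at z = 0. *)
Definition pf_remainder n z := ev P z / ev Q z - ev P 0 / ev Q 0 -
  \sum_(i < n) residue i * ((z - x i)^-1 + (x i)^-1).

(** The remainder is z times (M(z) / z) / Q1(z), where M = N - h0 Q1 vanishes at 0. The maximum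
    principle is applied to the second factor, Q1 having no zero in the disc, so the factor |z|
    survives in the bound. *)
Lemma pf_remainder_max n (r B : R) : 0 < r ->
  (forall m, (m < n)%N -> nc (x m) < r) -> (forall m, (n <= m)%N -> r < nc (x m)) ->
  (forall z, nc z = r -> nc (pf_remainder n z) <= B * r) ->
  forall z, nc z <= r -> ev Q z != 0 -> nc (pf_remainder n z) <= B * nc z.
Proof.
move=> r0 xlt xgt hB.
have [N [Q1 [eN eQ1 hQ hP]]] := partial_fractions n.
(* A zero of Q1 at a removed point would be a double zero of Q. *)
have Q1x m : (m < n)%N -> ev Q1 (x m) != 0.
  move=> mn; pose i0 := Ordinal mn.
  have [G eG hG] := entire_mul_linears (index_enum 'I_n) (fun i => i != i0)
    (fun i : 'I_n => x i) eQ1.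
  have QG z : ev Q z = (z - x m) * ev G z.
    by rewrite hQ /Pi (bigD1 i0)//= hG mulrA.
  have := dQx m; rewrite (ev_der_factor eQ eG QG) hG mulf_eq0 negb_or.
  by move=> /andP[].
have Q1r z : nc z <= r -> ev Q1 z != 0.
  move=> zr; apply/eqP => Qz.
  have [m zE] : exists m, z = x m by apply: Qzero; rewrite hQ Qz mulr0.
  have [mn|nm] := ltnP m n; first by have := Q1x m mn; rewrite -zE Qz eqxx.
  by have := xgt m nm; rewrite -zE ltNge zr.
have x0 m : x m != 0.
  by apply/eqP => E; move/eqP: Q0; apply; rewrite -E Qx.
have Q10 : ev Q1 0 != 0 by apply: Q1r; rewrite nc0 ltW.
have quotE z : ev Q z != 0 -> ev P z / ev Q z =
    \sum_(i < n) residue i / (z - x i) + ev N z / ev Q1 z.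
  move=> Qz; have Q1z : ev Q1 z != 0.
    by apply: contraNneq Qz => E; rewrite hQ E mulr0.
  have Piz : Pi n z != 0 by apply: contraNneq Qz => E; rewrite hQ E mul0r.
  rewrite {1}hP mulrDl mulr_suml; congr (_ + _); last first.
    by rewrite hQ; field; rewrite Q1z.
  apply: eq_bigr => i _.
  have zx : z - x i != 0.
    by apply: contraNneq Qz => /eqP; rewrite subr_eq0 => /eqP ->; rewrite Qx.
  have QE : ev Q z = (z - x i) * ev (quo Q (x i)) z.
    by rewrite (ev_quo (x i) z eQ) Qx add0r.
  have qz : ev (quo Q (x i)) z != 0.
    by apply: contraNneq Qz => E; rewrite QE E mulr0.
  by rewrite QE; field; rewrite ?qz ?zx.
pose h0 := ev N 0 / ev Q1 0.
pose M k := N k + - h0 * Q1 k.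
have eM : entire M by apply: entire_add => //; exact: entire_scale.
have ME z : ev M z = ev N z - h0 * ev Q1 z.
  by rewrite ev_add ?ev_scale ?mulNr//; exact: entire_scale.
have M0 : ev M 0 = 0 by rewrite ME /h0 divfK// subrr.
have MQ z : ev M z = z * ev (quo M 0) z by rewrite {1}(ev_quo 0 z eM) M0 add0r subr0.
have remE z : ev Q z != 0 -> pf_remainder n z = z * (ev (quo M 0) z / ev Q1 z).
  move=> Qz; have Q1z : ev Q1 z != 0.
    by apply: contraNneq Qz => E; rewrite hQ E mulr0.
  have alg (a b h : R[i]) : b != 0 -> (a - h * b) / b = a / b - h by move=> b0; field.
  rewrite /pf_remainder (quotE _ Qz) (quotE _ Q0) mulrA -(MQ z) (ME z) (alg _ _ _ Q1z).
  have -> : \sum_(i < n) residue i / (0 - x i) = - \sum_(i < n) residue i / x i.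
    by rewrite -sumrN; apply: eq_bigr => i _; rewrite sub0r invrN mulrN.
  have -> : \sum_(i < n) residue i * ((z - x i)^-1 + (x i)^-1) =
      \sum_(i < n) residue i / (z - x i) + \sum_(i < n) residue i / x i.
    by rewrite -big_split; apply: eq_bigr => i _; rewrite mulrDr.
  have key (S1 S2 u v : R[i]) : S1 + u - (- S2 + v) - (S1 + S2) = u - v by ring.
  exact: key.
have circ z : nc z = r -> nc (ev (quo M 0) z / ev Q1 z) <= B.
  move=> zr; have Qz : ev Q z != 0.
    apply/eqP => /Qzero[m zE]; have [mn|nm] := ltnP m n.
      by have := xlt m mn; rewrite -zE zr ltxx.
    by have := xgt m nm; rewrite -zE zr ltxx.
  have := hB z zr; rewrite remE// ncM zr mulrC.
  by rewrite ler_pM2r.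
move=> z zr Qz; rewrite remE// ncM mulrC ler_wpM2r ?nc_ge0//.
by apply: (maximum_principle (entire_quo 0 eM) eQ1 r0 Q1r circ).
Qed.

End PartialFractions.

(** * The Hankel transform *)

Section WeightedIntegral.
Variables (R : realType) (g : R -> R).
Local Notation mu := (@lebesgue_measure R).
Local Notation D := (`]0, 1[%classic : set (measurableTypeR R)).
Hypothesis gI : mu.-integrable D (EFin \o g).
Implicit Types (h phi : R -> R) (c M t : R).

Let mD : measurable D. Proof. exact: measurable_itv. Qed.

Let Dt t : D t -> 0 < t < 1. Proof. by rewrite /= in_itv. Qed.

Definition wint h := \int[mu]_(t in D) (g t * h t).

Definition wmass := \int[mu]_(t in D) `|g t|.

Let mg : measurable_fun D g.
Proof. by have /integrableP[/measurable_EFinP] := gI. Qed.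

Let absI : mu.-integrable D (EFin \o (fun t => `|g t|)).
Proof. exact: integrable_norm. Qed.

Lemma wint_integrable h M : measurable_fun D h ->
  (forall t, 0 < t < 1 -> `|h t| <= M) ->
  mu.-integrable D (EFin \o (fun t => g t * h t)).
Proof.
move=> mh hM.
have MI : mu.-integrable D (EFin \o (fun t => `|M| * `|g t|)).
  exact: (integrableZl mD `|M| absI).
apply: le_integrable MI => //.
  by apply/measurable_EFinP; apply: measurable_funM.
move=> t /Dt t01 /=; rewrite lee_fin !normrM !normr_id mulrC ler_wpM2r//.
by rewrite (le_trans (hM t t01))// ler_norm.
Qed.

(** The dominating function is left free: with g(t) = t^(nu + 1/2) f(t) and nu >= -1/2 the needed
    estimate is against |f|, not against |g|. *)
Lemma wint_le h phi c M : measurable_fun D h ->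
  (forall t, 0 < t < 1 -> `|h t| <= M) ->
  mu.-integrable D (EFin \o phi) ->
  (forall t, 0 < t < 1 -> `|g t * h t| <= c * phi t) ->
  `|wint h| <= c * \int[mu]_(t in D) phi t.
Proof.
move=> mh hM phiI hphi.
have hI := wint_integrable mh hM.
rewrite /wint (le_trans (le_normr_Rintegral mD hI))//.
rewrite -(RintegralZl _ mD phiI).
apply: (le_Rintegral mD) => //.
- exact: integrable_norm.
- exact: (integrableZl mD c phiI).
Qed.

Lemma wint_le_mass h M : measurable_fun D h ->
  (forall t, 0 < t < 1 -> `|h t| <= M) -> `|wint h| <= M * wmass.
Proof.
move=> mh hM; apply: (wint_le mh hM absI) => t t01.
by rewrite normrM mulrC ler_wpM2r// hM.
Qed.

Lemma wintD h1 h2 M1 M2 : measurable_fun D h1 -> measurable_fun D h2 ->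
  (forall t, 0 < t < 1 -> `|h1 t| <= M1) ->
  (forall t, 0 < t < 1 -> `|h2 t| <= M2) ->
  wint (fun t => h1 t + h2 t) = wint h1 + wint h2.
Proof.
move=> m1 m2 b1 b2; rewrite /wint -(RintegralD mD).
- by apply: eq_Rintegral => t _; rewrite mulrDr.
- exact: wint_integrable m1 b1.
- exact: wint_integrable m2 b2.
Qed.

Lemma wintZ h M c : measurable_fun D h ->
  (forall t, 0 < t < 1 -> `|h t| <= M) ->
  wint (fun t => c * h t) = c * wint h.
Proof.
move=> m1 b1; rewrite /wint -(RintegralZl _ mD).
- by apply: eq_Rintegral => t _; rewrite mulrCA.
- exact: wint_integrable m1 b1.
Qed.

Lemma wint0 : wint (fun=> 0) = 0.
Proof.
have h : wint (fun=> 0 * 0) = 0 * wint (fun=> 0).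
  by apply: (@wintZ (fun=> 0) 0 0) => // t _; rewrite normr0.
by rewrite mul0r in h; rewrite h mul0r.
Qed.

Lemma wint_sum (n : nat) (h : nat -> R -> R) (c : nat -> R) (M : R) :
  (forall k, measurable_fun D (h k)) ->
  (forall k t, 0 < t < 1 -> `|h k t| <= M) ->
  wint (fun t => \sum_(k < n) c k * h k t) = \sum_(k < n) c k * wint (h k).
Proof.
move=> mh hM.
suff H : measurable_fun D (fun t => \sum_(k < n) c k * h k t) /\
   (forall t, 0 < t < 1 -> `|\sum_(k < n) c k * h k t| <= \sum_(k < n) `|c k| * M) /\
   wint (fun t => \sum_(k < n) c k * h k t) = \sum_(k < n) c k * wint (h k).
  by have [_ []] := H.
elim: n => [|n [mS [bS IH]]].
  have -> : (fun t => \sum_(k < 0) c k * h k t) = (fun=> 0).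
    by apply/funext => t; rewrite big_ord0.
  split=> //.
  split; first by move=> t _; rewrite !big_ord0 normr0.
  by rewrite wint0 big_ord0.
have mc : measurable_fun D (fun t => c n * h n t) by apply: measurable_funM.
have bc t : 0 < t < 1 -> `|c n * h n t| <= `|c n| * M.
  by move=> t01; rewrite normrM ler_wpM2l// hM.
have -> : (fun t => \sum_(k < n.+1) c k * h k t) =
    (fun t => \sum_(k < n) c k * h k t + c n * h n t).
  by apply/funext => t; rewrite big_ord_recr.
split; first exact: measurable_funD.
split.
  move=> t t01; rewrite big_ord_recr /= (le_trans (ler_normD _ _))//.
  by rewrite [leRHS]big_ord_recr /= lerD ?bS ?bc.
by rewrite (wintD mS mc bS bc) IH big_ord_recr /= (wintZ _ (mh n) (hM n)).
Qed.

End WeightedIntegral.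

Section SeriesTail.
Variable R : realType.
Implicit Types (a : nat -> R[i]) (z w : R[i]).

Lemma ev_split a w n : entire a -> ev a w = pser a w n + w ^+ n * ev (shift a n) w.
Proof.
move=> ea; elim: n => [|n IH].
  have -> : shift a 0 = a by apply/funext => i; rewrite /shift ?addn0 ?add0n.
  by rewrite /pser big_ord0 add0r expr0 mul1r.
rewrite IH /pser big_ord_recr /= (ev_tail w n ea) exprS; ring.
Qed.

Lemma ev_tail_small a (M : R) : entire a -> exists2 C, 0 < C & forall n w,
  nc w <= M -> nc (w ^+ n * ev (shift a n) w) <= C * 2^-1 ^+ n.
Proof.
move=> ea; pose r := 2 * `|M| + 1.
have r0 : 0 < r by rewrite ltr_wpDl// mulr_ge0.
have [C aC] := ea _ r0; have C0 := entire_ge0 r0 aC.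
exists (2 * C + 1); first by rewrite ltr_wpDl// mulr_ge0.
move=> n w wM; have wr : 2 * nc w <= r.
  rewrite /r (le_trans (_ : _ <= 2 * `|M|)) ?lerDl// ler_wpM2l//.
  by rewrite (le_trans wM)// ler_norm.
have h : nc (ev (shift a n) w) <= 2 * (C / r ^+ n).
  apply: (ev_le (entire_shift n ea) r0 wr) => i.
  by rewrite ler_pdivlMr ?exprn_gt0// -mulrA -exprD addnC; exact: aC.
rewrite ncM ncX (@le_trans _ _ ((r / 2) ^+ n * (2 * (C / r ^+ n))))//.
  apply: ler_pM; rewrite ?exprn_ge0 ?nc_ge0//.
  by rewrite lerXn2r ?nnegrE ?nc_ge0 ?divr_ge0 ?(ltW r0)// ler_pdivlMr// mulrC.
have -> : (r / 2) ^+ n * (2 * (C / r ^+ n)) = 2 * C * 2^-1 ^+ n.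
  rewrite exprMn; have : r ^+ n != 0 by rewrite expf_neq0// gt_eqF.
  by move: (r ^+ n) (2^-1 ^+ n) => p q p0; field.
by rewrite ler_wpM2r ?exprn_ge0// lerDl.
Qed.

End SeriesTail.

(** * Termwise integration of an entire series *)

Section IntegralOfSeries.
Variables (R : realType) (g : R -> R) (a : nat -> R).
Local Notation lm := (@lebesgue_measure R).
Local Notation D := (`]0, 1[%classic : set (measurableTypeR R)).
Hypothesis gI : lm.-integrable D (EFin \o g).
Hypothesis ea : entire (fun k => (a k)%:C : R[i]).
Implicit Types (z w : R[i]) (t c : R).

Local Notation ac := (fun k => (a k)%:C : R[i]).

(** Coefficients of the function z |-> int_0^1 g(t) a(z t^2) dt. *)
Definition moment_series k : R[i] := (a k * wint g (fun t => t ^+ k.*2))%:C.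

Let mpow n : measurable_fun D (fun t : R => t ^+ n).
Proof. by apply: measurable_funTS; exact: exprn_measurable. Qed.

Let pow1 n t : 0 < t < 1 -> `|t ^+ n| <= 1.
Proof. by move=> /andP[t0 /ltW t1]; rewrite normrX ger0_norm ?(ltW t0)// exprn_ile1// ltW. Qed.

Lemma entire_moment_series : entire moment_series.
Proof.
move=> rho r0; have [C aC] := ea r0.
exists (C * wmass g) => k; rewrite /moment_series nc_real normrM mulrAC.
have h := wint_le_mass gI (mpow k.*2) (pow1 k.*2).
rewrite mul1r in h; apply: ler_pM => //; first by rewrite mulr_ge0// exprn_ge0// ltW.
by have := aC k; rewrite nc_real.
Qed.

Lemma nc_sq_scale z t : 0 < t < 1 -> nc (z * (t ^+ 2)%:C) <= nc z.
Proof.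
move=> t01; rewrite ncM nc_real ler_piMr ?nc_ge0//; exact: pow1.
Qed.

Lemma cder_ev_scale z t : cder (fun u => ev ac (z * (u ^+ 2)%:C)) t
  (ev (der ac) (z * (t ^+ 2)%:C) * (z * (2 * t * 1)%:C)).
Proof.
by apply: cder_ev => //; apply: cderMl; apply: cder_real; exact: derX2 (der_id t).
Qed.

Lemma measurable_Re_ev z :
  measurable_fun D (fun t => complex.Re (ev ac (z * (t ^+ 2)%:C))).
Proof.
apply: measurable_funTS; apply: continuous_measurable_fun => t.
by have [h _] := cder_ev_scale z t; exact: is_derive_cts h.
Qed.

Lemma measurable_Im_ev z :
  measurable_fun D (fun t => complex.Im (ev ac (z * (t ^+ 2)%:C))).
Proof.
apply: measurable_funTS; apply: continuous_measurable_fun => t.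
by have [_ h] := cder_ev_scale z t; exact: is_derive_cts h.
Qed.

(** What Re and Im have in common; one proof of termwise integration then serves both. *)
Let Phi (phi : R[i] -> R) := [/\ forall u v, phi (u + v) = phi u + phi v,
  forall (x : R) u, phi (x%:C * u) = x * phi u & forall u, `|phi u| <= nc u].

Let Phi_sum phi (u : nat -> R[i]) n : Phi phi ->
  phi (\sum_(k < n) u k) = \sum_(k < n) phi (u k).
Proof.
move=> [pD pZ _]; elim: n => [|n IH].
  by rewrite !big_ord0; have := pZ 0 0; rewrite mul0r mul0r.
by rewrite !big_ord_recr /= pD IH.
Qed.

Let PhiRe : Phi (@complex.Re R).
Proof.
split; [exact: cReD|by move=> x u; rewrite cReM /= mul0r subr0|exact: nc_Re].
Qed.

Let PhiIm : Phi (@complex.Im R).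
Proof.
split; [exact: cImD|by move=> x u; rewrite cImM /= mul0r addr0|exact: nc_Im].
Qed.

(** Uniform convergence: as |z t^2| <= |z|, the n-th partial sum is off by at most C 2^-n for all t
    at once, and this error integrates to at most C 2^-n times the mass of g. *)
Let wint_phi phi z : Phi phi ->
  measurable_fun D (fun t => phi (ev ac (z * (t ^+ 2)%:C))) ->
  wint g (fun t => phi (ev ac (z * (t ^+ 2)%:C))) = phi (ev moment_series z).
Proof.
move=> hphi mphi; have [pD pZ pb] := hphi.
have [K K0 bK] := ev_bounded (nc z) ea.
have [C C0 tC] := ev_tail_small (nc z) ea.
set I := wint _ _.
have pB u v : phi (u - v) = phi u - phi v.
  have -> : u - v = u + (-1)%:C * v by rewrite rmorphN rmorph1 mulN1r.
  by rewrite pD pZ mulN1r.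
have hn n : `|I - phi (pser moment_series z n)| <= C * 2^-1 ^+ n * wmass g.
  pose h (k : nat) t : R := t ^+ k.*2.
  pose S t := \sum_(k < n) (a k * phi (z ^+ k)) * h k t.
  have SE t : S t = phi (pser ac (z * (t ^+ 2)%:C) n).
    rewrite /pser (Phi_sum (fun k => (a k)%:C * (z * (t ^+ 2)%:C) ^+ k) n hphi).
    apply: eq_bigr => k _.
    rewrite exprMn -rmorphXn -exprM mul2n /h.
    have -> : (a k)%:C * (z ^+ k * (t ^+ k.*2)%:C) = (a k * t ^+ k.*2)%:C * z ^+ k.
      by rewrite rmorphM; ring.
    by rewrite pZ; ring.
  have mS : measurable_fun D S.
    by apply: measurable_sum => k; apply: measurable_funM => //; exact: mpow.
  have IS : wint g S = phi (pser moment_series z n).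
    rewrite /S (@wint_sum _ _ gI n h (fun k => a k * phi (z ^+ k)) 1) //; last first.
      by move=> k t t01; exact: pow1.
    + by move=> k; exact: mpow.
    rewrite /pser (Phi_sum (fun k => moment_series k * z ^+ k) n hphi).
    apply: eq_bigr => k _.
    by rewrite /moment_series pZ; ring.
  have d01 t : 0 < t < 1 ->
      `|phi (ev ac (z * (t ^+ 2)%:C)) - S t| <= C * 2^-1 ^+ n.
    move=> t01; rewrite SE -pB (ev_split (z * (t ^+ 2)%:C) n ea) addrC addKr.
    exact: le_trans (pb _) (tC n _ (nc_sq_scale z t01)).
  have b01 t : 0 < t < 1 -> `|phi (ev ac (z * (t ^+ 2)%:C))| <= K.
    by move=> t01; exact: le_trans (pb _) (bK _ (nc_sq_scale z t01)).
  rewrite -IS.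
  pose d t := phi (ev ac (z * (t ^+ 2)%:C)) - S t.
  have md : measurable_fun D d by exact: measurable_funB.
  have bS t : 0 < t < 1 -> `|S t| <= K + C * 2^-1 ^+ n.
    move=> t01; have -> : S t = phi (ev ac (z * (t ^+ 2)%:C)) - d t.
      by rewrite /d subKr.
    by rewrite (le_trans (ler_normB _ _))// lerD ?b01//; exact: d01.
  have -> : I - wint g S = wint g d.
    have := wintD gI mS md bS d01.
    have -> : (fun t => S t + d t) = (fun t => phi (ev ac (z * (t ^+ 2)%:C))).
      by apply/funext => t; rewrite /d addrC subrK.
    by rewrite -/I => ->; rewrite addrC addKr.
  exact: wint_le_mass.
apply/eqP; rewrite -subr_eq0 -normr_le0; apply/ler_addgt0Pl => e e0; rewrite addr0.
have c1 : (fun n => C * wmass g * 2^-1 ^+ n) @ \oo --> (0 : R).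
  rewrite -[X in _ --> X](mulr0 (C * wmass g)); apply: cvgMr.
  by apply: cvg_expr; rewrite ger0_norm// invf_lt1// ltr1n.
have := ev_cvg z entire_moment_series => /cvgP_nc c2.
have e2 : 0 < e / 2 by rewrite divr_gt0.
near \oo => n.
have h1 : C * 2^-1 ^+ n * wmass g <= e / 2.
  rewrite mulrAC; apply/ltW; apply: le_lt_trans (ler_norm _) _.
  rewrite -[X in `|X|]subr0 distrC; near: n.
  by move/cvgrPdist_lt: c1; apply.
have h2 : nc (pser moment_series z n - ev moment_series z) <= e / 2.
  apply/ltW; apply: le_lt_trans (ler_norm _) _.
  rewrite -normrN -[X in `|X|]sub0r; near: n.
  by move/cvgrPdist_lt: c2; apply.
have -> : I - phi (ev moment_series z) =
  (I - phi (pser moment_series z n)) + phi (pser moment_series z n - ev moment_series z).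
  by rewrite pB; ring.
rewrite (le_trans (ler_normD _ _))// [leRHS]splitr lerD//.
  exact: le_trans (hn n) h1.
exact: le_trans (pb _) h2.
Unshelve. all: by end_near. Qed.

Lemma wint_Re_ev z : wint g (fun t => complex.Re (ev ac (z * (t ^+ 2)%:C))) =
  complex.Re (ev moment_series z).
Proof. by apply: wint_phi => //; exact: measurable_Re_ev. Qed.

Lemma wint_Im_ev z : wint g (fun t => complex.Im (ev ac (z * (t ^+ 2)%:C))) =
  complex.Im (ev moment_series z).
Proof. by apply: wint_phi => //; exact: measurable_Im_ev. Qed.

Lemma moment_series_le z c (phi : R -> R) : lm.-integrable D (EFin \o phi) ->
  (forall t, 0 < t < 1 -> `|g t| * nc (ev ac (z * (t ^+ 2)%:C)) <= c * phi t) ->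
  nc (ev moment_series z) <= 2 * (c * \int[lm]_(t in D) phi t).
Proof.
move=> phiI hphi; have [K K0 bK] := ev_bounded (nc z) ea.
rewrite (le_trans (nc_le _))// -wint_Re_ev -wint_Im_ev mulr_natl mulr2n lerD//.
  apply: (wint_le gI (M := K)) => //; first exact: measurable_Re_ev.
    by move=> t t01; exact: le_trans (nc_Re _) (bK _ (nc_sq_scale z t01)).
  move=> t t01; rewrite normrM (le_trans _ (hphi t t01))//.
  by rewrite ler_wpM2l// nc_Re.
apply: (wint_le gI (M := K)) => //; first exact: measurable_Im_ev.
  by move=> t t01; exact: le_trans (nc_Im _) (bK _ (nc_sq_scale z t01)).
move=> t t01; rewrite normrM (le_trans _ (hphi t t01))//.
by rewrite ler_wpM2l// nc_Im.
Qed.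

End IntegralOfSeries.

Section PowerInequalities.
Variable R : realType.
Implicit Types x y r : R.

Lemma powR_le1 x r : 0 <= x -> x <= 1 -> 0 <= r -> x `^ r <= 1.
Proof.
move=> x0 x1 r0; have h : (1 : R) `^ r = 1 by rewrite powR1.
by rewrite -[leRHS]h; apply: ge0_ler_powR => //; rewrite nnegrE.
Qed.

Lemma powR_ge1 x r : 1 <= x -> 0 <= r -> 1 <= x `^ r.
Proof.
move=> x1 r0; have h : (1 : R) `^ r = 1 by rewrite powR1.
rewrite -[leLHS]h; apply: ge0_ler_powR => //; rewrite nnegrE//.
exact: le_trans x1.
Qed.

Lemma ler_npowR x y r : r <= 0 -> 0 < x -> x <= y -> y `^ r <= x `^ r.
Proof.
move=> r0 x0 xy; have y0 : 0 < y by exact: lt_le_trans xy.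
rewrite -[r]opprK powRN (powRN x) lef_pV2 ?posrE ?powR_gt0//.
by apply: ge0_ler_powR; rewrite ?nnegrE ?oppr_ge0// ltW.
Qed.

Lemma powR_nle1 x r : 1 <= x -> r <= 0 -> x `^ r <= 1.
Proof.
move=> x1 r0; have h : (1 : R) `^ r = 1 by rewrite powR1.
by rewrite -[leRHS]h; exact: ler_npowR.
Qed.

End PowerInequalities.

(** * The entire function of the Hankel transform and its growth *)

Section HankelWeight.
Variables (R : realType) (nu : R) (f : R -> R).
Local Notation lm := (@lebesgue_measure R).
Local Notation D := (`]0, 1[%classic : set (measurableTypeR R)).
Hypothesis hnu : -1 < nu.
Hypothesis hf : lm.-integrable D (EFin \o f).
Hypothesis hfnu : nu < - 2^-1 ->
  (\int[lm]_(t in `]0%R, 1%R[) (t `^ (nu + 2^-1) * `|f t|)%:E < +oo)%E.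
Implicit Types (z : R[i]) (t : R).

Let mD : measurable D. Proof. exact: measurable_itv. Qed.
Let Dt t : D t -> 0 < t < 1. Proof. by rewrite /= in_itv. Qed.

Local Notation sg := (nu + 2^-1).

Definition hankel_weight t := t `^ sg * f t.

Let mf : measurable_fun D f.
Proof. by have /integrableP[/measurable_EFinP] := hf. Qed.

Lemma hankel_weight_integrable : lm.-integrable D (EFin \o hankel_weight).
Proof.
have mg : measurable_fun D hankel_weight.
  by apply: measurable_funM => //; apply: measurable_funTS; exact: measurable_powR.
have [s0|s0] := leP 0 sg.
  apply: (le_integrable mD) hf; first exact/measurable_EFinP.
  move=> t /Dt/andP[t0 t1] /=; rewrite lee_fin normrM ger0_norm ?powR_ge0//.
  by rewrite ler_piMl// powR_le1// ltW.
apply/integrableP; split; first exact/measurable_EFinP.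
have h : nu < - 2^-1 by rewrite -subr_lt0 opprK.
apply: le_lt_trans (hfnu h); rewrite le_eqVlt; apply/orP; left; apply/eqP.
apply: eq_integral => t _ /=.
by rewrite /hankel_weight normrM ger0_norm ?powR_ge0.
Qed.

Definition hankel_series := moment_series hankel_weight (bcr nu).

Lemma entire_hankel_series : entire hankel_series.
Proof.
exact: (entire_moment_series hankel_weight_integrable (entire_bc hnu)).
Qed.

Lemma expR_Im_scale z t : 0 < t < 1 ->
  expR `|complex.Im (z * t%:C)| <= expR `|complex.Im z|.
Proof.
move=> /andP[t0 t1]; rewrite ler_expR cImM /= mulr0 add0r normrM.
by rewrite ler_piMr// ger0_norm ?ltW.
Qed.

(** Where |zt| >= 1 [BQ_upper] applies; elsewhere BQ is bounded and the exponential is at least 1.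
    If nu + 1/2 >= 0, the factor t^(nu + 1/2) is what turns the power of |z| into that of |zt|. If
    it is negative, the power of |z| is at most that of |zt|, and t^(nu + 1/2) can stay in the
    weight. *)
Let BQ_bound : exists2 C, 0 < C & forall z t, 0 < t < 1 -> 1 <= nc z ->
  (0 <= sg -> t `^ sg * nc (BQ nu ((z * t%:C) ^+ 2)) <=
     C * expR `|complex.Im z| / nc z `^ sg) /\
  (sg < 0 -> nc (BQ nu ((z * t%:C) ^+ 2)) <=
     C * expR `|complex.Im z| / nc z `^ sg).
Proof.
have [C C0 hC] := BQ_upper hnu.
have [K K0 hK] := ev_bounded 1 (entire_bc hnu).
exists (C + K); first exact: addr_gt0.
move=> z t t01 z1; have /andP[t0 t1] := t01.
set w := z * t%:C; set E := expR _.
have E1 : 1 <= E by rewrite -expR0 ler_expR.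
have z0 : 0 < nc z by exact: lt_le_trans z1.
have wE : nc w = nc z * t by rewrite ncM nc_real ger0_norm ?ltW.
have w0 : 0 < nc w by rewrite wE mulr_gt0.
have wz : nc w <= nc z by rewrite wE ler_piMr ?ltW.
have zs : 0 < nc z `^ sg by rewrite powR_gt0.
have big : 1 <= nc w -> nc (BQ nu (w ^+ 2)) * nc w `^ sg <= (C + K) * E.
  move=> w1; rewrite (le_trans (hC w w1))//.
  apply: (@le_trans _ _ (C * E)).
    by rewrite ler_wpM2l ?(ltW C0)//; exact: expR_Im_scale.
  by rewrite mulrDl lerDl mulr_ge0 ?(ltW K0)// (le_trans ler01).
have small : nc w <= 1 -> nc (BQ nu (w ^+ 2)) <= (C + K) * E.
  move=> w1; have h : nc (BQ nu (w ^+ 2)) <= K.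
    by apply: hK; rewrite ncX exprn_ile1 ?nc_ge0.
  rewrite (le_trans h)// (@le_trans _ _ (C + K)) ?lerDr ?(ltW C0)//.
  by rewrite ler_peMr// addr_ge0// ltW.
have B0 := nc_ge0 (BQ nu (w ^+ 2)).
move: (nc (BQ nu (w ^+ 2))) B0 big small => B B0 big small.
split=> s0; rewrite ler_pdivlMr//.
  have -> : t `^ sg * B * nc z `^ sg = B * nc w `^ sg.
    by rewrite wE powRM ?nc_ge0// ?(ltW t0)//; ring.
  have [w1|/ltW w1] := leP 1 (nc w); first exact: big.
  by rewrite (le_trans _ (small w1))// ler_piMr// powR_le1// ltW.
have [w1|/ltW w1] := leP 1 (nc w).
  rewrite (le_trans _ (big w1))// ler_wpM2l//.
  by apply: ler_npowR => //; exact: ltW.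
by rewrite (le_trans _ (small w1))// ler_piMr// powR_nle1// ltW.
Qed.

Lemma hankel_series_upper : exists2 C, 0 < C & forall z, 1 <= nc z ->
  nc (ev hankel_series (z ^+ 2)) * nc z `^ sg <= C * expR `|complex.Im z|.
Proof.
have [C C0 hC] := BQ_bound.
(* phi is |f| when nu + 1/2 >= 0 and |t^(nu + 1/2) f| otherwise. *)
suff [phi [phiI phi0 hphi]] : exists phi, [/\ lm.-integrable D (EFin \o phi),
    forall t, 0 <= phi t & forall z t, 0 < t < 1 -> 1 <= nc z ->
    `|hankel_weight t| * nc (BQ nu ((z * t%:C) ^+ 2)) <=
    C * expR `|complex.Im z| / nc z `^ sg * phi t].
  exists (2 * C * (\int[lm]_(t in D) phi t) + 1).
    by rewrite ltr_wpDl// mulr_ge0 ?mulr_ge0 ?(ltW C0)//; apply: Rintegral_ge0.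
  move=> z z1; set I := Rintegral _ _ _.
  have z0 : 0 < nc z by exact: lt_le_trans z1.
  have zs : 0 < nc z `^ sg by rewrite powR_gt0.
  rewrite -ler_pdivlMr//.
  have := moment_series_le hankel_weight_integrable (entire_bc hnu) (z := z ^+ 2)
    (c := C * expR `|complex.Im z| / nc z `^ sg) phiI.
  rewrite -/hankel_series -/I => h; apply: le_trans (h _) _.
    move=> t t01; have := hphi z t t01 z1.
    by rewrite /BQ exprMn -rmorphXn.
  have E0 := expR_ge0 `|complex.Im z|.
  have -> : 2 * (C * expR `|complex.Im z| / nc z `^ sg * I) =
      2 * C * I * expR `|complex.Im z| / nc z `^ sg by ring.
  by rewrite ler_pM2r ?invr_gt0// ler_wpM2r// lerDl.
have [s0|s0] := leP 0 sg.
  exists (fun t => `|f t|); split => //; first exact: integrable_norm.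
  move=> z t t01 z1; have [/(_ s0) h _] := hC z t t01 z1.
  rewrite /hankel_weight normrM (ger0_norm (powR_ge0 _ _)) mulrAC.
  by rewrite ler_wpM2r.
exists (fun t => `|hankel_weight t|); split => //.
  by apply: integrable_norm => //; exact: hankel_weight_integrable.
move=> z t t01 z1; have [_ /(_ s0) h] := hC z t t01 z1.
by rewrite mulrC ler_wpM2r.
Qed.

End HankelWeight.

(** * The remainder on circles *)

Section PowerSums.
Variable R : realType.
Implicit Types (e x : R) (n m : nat).

Lemma ln_step n : (0 < n)%N ->
  n.+1%:R^-1 <= ln n.+1%:R - ln n%:R :> R.
Proof.
move=> n0; have p0 : 0 < n%:R :> R by rewrite ltr0n.
have q0 : 0 < n.+1%:R :> R by rewrite ltr0n.
have E : 1 + - n.+1%:R^-1 = n%:R / n.+1%:R :> R.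
  by rewrite -(natr1 n) in q0 *; field; rewrite natr1.
have := @le_ln1Dx R (- n.+1%:R^-1).
rewrite E ln_div ?posrE// => h.
rewrite -lerN2 opprB h// ltrN2 invf_lt1// ltr1n.
by rewrite ltnS.
Qed.

(** The logarithm is traded for an arbitrarily small power, so that only powers have to be compared
    later. *)
Lemma harmonic_le e : 0 < e -> exists2 K, 0 < K & forall n,
  \sum_(i < n.+1) (i.+1%:R^-1 : R) <= K * n.+1%:R `^ e.
Proof.
move=> e0; exists (1 + e^-1); first by rewrite addr_gt0// invr_gt0.
have ei : 0 < e^-1 by rewrite invr_gt0.
move=> n; have H : \sum_(i < n.+1) (i.+1%:R^-1 : R) <= 1 + ln n.+1%:R.
  elim: n => [|n IH]; first by rewrite big_ord_recr big_ord0 /= invr1 ln1 add0r addr0.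
  rewrite big_ord_recr /=.
  apply: le_trans (lerD IH (@ln_step n.+1 isT)) _.
  by rewrite le_eqVlt; apply/orP; left; apply/eqP; ring.
have p1 : 1 <= n.+1%:R :> R by rewrite ler1n.
have h1 := powR_ge1 p1 (ltW e0).
have h2 : ln n.+1%:R <= n.+1%:R `^ e / e.
  rewrite ler_pdivlMr// mulrC -ln_powR; apply/ltW/ln_sublinear.
  exact: lt_le_trans h1.
by rewrite (le_trans H)// mulrDl mul1r mulrC lerD// [leRHS]mulrC.
Qed.

(** A telescoping form of the integral test, from e^y >= 1 + y and [ln_step]. *)
Lemma powR_step e n : 0 < e -> (0 < n)%N ->
  e * n.+1%:R `^ (- (1 + e)) <= n%:R `^ (- e) - n.+1%:R `^ (- e) :> R.
Proof.
move=> e0 n0; have p0 : 0 < n%:R :> R by rewrite ltr0n.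
have q0 : 0 < n.+1%:R :> R by rewrite ltr0n.
have E : n%:R `^ (- e) = n.+1%:R `^ (- e) * expR (e * (ln n.+1%:R - ln n%:R)) :> R.
  rewrite /powR !gt_eqF// -expRD; congr expR; ring.
have F : n.+1%:R `^ (- (1 + e)) = n.+1%:R^-1 * n.+1%:R `^ (- e) :> R.
  have := @powRD R n.+1%:R (-1) (- e).
  by rewrite opprD (gt_eqF q0) implybT powR_inv1 ?ltW// => ->.
rewrite E F.
have h : 1 + e * n.+1%:R^-1 <= expR (e * (ln n.+1%:R - ln n%:R)).
  rewrite (le_trans _ (expR_ge1Dx _))// lerD2l ler_wpM2l ?(ltW e0)//.
  exact: ln_step.
have w0 : 0 < n.+1%:R `^ (- e) :> R by rewrite powR_gt0.
move: (expR _) (n.+1%:R^-1) (n.+1%:R `^ (- e)) h w0 => x y w h w0.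
have : w * (1 + e * y) <= w * x by rewrite ler_wpM2l// ltW.
lra.
Qed.

Lemma cvgn_series_powR e : 0 < e ->
  cvgn (series (fun n => n.+1%:R `^ (- (1 + e)) : R)).
Proof.
move=> e0; apply: (@nondecreasing_is_cvgn _ _).
  by apply: nondecreasing_series => n _ _; exact: powR_ge0.
exists (1 + e^-1) => _ [n _ <-]; rewrite seriesE.
have H m : \sum_(k < m.+1) (k.+1%:R `^ (- (1 + e)) : R) <=
    1 + e^-1 * (1 - m.+1%:R `^ (- e)).
  elim: m => [|m IH].
    by rewrite big_ord_recr big_ord0 /= !powR1 subrr mulr0 add0r addr0.
  rewrite big_ord_recr /=.
  have h := @powR_step e m.+1 e0 isT; rewrite -ler_pdivlMl// in h.
  apply: le_trans (lerD IH h) _.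
  by rewrite le_eqVlt; apply/orP; left; apply/eqP; ring.
case: n => [|n].
  by rewrite big_ord0 addr_ge0// invr_ge0 ltW.
by rewrite (le_trans (H n))// lerD2l ler_piMr ?invr_ge0 ?(ltW e0)// gerBl powR_ge0.
Qed.

End PowerSums.

(** * The zeros in the variable w: simplicity, gaps, linear growth *)

Section ZeroSequence.
Variables (R : realType) (mu : R) (j : nat -> R).
Hypothesis mu1 : -1 < mu.
Hypothesis jmono : {homo j : m n / (m < n)%N >-> m < n}.
Hypothesis jz : forall x, (0 < x /\ bq mu x = 0) <-> exists m, j m = x.
Implicit Types (m n : nat) (x : R) (w : R[i]).

Local Notation s := (mu + 2^-1).

Lemma j_gt0 m : 0 < j m.
Proof. by have [] := (jz (j m)).2 (ex_intro _ m erefl). Qed.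

Lemma bq_j m : bq mu (j m) = 0.
Proof. by have [] := (jz (j m)).2 (ex_intro _ m erefl). Qed.

Lemma j_ge m n : (m <= n)%N -> j m <= j n.
Proof. by rewrite leq_eqVlt => /predU1P[->//|/jmono/ltW]. Qed.

Definition sqz m : R[i] := (j m ^+ 2)%:C.

Lemma nc_sqz m : nc (sqz m) = j m ^+ 2.
Proof. by rewrite nc_real ger0_norm ?sqr_ge0. Qed.

Lemma sqz_inj : injective sqz.
Proof.
move=> m n /(congr1 (@complex.Re R))/= /eqP.
rewrite eqrXn2 ?(ltW (j_gt0 _))// => /eqP E.
by case: (ltngtP m n) => // /jmono; rewrite E ltxx.
Qed.

Lemma BQ_bq x : BQ mu (x ^+ 2)%:C = (bq mu x)%:C.
Proof. by apply: eq_ReIm; rewrite //= BQ_real. Qed.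

Lemma BQ_sqz m : BQ mu (sqz m) = 0.
Proof. by rewrite /sqz BQ_bq bq_j. Qed.

Lemma BQ_eq0 w : BQ mu w = 0 -> exists m, w = sqz m.
Proof.
move=> h; have [x x0 E] := BQ_zero_real mu1 h.
have [m jm] : exists m, j m = x.
  by apply/jz; split=> //; move: h; rewrite E BQ_bq => /(congr1 (@complex.Re R)).
by exists m; rewrite E /sqz jm.
Qed.

(** At a zero x of [bq] the whole energy is the square of 2 x^(s + 1) BD(x^2), so the lower energy
    bound makes the zero simple in a quantitative way. *)
Lemma BD_sqz_lower : exists2 c, 0 < c & forall m,
  c <= nc (BD mu (sqz m)) * j m `^ (s + 1).
Proof.
have [c [C [c0 C0 hc]]] := energy_bounds mu1 (j_gt0 0).
exists (Num.sqrt c / 2); first by rewrite divr_gt0// sqrtr_gt0.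
move=> m; have j0 := j_gt0 m.
have /andP[+ _] := hc _ (j_ge (leq0n m)).
rewrite energyE// bq_j mulr0 expr0n /= add0r.
rewrite -(ler_sqrt c) ?sqr_ge0// => h.
have E : nc (BD mu (sqz m)) = `|complex.Re (BD mu (sqz m))|.
  have -> : BD mu (sqz m) = (complex.Re (BD mu (sqz m)))%:C.
    by apply: eq_ReIm; rewrite //= BD_real.
  by rewrite nc_real.
rewrite E ler_pdivrMr// (le_trans h)// sqrtr_sqr.
rewrite /bp bq_j mul0r mulr0 addr0 !normrM.
rewrite (ger0_norm (powR_ge0 _ _)) (ger0_norm (ltW j0)) normr_nat.
have -> : j m `^ (s + 1) = j m `^ s * j m.
  by rewrite -[X in _ = _ * X](powRr1 (ltW j0)) -powRD ?(gt_eqF j0) ?implybT.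
by rewrite le_eqVlt; apply/orP; left; apply/eqP; ring.
Qed.

Lemma BD_sqz_neq0 m : BD mu (sqz m) != 0.
Proof.
have [c c0 h] := BD_sqz_lower; apply/eqP => E.
by have := h m; rewrite E nc0 mul0r leNgt c0.
Qed.

Lemma j_gaps : exists d (c : nat -> R), [/\ 0 < d,
  forall n, j n + d <= c n /\ c n + d <= j n.+1, forall n, bp mu (c n) = 0 &
  forall n, d * n.+1%:R <= j n].
Proof.
have [d d0 h] := zero_gap mu1 (j_gt0 0).
have /choice[c hc] : forall n, exists c, bp mu c = 0 /\ (j n + d <= c /\ c + d <= j n.+1).
  move=> n; have [c] := h _ _ (j_ge (leq0n n)) (jmono (ltnSn n)) (bq_j n) (bq_j n.+1).
  by exists c.
(* The minimum with [j 0] starts the induction for the linear growth of j n. *)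
pose d' := Num.min d (j 0); have d'0 : 0 < d' by rewrite lt_min d0 j_gt0.
have d'd : d' <= d by rewrite ge_min lexx.
exists d', c; split=> //.
- move=> n; have [_ [h1 h2]] := hc n; split; [move: h1|move: h2]; apply: le_trans.
    by rewrite lerD2l.
  by rewrite lerD2l.
- by move=> n; have [] := hc n.
elim=> [|n IH]; first by rewrite mulr1 /d' ge_min lexx orbT.
have [_ [h1 h2]] := hc n.
rewrite -natr1 mulrDr mulr1.
by lra.
Qed.

Lemma j_gap_le (d : R) n m : (forall k, j k + d <= j k.+1) -> (n <= m)%N ->
  j n + d * (m - n)%:R <= j m.
Proof.
move=> h; elim: m => [|m IH]; first by rewrite leqn0 => /eqP->; rewrite subnn mulr0 addr0.
rewrite leq_eqVlt => /predU1P[->|]; first by rewrite subnn mulr0 addr0.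
rewrite ltnS => nm; rewrite subSn// -natr1 mulrDr mulr1 addrA.
by rewrite (le_trans _ (h m))// lerD2r IH.
Qed.

End ZeroSequence.

(** * Residues, and bounds on the critical circles *)

Section RemainderBounds.
Variables (R : realType) (mu nu : R) (f : R -> R) (j : nat -> R).
Local Notation lm := (@lebesgue_measure R).
Local Notation D := (`]0, 1[%classic : set (measurableTypeR R)).
Hypotheses (mu1 : -1 < mu) (nu1 : -1 < nu) (munu : mu < nu + 2).
Hypothesis hf : lm.-integrable D (EFin \o f).
Hypothesis hfnu : nu < - 2^-1 ->
  (\int[lm]_(t in `]0%R, 1%R[) (t `^ (nu + 2^-1) * `|f t|)%:E < +oo)%E.
Hypothesis jmono : {homo j : m n / (m < n)%N >-> m < n}.
Hypothesis jz : forall x, (0 < x /\ bq mu x = 0) <-> exists m, j m = x.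
Implicit Types (m n : nat) (x : R) (w z : R[i]).

Local Notation s := (mu + 2^-1).
Local Notation sg := (nu + 2^-1).
Local Notation P := (hankel_series nu f).
Local Notation Q := (bc mu).
Local Notation res := (residue P Q (sqz j)).

Let eP : entire P. Proof. exact: entire_hankel_series. Qed.
Let eQ : entire Q. Proof. exact: entire_bc. Qed.

Lemma hankel_series_real_upper a : 0 < a -> exists2 C, 0 < C & forall x, a <= x ->
  nc (ev P (x ^+ 2)%:C) * x `^ sg <= C.
Proof.
move=> a0; have [C C0 hC] := hankel_series_upper nu1 hf hfnu.
have [K K0 hK] := ev_bounded 1 eP.
have as0 : 0 <= a `^ sg by exact: powR_ge0.
have H0 : 0 < K * (1 + a `^ sg) by rewrite mulr_gt0// ltr_pwDl.
exists (C + K * (1 + a `^ sg)); first exact: addr_gt0.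
move=> x ax; have x0 : 0 < x by exact: lt_le_trans ax.
have nx : nc (x%:C : R[i]) = x by rewrite nc_real ger0_norm ?ltW.
have [x1|/ltW x1] := leP 1 x.
  have := hC x%:C; rewrite nx /= normr0 expR0 mulr1 -rmorphXn => /(_ x1) h.
  by rewrite (le_trans h)// lerDl ltW.
apply: (@le_trans _ _ (K * (1 + a `^ sg))); last by rewrite lerDr ltW.
apply: ler_pM; rewrite ?nc_ge0 ?powR_ge0//.
  by apply: hK; rewrite nc_real normrX ger0_norm ?exprn_ile1// ltW.
have [s0|/ltW s0] := leP 0 sg.
  by rewrite (le_trans (powR_le1 (ltW x0) x1 s0))// lerDl.
by rewrite (le_trans (ler_npowR s0 a0 ax))// lerDr.
Qed.

Lemma residue_le : exists2 A, 0 < A & forall m,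
  nc (res m) / j m ^+ 2 <= A * j m `^ (mu - nu - 1).
Proof.
have [C C0 hC] := hankel_series_real_upper (j_gt0 jz 0).
have [c c0 hc] := BD_sqz_lower mu1 jmono jz.
exists (C / c); first by rewrite divr_gt0.
move=> m; have j0 := j_gt0 jz m.
have h1 := hC _ (j_ge jmono (leq0n m)).
have h2 := hc m.
have -> : j m `^ (mu - nu - 1) = j m `^ (s + 1) / j m `^ sg / j m ^+ 2.
  rewrite -(powR_mulrn 2 (ltW j0)) -!powRB ?(gt_eqF j0) ?implybT//.
  by congr powR; ring.
rewrite /residue -/(BD mu (sqz j m)) ncM ncV.
have p1 : 0 < j m `^ sg by rewrite powR_gt0.
have p2 : 0 < j m `^ (s + 1) by rewrite powR_gt0.
have p3 : 0 < j m ^+ 2 by rewrite exprn_gt0.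
have b0 : 0 < nc (BD mu (sqz j m)) by rewrite nc_gt0 BD_sqz_neq0.
have n0 := nc_ge0 (ev P (sqz j m)).
rewrite -/(sqz j m) in h1.
move: (nc (BD mu (sqz j m))) (nc (ev P (sqz j m))) h1 h2 b0 n0 => b p.
move: (j m `^ sg) (j m `^ (s + 1)) (j m ^+ 2) p1 p2 p3 => x y z x0 y0 z0 h1 h2 b0 p0.
have -> : C / c * (y / x / z) = (C / x) * (y / c) / z by ring.
rewrite ler_pM2r ?invr_gt0//; apply: ler_pM; rewrite ?invr_ge0 ?(ltW b0)//.
  by rewrite ler_pdivlMr.
by rewrite ler_pdivlMr// ler_pdivrMl.
Qed.

(** The bounds for numerator and denominator at a square root of w carry the same exponential of
    |Im|, which cancels. *)
Lemma quotient_le : exists r0 A, [/\ 1 <= r0, 0 < A & forall x, r0 <= x -> bp mu x = 0 ->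
  forall w, nc w = x ^+ 2 -> nc (ev P w / ev Q w) <= A * x `^ (mu - nu)].
Proof.
have [C C0 hC] := hankel_series_upper nu1 hf hfnu.
have [r0 [c [r1 c0 hc]]] := BQ_lower mu1.
exists r0, (C / c); split; rewrite ?divr_gt0// => x rx px w wx.
have x1 : 1 <= x by exact: le_trans rx.
have x0 : 0 < x by exact: lt_le_trans x1.
have zE : (sqrtc w) ^+ 2 = w by exact: sqr_sqrtc.
have zx : nc (sqrtc w) = x.
  apply/eqP; rewrite -(@eqrXn2 _ 2) ?nc_ge0 ?(ltW x0)//.
  by rewrite -ncX zE wx.
have h1 := hC (sqrtc w); rewrite zx zE in h1; have {}h1 := h1 x1.
have h2 := hc x rx px (sqrtc w) zx; rewrite zE in h2.
have -> : x `^ (mu - nu) = x `^ s / x `^ sg.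
  by rewrite -powRB ?(gt_eqF x0) ?implybT//; congr powR; ring.
rewrite ncM ncV -/(BQ mu w).
have p1 : 0 < x `^ sg by rewrite powR_gt0.
have p2 : 0 < x `^ s by rewrite powR_gt0.
have E0 := expR_gt0 `|complex.Im (sqrtc w)|.
have n0 := nc_ge0 (ev P w); have b0 := nc_ge0 (BQ mu w).
move: (nc (BQ mu w)) (nc (ev P w)) (x `^ sg) (x `^ s) (expR _) h1 h2 p1 p2 E0 n0 b0.
move=> b p X Y E h1 h2 X0 Y0 E0 p0 b0.
have bY : 0 < b * Y by apply: lt_le_trans h2; rewrite mulr_gt0.
have bp : 0 < b by move: bY; rewrite pmulr_lgt0.
have -> : C / c * (Y / X) = (C * E / X) * (Y / (c * E)) by field; rewrite !gt_eqF.
apply: ler_pM; rewrite ?invr_ge0//.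
  by rewrite ler_pdivlMr.
by rewrite ler_pdivlMr ?mulr_gt0// ler_pdivrMl.
Qed.

Local Notation be := (mu - nu - 1).

(** The sum equals w / (b^2 (w - b^2)), and |w - b^2| >= X^2 - b^2 >= X (X - b). *)
Lemma cauchy_kernel_le (X b : R) w : 0 < b -> b < X -> nc w = X ^+ 2 ->
  nc ((w - (b ^+ 2)%:C)^-1 + (b ^+ 2)%:C^-1) <= X / (b ^+ 2 * (X - b)).
Proof.
move=> b0 bX wX; have X0 : 0 < X by exact: lt_trans bX.
have Xb : 0 < X - b by rewrite subr_gt0.
have nb : nc ((b ^+ 2)%:C : R[i]) = b ^+ 2 by rewrite nc_real ger0_norm ?sqr_ge0.
have h : X * (X - b) <= nc (w - (b ^+ 2)%:C).
  apply: le_trans (ler_ncB _ _); rewrite wX nb subr_sqr.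
  by rewrite [leRHS]mulrC ler_wpM2r ?(ltW Xb)// lerDl ltW.
have h0 : 0 < nc (w - (b ^+ 2)%:C) by apply: lt_le_trans h; rewrite mulr_gt0.
have w0 : w - (b ^+ 2)%:C != 0 by rewrite -nc_gt0.
have c0 : (b ^+ 2)%:C != 0 :> R[i] by rewrite -nc_gt0 nb exprn_gt0.
have -> : (w - (b ^+ 2)%:C)^-1 + (b ^+ 2)%:C^-1 = w / ((b ^+ 2)%:C * (w - (b ^+ 2)%:C)).
  by move: (_%:C) c0 w0 => c c0 w0; field; rewrite c0 w0.
rewrite ncM ncV ncM nb wX.
have b2 : 0 < b ^+ 2 by rewrite exprn_gt0.
move: (nc _) h h0 => N h h0.
have -> : X ^+ 2 / (b ^+ 2 * N) = X / b ^+ 2 * (X / N) by rewrite invfM; ring.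
have -> : X / (b ^+ 2 * (X - b)) = X / b ^+ 2 * (X - b)^-1 by rewrite invfM; ring.
rewrite ler_wpM2l ?divr_ge0 ?(ltW X0) ?(ltW b2)//.
by rewrite ler_pdivrMr// ler_pdivlMl// mulrC.
Qed.

(** The gaps give c_n - j_i >= d (n - i + 1), so the i-th term is at most a constant times j_i^be
    c_n^2 / (n - i + 1) / c_n, and the sum over i is harmonic. Since j_i^be <= G c_n^(1 - 2k), a
    power c_n^k is left for the harmonic sum. *)
Lemma principal_part_le (d k : R) (c : nat -> R) : 0 < d -> 0 < k -> k <= 1 - be - k ->
  k <= 1 - k ->
  (forall n, j n + d <= c n /\ c n + d <= j n.+1) ->
  (forall n, d * n.+1%:R <= j n) ->
  exists2 S, 0 < S & forall n w, 1 <= c n -> nc w = c n ^+ 2 ->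
    nc (\sum_(i < n.+1) res i * ((w - sqz j i)^-1 + (sqz j i)^-1)) <=
    S * c n `^ (- k) * c n ^+ 2.
Proof.
move=> d0 k0 kb k1 gap jd.
have [A A0 hA] := residue_le.
have [H H0 hH] := harmonic_le k0.
(* Serves both signs of [be]: the powers of j i are bounded by that of c n if [be] is nonnegative,
   and by that of [j 0] otherwise. *)
pose G := 1 + j 0 `^ be.
have G0 : 0 < G by rewrite ltr_pwDl// powR_ge0.
exists (A * G / d * (H * d `^ (- k))).
  by rewrite !mulr_gt0 ?invr_gt0 ?powR_gt0.
move=> n w c1 wc; have jc : j n + d <= c n by have [] := gap n.
have cn0 : 0 < c n by exact: lt_le_trans c1.
have gap' i : j i + d <= j i.+1.
  by have [h1 h2] := gap i; lra.
have ncn i : (i <= n)%N -> j i + d * (n - i).+1%:R <= c n.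
  move=> ile; have := j_gap_le gap' ile; rewrite -natr1 mulrDr mulr1.
  by move: (d * _) => y; lra.
pose T (i : nat) := A * G / d * (c n `^ (1 - 2 * k) * c n) * (n - i).+1%:R^-1.
have term (i : 'I_n.+1) :
    nc (res i * ((w - sqz j i)^-1 + (sqz j i)^-1)) <= T i.
  have ile : (i <= n)%N by rewrite -ltnS.
  have ji0 := j_gt0 jz i.
  have h1 := ncn i ile.
  have dn0 : 0 < d * (n - i).+1%:R by rewrite mulr_gt0.
  have jic : j i < c n by lra.
  have h2 := cauchy_kernel_le ji0 jic wc.
  have e0 : 0 <= 1 - 2 * k by lra.
  have h3 : j i `^ be <= G * c n `^ (1 - 2 * k).
    have [b0|/ltW b0] := leP 0 be.
      apply: (@le_trans _ _ (c n `^ (1 - 2 * k))).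
        apply: (@le_trans _ _ (c n `^ be)).
          by apply: ge0_ler_powR => //; rewrite ?nnegrE ltW.
        by apply: ler_powR => //; lra.
      by rewrite ler_peMl ?powR_ge0// lerDl powR_ge0.
    apply: (@le_trans _ _ (j 0 `^ be)).
      apply: ler_npowR => //; first exact: (j_gt0 jz 0).
      exact: j_ge.
    have p1 := powR_ge1 c1 e0; have p0 := powR_ge0 (j 0) be.
    rewrite (@le_trans _ _ G) ?lerDr//.
    by rewrite ler_peMr// ltW.
  have h4 := hA i; have j2 : 0 < j i ^+ 2 by rewrite exprn_gt0.
  have Xj : 0 < c n - j i by rewrite subr_gt0.
  rewrite ncM; apply: le_trans (ler_wpM2l (nc_ge0 _) h2) _.
  rewrite invfM mulrCA mulrA [X in X <= _](_ : _ =
    nc (res i) / j i ^+ 2 * (c n / (c n - j i))); last by ring.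
  rewrite [T i](_ : _ = A * (G * c n `^ (1 - 2 * k)) *
    (c n / (d * (n - i).+1%:R))); last first.
    by rewrite /T; field; rewrite ?gt_eqF.
  apply: ler_pM; rewrite ?divr_ge0 ?nc_ge0 ?(ltW j2) ?(ltW cn0) ?(ltW Xj)//.
    by rewrite (le_trans h4)// ler_wpM2l// ltW.
  rewrite ler_wpM2l ?(ltW cn0)// lef_pV2 ?posrE//.
  by move: (d * _) h1 => y; lra.
apply: le_trans (nc_sum (fun i => res i * ((w - sqz j i)^-1 + (sqz j i)^-1)) n.+1) _.
apply: le_trans (ler_sum _ (fun i _ => term i)) _.
rewrite /T -mulr_sumr.
(* Counting the zeros backwards from the circle gives the harmonic sum. *)
have -> : \sum_(i < n.+1) ((n - i).+1%:R^-1 : R) = \sum_(i < n.+1) (i.+1%:R^-1 : R).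
  rewrite (reindex_inj rev_ord_inj) /=; apply: eq_bigr => i _.
  by rewrite subSS subKn// -ltnS.
have h5 := hH n.
have h6 : n.+1%:R `^ k <= c n `^ k * d `^ (- k).
  have dk0 : d `^ k != 0 by rewrite gt_eqF// powR_gt0.
  rewrite powRN -[leLHS](mulfK dk0).
  rewrite ler_wpM2r ?invr_ge0 ?powR_ge0// -powRM ?(ltW d0)//.
  have h7 : n.+1%:R * d <= c n.
    rewrite mulrC; apply: le_trans (jd n) _.
    by rewrite (le_trans _ jc)// lerDl ltW.
  apply: ge0_ler_powR h7; rewrite ?nnegrE ?(ltW k0) ?(ltW cn0)//.
  by rewrite mulr_ge0// ltW.
have E : c n `^ (- k) * c n ^+ 2 = c n `^ (1 - 2 * k) * c n * c n `^ k.
  rewrite -(powR_mulrn 2 (ltW cn0)) -[X in _ = _ * X * _](powRr1 (ltW cn0)).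
  by rewrite -!powRD ?(gt_eqF cn0) ?implybT//; congr powR; ring.
rewrite -[leRHS]mulrA E.
apply: (@le_trans _ _ (A * G / d * (c n `^ (1 - 2 * k) * c n) * (H * (c n `^ k * d `^ (- k))))).
  rewrite ler_wpM2l ?mulr_ge0 ?invr_ge0 ?powR_ge0 ?(ltW A0) ?(ltW G0) ?(ltW d0) ?(ltW cn0)//.
  by rewrite (le_trans h5)// ler_wpM2l// ltW.
by rewrite le_eqVlt; apply/orP; left; apply/eqP; ring.
Qed.

End RemainderBounds.

(** * The remainder tends to 0 *)

Section RemainderLimit.
Variables (R : realType) (mu nu : R) (f : R -> R) (j : nat -> R).
Local Notation lm := (@lebesgue_measure R).
Local Notation D := (`]0, 1[%classic : set (measurableTypeR R)).
Hypotheses (mu1 : -1 < mu) (nu1 : -1 < nu) (munu : mu < nu + 2).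
Hypothesis hf : lm.-integrable D (EFin \o f).
Hypothesis hfnu : nu < - 2^-1 ->
  (\int[lm]_(t in `]0%R, 1%R[) (t `^ (nu + 2^-1) * `|f t|)%:E < +oo)%E.
Hypothesis jmono : {homo j : m n / (m < n)%N >-> m < n}.
Hypothesis jz : forall x, (0 < x /\ bq mu x = 0) <-> exists m, j m = x.
Implicit Types (m n : nat) (x : R) (w z : R[i]).

Local Notation P := (hankel_series nu f).
Local Notation Q := (bc mu).

Lemma cvg_powRN (k : R) : 0 < k -> (fun n => n.+1%:R `^ (- k)) @ \oo --> (0 : R).
Proof.
move=> k0; apply/cvgrPdist_lt => e e0.
near=> n; rewrite sub0r normrN ger0_norm ?powR_ge0// powRN.
have n1 : e^-1 `^ k^-1 < n.+1%:R.
  rewrite (@lt_le_trans _ _ n%:R) ?ler_nat//.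
  by near: n; exact: nbhs_infty_gtr.
have h : (e^-1 `^ k^-1) `^ k < n.+1%:R `^ k.
  by apply: gt0_ltr_powR => //; rewrite nnegrE ?powR_ge0.
rewrite -powRrM mulVf ?gt_eqF// powRr1 ?invr_ge0 ?(ltW e0)// in h.
by rewrite -[ltRHS]invrK ltf_pV2 ?posrE ?invr_gt0// powR_gt0.
Unshelve. all: by end_near. Qed.

Lemma remainder_cvg w : BQ mu w != 0 ->
  clim (fun n => pf_remainder P Q (sqz j) n.+1 w) 0.
Proof.
move=> Qw.
(* Half of the room left by mu < nu + 2, capped at 1/2, as [principal_part_le] requires. *)
pose k := Num.min 1 (1 - (mu - nu - 1)) / 2.
have b1 : 0 < 1 - (mu - nu - 1) by have := munu; lra.
have k0 : 0 < k by rewrite divr_gt0// lt_min ltr01.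
have [k2 kb] : k <= 1 - k /\ k <= 1 - (mu - nu - 1) - k.
  have h1 : Num.min 1 (1 - (mu - nu - 1)) <= 1 by rewrite ge_min lexx.
  have h2 : Num.min 1 (1 - (mu - nu - 1)) <= 1 - (mu - nu - 1) by rewrite ge_min lexx orbT.
  by rewrite /k; move: (Num.min _ _) h1 h2 => y h1 h2; split; lra.
have [d [c [d0 gap hc jd]]] := j_gaps mu1 jmono jz.
have [S S0 hS] := principal_part_le mu1 nu1 hf hfnu jmono jz d0 k0 kb k2 gap jd.
have [r0 [A [r1 A0 hA]]] := quotient_le mu1 nu1 hf hfnu.
pose q0 := nc (ev P 0 / ev Q 0); have q00 : 0 <= q0 by exact: nc_ge0.
pose T := A + q0 + S.
have T0 : 0 < T by rewrite /T; move: (q0) q00 => q q00; lra.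
have cd n : d * n.+1%:R <= c n.
  by have [h1 _] := gap n; apply: le_trans (jd n) _; lra.
have Q00 : ev Q 0 != 0.
  have := BQ0_gt0 mu1; rewrite /BQ => h; apply/eqP => E.
  by move: h; rewrite E /= ltxx.
(* The circle of radius c_n^2 encloses exactly the zeros of index at most n, hence [n.+1] principal
   parts. *)
have main n : r0 <= c n -> nc w <= c n ^+ 2 ->
    nc (pf_remainder P Q (sqz j) n.+1 w) <= T * d `^ (- k) * nc w * n.+1%:R `^ (- k).
  move=> rc wc; have c1 : 1 <= c n by exact: le_trans rc.
  have c0 : 0 < c n by exact: lt_le_trans c1.
  have H : nc (pf_remainder P Q (sqz j) n.+1 w) <= T * c n `^ (- k) * nc w.
    apply: (pf_remainder_max (P := P) (Q := Q) (x := sqz j) _ _ _ _ _ _ Q00 _ _ _ _ wc Qw).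
    - exact: entire_hankel_series.
    - exact: entire_bc.
    - exact: sqz_inj jz.
    - by move=> m; exact: (BQ_sqz mu1 jz m).
    - by move=> m; exact: (BD_sqz_neq0 mu1 jmono jz m).
    - by move=> z; exact: (BQ_eq0 mu1 jz).
    - by rewrite exprn_gt0.
    - move=> m mn; rewrite nc_sqz; have j0 := j_gt0 jz m.
      rewrite ltrXn2r ?nnegrE ?(ltW j0) ?(ltW c0)//.
      have [h1 _] := gap n; apply: lt_le_trans h1.
      by rewrite (@le_lt_trans _ _ (j n)) ?ltrDl// j_ge// -ltnS.
    - move=> m mn; rewrite nc_sqz; have j0 := j_gt0 jz m.
      rewrite ltrXn2r ?nnegrE ?(ltW j0) ?(ltW c0)//.
      have [_ h1] := gap n; apply: (@lt_le_trans _ _ (j n.+1)); last exact: j_ge.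
      by apply: lt_le_trans h1; rewrite ltrDl.
    move=> z zc; rewrite /pf_remainder.
    have h1 := hA _ rc (hc n) z zc; have h2 := hS n z c1 zc.
    have p1 : c n `^ (mu - nu) <= c n `^ (- k) * c n ^+ 2.
      rewrite -(powR_mulrn 2 (ltW c0)) -powRD ?(gt_eqF c0) ?implybT//.
      by apply: ler_powR => //; lra.
    have p2 : 1 <= c n `^ (- k) * c n ^+ 2.
      rewrite -(powR_mulrn 2 (ltW c0)) -powRD ?(gt_eqF c0) ?implybT//.
      by apply: powR_ge1 => //; lra.
    have triangle (a b e : R[i]) (x y : R) : nc a <= x -> nc e <= y ->
        nc (a - b - e) <= x + nc b + y.
      move=> ax ey; apply: le_trans (ncB _ _) _; apply: lerD => //.
      by apply: le_trans (ncB _ _) _; rewrite lerD2r.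
    apply: le_trans (triangle _ _ _ _ _ h1 h2) _; rewrite -/q0.
    rewrite -[leRHS]mulrA -[S * _ * _]mulrA /T.
    move: (c n `^ (mu - nu)) (c n `^ (- k) * c n ^+ 2) p1 p2 => x y p1 p2.
    rewrite !mulrDl; apply: lerD => //; apply: lerD.
      by rewrite ler_wpM2l// ltW.
    by rewrite ler_peMr.
  apply: le_trans H _; rewrite [leRHS]mulrAC -!mulrA ler_wpM2l ?(ltW T0)//.
  rewrite mulrA ler_wpM2r ?nc_ge0// -powRM ?(ltW d0)//.
  by apply: ler_npowR; rewrite ?oppr_le0 ?(ltW k0) ?mulr_gt0.
apply/climP_nc/cvgrPdist_lt => e e0.
pose M := T * d `^ (- k) * nc w.
have cM : (fun n => M * n.+1%:R `^ (- k)) @ \oo --> (0 : R).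
  by rewrite -[X in _ --> X](mulr0 M); apply: cvgMr; exact: cvg_powRN.
near=> n.
have nb : (r0 + nc w + 1) / d < n.+1%:R.
  rewrite (@lt_le_trans _ _ n%:R) ?ler_nat//.
  by near: n; exact: nbhs_infty_gtr.
have cb : r0 + nc w + 1 <= c n.
  by apply: le_trans (cd n); rewrite mulrC -ler_pdivrMr// ltW.
have w0 := nc_ge0 w.
rewrite sub0r normrN subr0 ger0_norm ?nc_ge0//.
apply: (@le_lt_trans _ _ (M * n.+1%:R `^ (- k))).
  apply: main.
    by apply: le_trans cb; move: (nc w) w0 => y; lra.
  have c1 : 1 <= c n by apply: le_trans cb; move: (nc w) w0 => y; lra.
  apply: (@le_trans _ _ (c n)).
    by apply: le_trans cb; move: (nc w) w0 => y; lra.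
  by rewrite expr2 ler_peMl// (le_trans ler01).
rewrite (le_lt_trans (ler_norm _))// -normrN -[X in `|X|]sub0r; near: n.
by move/cvgrPdist_lt: cM; apply.
Unshelve. all: by end_near. Qed.

End RemainderLimit.

(** * Bessel functions and the expansion *)

Section ComplexPowerRules.
Variables (R : realType) (arg : R[i] -> R).
Hypothesis harg : arg_branch arg.
Implicit Types (z : R[i]) (a b t : R).

Lemma cpowD z a b : z != 0 -> cpow arg z (a + b) = cpow arg z a * cpow arg z b.
Proof.
move=> z0; have nz : nc z != 0 by rewrite gt_eqF// nc_gt0.
rewrite /cpow powRD ?nz ?implybT// !mulrDl cosD sinD.
move: (nc z `^ a) (nc z `^ b) => p q.
by apply: eq_ReIm; rewrite !(cReM, cImM) /=; ring.
Qed.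

Lemma cpow_neq0 z a : z != 0 -> cpow arg z a != 0.
Proof.
move=> z0; have nz : 0 < nc z by rewrite nc_gt0.
have p0 : nc z `^ a != 0 by rewrite gt_eqF// powR_gt0.
rewrite /cpow mulf_neq0//.
  by apply/eqP => /(congr1 (@complex.Re R)) /= /eqP; rewrite (negbTE p0).
apply/eqP => E.
have /= c0 := congr1 (@complex.Re R) E; have /= s0 := congr1 (@complex.Im R) E.
by have := cos2Dsin2 (a * arg z); rewrite c0 s0 expr0n /= addr0 => /eqP; rewrite eq_sym oner_eq0.
Qed.

Lemma cpow1 z : z != 0 -> cpow arg z 1 = z.
Proof.
by move=> z0; rewrite /cpow mul1r powRr1 ?nc_ge0//; have [<-] := harg z0.
Qed.

(** Here the condition arg (t z) = arg z for t > 0 enters; it lets real factors leave a power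
    without a change of branch. *)
Lemma cpow_scale z a t : z != 0 -> 0 < t ->
  cpow arg (t%:C * z) a = (t `^ a)%:C * cpow arg z a.
Proof.
move=> z0 t0; have [_ h] := harg z0.
rewrite /cpow h// ncM nc_real gtr0_norm// powRM ?nc_ge0 ?(ltW t0)//.
by rewrite rmorphM mulrA.
Qed.

End ComplexPowerRules.

Section BesselSeries.
Variables (R : realType) (arg : R[i] -> R).
Hypothesis harg : arg_branch arg.
Implicit Types (z w : R[i]) (nu mu t : R).

Lemma bessel_BQ nu z : z != 0 ->
  bessel arg nu z = (2 `^ (- nu))%:C * cpow arg z nu * BQ nu (z ^+ 2).
Proof.
move=> z0; rewrite /bessel.
have zE : z / 2 = (2^-1)%:C * z by rewrite mulrC fmorphV rmorph_nat.
rewrite zE cpow_scale ?invr_gt0//; congr (_ * _ * _).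
  by rewrite -powR_inv1// -powRrM mulN1r.
rewrite /BQ evE.
suff -> : bessel_term nu z = (fun k => bc nu k * (z ^+ 2) ^+ k) by [].
apply/funext => k.
rewrite /bessel_term zE /bc /bcr -mul2n exprM.
have -> : ((2^-1)%:C * z) ^+ 2 = (4^-1)%:C * z ^+ 2.
  by rewrite exprMn -rmorphXn; congr (_%:C * _); field.
rewrite exprMn mulrA -rmorphXn -rmorphM; congr (_%:C * _).
have k0 : k`!%:R != 0 :> R by rewrite pnatr_eq0 -lt0n fact_gt0.
rewrite exprVn -!mulrA; congr (_ * _); rewrite !invfM; ring.
Qed.

(** The relation (z^-mu J_mu)' = -z^-mu J_(mu+1) in the variable w. It turns the J_(mu+1) in a_m
    into the derivative in the residue. *)
Lemma BD_BQ mu w : -1 < mu -> BD mu w = - 4^-1 * BQ (mu + 1) w.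
Proof.
move=> mu1; rewrite -[RHS](ev_scale (- 4^-1) w (a := bc (mu + 1))); last first.
  by apply: entire_bc; have := mu1; lra.
rewrite /BD; congr (ev _ w); apply/funext => k.
have k0 : k`!%:R != 0 :> R by rewrite pnatr_eq0 -lt0n fact_gt0.
have k1 : k.+1%:R != 0 :> R by rewrite pnatr_eq0.
have E : k.+1%:R * bcr mu k.+1 = - 4^-1 * bcr (mu + 1) k.
  rewrite /bcr factS natrM !exprS.
  have -> : mu + k.+1%:R + 1 = mu + 1 + k%:R + 1 by rewrite -natr1; ring.
  have G0 : Gamma (mu + 1 + k%:R + 1) != 0.
    by rewrite gt_eqF// Gamma_gt0//; have := mu1; have := ler0n R k; lra.
  have f0 : 4 ^+ k != 0 :> R by rewrite expf_neq0.
  move: (Gamma _) (4 ^+ k) (k`!%:R) (k.+1%:R) ((-1) ^+ k) G0 f0 k0 k1.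
  by move=> G u v w' e G0 u0 v0 w0; field; rewrite G0 u0 v0 w0.
rewrite /der /bc -(rmorph_nat (real_complex R)) -rmorphM E.
by rewrite rmorphM rmorphN fmorphV rmorph_nat.
Qed.

End BesselSeries.

(** * Both sides of the expansion in terms of P and Q *)

Section HankelSeries.
Variables (R : realType) (arg : R[i] -> R) (mu nu : R) (f : R -> R) (j : nat -> R).
Local Notation lm := (@lebesgue_measure R).
Local Notation D := (`]0, 1[%classic : set (measurableTypeR R)).
Hypothesis harg : arg_branch arg.
Hypotheses (mu1 : -1 < mu) (nu1 : -1 < nu).
Hypothesis hf : lm.-integrable D (EFin \o f).
Hypothesis hfnu : nu < - 2^-1 ->
  (\int[lm]_(t in `]0%R, 1%R[) (t `^ (nu + 2^-1) * `|f t|)%:E < +oo)%E.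
Implicit Types (m n : nat) (x t : R) (w z : R[i]).

Local Notation P := (hankel_series nu f).
Local Notation Q := (bc mu).
Local Notation g := (hankel_weight nu f).

Let mD : measurable D. Proof. exact: measurable_itv. Qed.
Let Dt t : D t -> 0 < t < 1. Proof. by rewrite /= in_itv. Qed.

Let gI : lm.-integrable D (EFin \o g). Proof. exact: hankel_weight_integrable. Qed.

(** The powers of zt split on one branch: the power of z can leave the integral, and t^(nu + 1/2)
    joins f. *)
Lemma hankel_integrand z t : z != 0 -> 0 < t ->
  (f t)%:C * bessel arg nu (z * t%:C) * cpow arg (z * t%:C) 2^-1 =
  (2 `^ (- nu))%:C * cpow arg z (nu + 2^-1) *
    ((g t)%:C * BQ nu (z ^+ 2 * (t ^+ 2)%:C)).
Proof.
move=> z0 t0.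
have t0' : t%:C != 0 :> R[i] by rewrite -nc_gt0 nc_real normr_gt0 gt_eqF.
rewrite (bessel_BQ harg) ?mulf_neq0// exprMn -rmorphXn [z * t%:C]mulrC.
rewrite !(cpow_scale harg)// cpowD// /hankel_weight.
have -> : (t `^ (nu + 2^-1) * f t)%:C = (t `^ nu)%:C * (t `^ 2^-1)%:C * (f t)%:C :> R[i].
  by rewrite powRD ?(gt_eqF t0) ?implybT// !rmorphM.
move: (BQ _ _) (cpow _ _ _) (cpow _ _ _) (_ `^ _)%:C (_ `^ _)%:C (_ `^ _)%:C => a b c d e h.
ring.
Qed.

Lemma hankelE z : z != 0 -> hankel arg nu f z =
  (2 `^ (- nu))%:C * cpow arg z (nu + 2^-1) * ev P (z ^+ 2).
Proof.
move=> z0; set K := (2 `^ (- nu))%:C * cpow arg z (nu + 2^-1).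
have [M M0 hM] := ev_bounded (nc (z ^+ 2)) (entire_bc nu1).
pose B t := BQ nu (z ^+ 2 * (t ^+ 2)%:C).
have mR : measurable_fun D (fun t => complex.Re (B t)).
  exact: (measurable_Re_ev (entire_bc nu1)).
have mI : measurable_fun D (fun t => complex.Im (B t)).
  exact: (measurable_Im_ev (entire_bc nu1)).
have bR t : 0 < t < 1 -> `|complex.Re (B t)| <= M.
  by move=> t01; exact: le_trans (nc_Re _) (hM _ (nc_sq_scale _ t01)).
have bI t : 0 < t < 1 -> `|complex.Im (B t)| <= M.
  by move=> t01; exact: le_trans (nc_Im _) (hM _ (nc_sq_scale _ t01)).
have iR := wint_integrable gI mR bR.
have iI := wint_integrable gI mI bI.
have eR : wint g (fun t => complex.Re (B t)) = complex.Re (ev P (z ^+ 2)).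
  exact: (wint_Re_ev gI (entire_bc nu1)).
have eI : wint g (fun t => complex.Im (B t)) = complex.Im (ev P (z ^+ 2)).
  exact: (wint_Im_ev gI (entire_bc nu1)).
have KRe (k b : R[i]) (a : R) : complex.Re (k * (a%:C * b)) =
    complex.Re k * (a * complex.Re b) - complex.Im k * (a * complex.Im b).
  by case: k b => [? ?] [? ?] /=; ring.
have KIm (k b : R[i]) (a : R) : complex.Im (k * (a%:C * b)) =
    complex.Re k * (a * complex.Im b) + complex.Im k * (a * complex.Re b).
  by case: k b => [? ?] [? ?] /=; ring.
have HR (F : R -> R[i]) : (forall t, D t -> F t = K * ((g t)%:C * B t)) ->
    \int[lm]_(t in D) complex.Re (F t) = complex.Re (K * ev P (z ^+ 2)).
  move=> hF; rewrite (@eq_Rintegral _ _ _ lm D (fun t =>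
    complex.Re K * (g t * complex.Re (B t)) - complex.Im K * (g t * complex.Im (B t)))).
    rewrite (RintegralB mD); [|exact: (integrableZl mD _ iR)|exact: (integrableZl mD _ iI)].
    by rewrite !(RintegralZl _ mD)// cReM -eR -eI.
  by move=> t /[!inE] tD; rewrite (hF t tD) KRe.
have HI (F : R -> R[i]) : (forall t, D t -> F t = K * ((g t)%:C * B t)) ->
    \int[lm]_(t in D) complex.Im (F t) = complex.Im (K * ev P (z ^+ 2)).
  move=> hF; rewrite (@eq_Rintegral _ _ _ lm D (fun t =>
    complex.Re K * (g t * complex.Im (B t)) + complex.Im K * (g t * complex.Re (B t)))).
    rewrite (RintegralD mD); [|exact: (integrableZl mD _ iI)|exact: (integrableZl mD _ iR)].
    by rewrite !(RintegralZl _ mD)// cImM -eR -eI.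
  by move=> t /[!inE] tD; rewrite (hF t tD) KIm.
rewrite /hankel /complex_integral.
have hF t : D t -> (f t)%:C * bessel arg nu (z * t%:C) * cpow arg (z * t%:C) 2^-1 =
    K * ((g t)%:C * B t).
  by move=> /Dt/andP[t0 _]; rewrite (hankel_integrand z0 t0).
by apply: eq_ReIm => /=; [exact: HR hF|exact: HI hF].
Qed.

(** The exponent nu - mu + 3/2 is the one for which z^lambda z^mu equals z^(nu + 1/2) times z, so
    all branch-dependent factors cancel. *)
Lemma hankel_quotientE z : z != 0 ->
  hankel arg nu f z / (cpow arg z (nu - mu + 3 / 2) * bessel arg mu z) =
  (2 `^ (mu - nu))%:C * (ev P (z ^+ 2) / ev Q (z ^+ 2)) / z.
Proof.
move=> z0; rewrite hankelE// (bessel_BQ harg)// -/(BQ mu (z ^+ 2)).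
have E : cpow arg z (nu - mu + 3 / 2) * cpow arg z mu = cpow arg z (nu + 2^-1) * z.
  rewrite -cpowD// -[X in _ = _ * X](cpow1 harg z0) -cpowD//.
  by congr cpow; field.
have c0 : cpow arg z (nu + 2^-1) != 0 by exact: cpow_neq0.
have p0 : (2 `^ (- mu))%:C != 0 :> R[i].
  by rewrite -nc_gt0 nc_real normr_gt0 gt_eqF// powR_gt0.
have -> : (2 `^ (mu - nu))%:C = (2 `^ (- nu))%:C / (2 `^ (- mu))%:C :> R[i].
  rewrite -fmorphV -rmorphM -powRN opprK -powRD ?pnatr_eq0 ?implybT//.
  by congr (_ `^ _)%:C; ring.
have -> : cpow arg z (nu - mu + 3 / 2) * ((2 `^ (- mu))%:C * cpow arg z mu * BQ mu (z ^+ 2)) =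
    (2 `^ (- mu))%:C * BQ mu (z ^+ 2) *
    (cpow arg z (nu - mu + 3 / 2) * cpow arg z mu) by ring.
rewrite E; move: (cpow _ _ _) c0 ((2 `^ (- mu))%:C) p0 ((2 `^ (- nu))%:C) => c c0 p p0 q.
move: (ev P (z ^+ 2)) (BQ mu (z ^+ 2)) => a b.
(* The inverse of BQ is generalised, so the identity also covers the zeros of BQ, where that inverse
   is 0 by convention. *)
rewrite !invfM; move: (b^-1) => b'; by field; rewrite c0 p0 z0.
Qed.

Lemma coef_bE : (coef_b nu mu f)%:C = (2 `^ (mu - nu))%:C * (ev P 0 / ev Q 0).
Proof.
rewrite (ev0 (entire_hankel_series nu1 hf hfnu)) (ev0 (entire_bc mu1)).
rewrite /hankel_series /moment_series /bc -fmorphV -!rmorphM; congr (_%:C).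
have -> : wint g (fun t => t ^+ 0.*2) =
    \int[lm]_(t in D) (t `^ (nu + 2^-1) * f t).
  by apply: eq_Rintegral => t _; rewrite expr0 mulr1.
rewrite /coef_b /bcr !expr0 !fact0 !mulr1 !mul1r !addr0.
have G0 : Gamma (nu + 1) != 0 by rewrite gt_eqF// Gamma_gt0//; have := nu1; lra.
have -> : 2 `^ (nu - mu) = (2 `^ (mu - nu))^-1 by rewrite -powRN opprB.
by move: (Rintegral _ _ _) => I; rewrite !invfM !invrK; ring.
Qed.

Hypothesis jmono : {homo j : m n / (m < n)%N >-> m < n}.
Hypothesis jz : forall x, (0 < x /\ bq mu x = 0) <-> exists m, j m = x.
Local Notation res := (residue P Q (sqz j)).

(** The factor -1/2 combines the extra power of 2 in J_(mu+1) with the -4 of [BD_BQ]. *)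
Lemma coef_aE m : coef_a arg nu mu f j m =
  - ((2 `^ (mu - nu))%:C / 2) * (res m / sqz j m).
Proof.
have j0 := j_gt0 jz m; set x := (j m)%:C : R[i].
have x0 : x != 0 by rewrite -nc_gt0 nc_real normr_gt0 gt_eqF.
have x2 : x ^+ 2 = sqz j m by rewrite -rmorphXn.
have D0 := BD_sqz_neq0 mu1 jmono jz m.
rewrite /coef_a -/x hankelE// (bessel_BQ harg)// x2.
have -> : BQ (mu + 1) (sqz j m) = - 4 * BD mu (sqz j m).
  by rewrite BD_BQ//; move: (BQ _ _) => b; field.
have E : cpow arg x (nu - mu + 3 / 2) * cpow arg x (mu + 1) =
    cpow arg x (nu + 2^-1) * sqz j m.
  rewrite -x2 expr2 -[X in _ = _ * (X * X)](cpow1 harg x0) -!cpowD//.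
  by congr cpow; field.
have c0 : cpow arg x (nu + 2^-1) != 0 by exact: cpow_neq0.
have p0 : (2 `^ (- (mu + 1)))%:C != 0 :> R[i].
  by rewrite -nc_gt0 nc_real normr_gt0 gt_eqF// powR_gt0.
have -> : (2 `^ (mu - nu))%:C = (2 `^ (- nu))%:C / (2 `^ (- (mu + 1)))%:C / 2 :> R[i].
  rewrite -fmorphV -rmorphM -powRN opprK -powRD ?pnatr_eq0 ?implybT//.
  have -> : - nu + (mu + 1) = mu - nu + 1 by ring.
  rewrite (@powRD R 2 (mu - nu) 1) ?pnatr_eq0 ?implybT// powRr1// rmorphM rmorph_nat.
  by rewrite mulfK// pnatr_eq0.
have s0 : sqz j m != 0 by rewrite -x2 expf_neq0.
have -> : cpow arg x (nu - mu + 3 / 2) *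
    ((2 `^ (- (mu + 1)))%:C * cpow arg x (mu + 1) * (- 4 * BD mu (sqz j m))) =
    (2 `^ (- (mu + 1)))%:C * (- 4 * BD mu (sqz j m)) *
    (cpow arg x (nu - mu + 3 / 2) * cpow arg x (mu + 1)) by ring.
rewrite E /residue -/(BD mu (sqz j m)).
move: (cpow _ _ _) c0 ((2 `^ (- (mu + 1)))%:C) p0 ((2 `^ (- nu))%:C) => c c0 p p0 q.
move: (ev P (sqz j m)) (BD mu (sqz j m)) D0 => a b b0.
move: (sqz j m) s0 => y y0.
by field; rewrite c0 p0 b0 y0.
Qed.

(** The poles j and -j are paired: 1 / (z - j) + 1 / (z + j) = 2z / (z^2 - j^2), which is 2 j^2 / z
    times the normalised principal part at j^2 in w = z^2. *)
Lemma expansion_termE z m : z != 0 -> z ^+ 2 != sqz j m ->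
  expansion_term arg nu mu f j z m =
  - ((2 `^ (mu - nu))%:C / z) * (res m * ((z ^+ 2 - sqz j m)^-1 + (sqz j m)^-1)).
Proof.
move=> z0 zm; rewrite /expansion_term coef_aE.
have j0 := j_gt0 jz m; set x := (j m)%:C : R[i].
have x0 : x != 0 by rewrite -nc_gt0 nc_real normr_gt0 gt_eqF.
have x2 : sqz j m = x ^+ 2 by rewrite -rmorphXn.
rewrite x2 in zm *.
have : (z - x) * (z + x) != 0 by rewrite -subr_sqr subr_eq0.
rewrite mulf_eq0 negb_or => /andP[h1 h2].
have h3 : z ^+ 2 - x ^+ 2 != 0 by rewrite subr_eq0.
move: (res m) ((2 `^ (mu - nu))%:C) => a q.
by field; rewrite x0 z0 h1 h2 h3.
Qed.

End HankelSeries.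

(** * Uniform convergence of complex series *)

Section ComplexSeriesTests.
Variable R : realType.
Implicit Types (u : nat -> R[i]) (v : R ^nat) (z : R[i]).

Lemma clim_unshiftS u x : clim (fun n => u n.+1) x -> clim u x.
Proof. by rewrite /clim => h; rewrite -cvg_shiftS. Qed.

(** The bound involves only the majorant v, so it is uniform in any parameter of u. Domination is
    asked from N on, as the expansion terms are controlled only for zeros that are large compared
    with z. *)
Lemma series_tail_le u v l n N : (N <= n)%N -> (forall m, (N <= m)%N -> nc (u m) <= v m) ->
  (forall m, 0 <= v m) -> cvgn (series v) ->
  clim (fun n => \sum_(k < n) u k) l ->
  nc (\sum_(k < n) u k - l) <= limn (series v) - series v n.
Proof.
move=> Nn uv v0 cv ul.
have sv k : series v k <= limn (series v).
  apply: nondecreasing_cvgn_le => //.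
  by apply: nondecreasing_series => i _ _; exact: v0.
have key k : nc (\sum_(i < n) u i - \sum_(i < (n + k)%N) u i) <= series v (n + k)%N - series v n.
  elim: k => [|k IH]; first by rewrite addn0 !subrr nc0.
  rewrite addnS big_ord_recr /= opprD addrA.
  have -> : series v (n + k)%N.+1 - series v n = series v (n + k)%N - series v n + v (n + k)%N.
    by rewrite !seriesE big_ord_recr /=; ring.
  apply: le_trans (ncD _ _) _; rewrite ncN; apply: lerD => //.
  by apply: uv; rewrite (leq_trans Nn)// leq_addr.
have cl : clim (fun k => \sum_(i < n) u i - \sum_(i < (n + k)%N) u i) (\sum_(k < n) u k - l).
  apply: climB; first exact: clim_cst.
  have -> : (fun k => \sum_(i < (n + k)%N) u i) = (fun k => \sum_(i < (k + n)%N) u i).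
    by apply/funext => k; rewrite addnC.
  move: ul; rewrite /clim -(@cvg_shiftn n).
  by apply.
apply: nc_lim_le cl _ => k; apply: le_trans (key k) _.
by rewrite lerD2r.
Qed.

Lemma continuous_nc : continuous (fun z : R[i]^o => nc z : R).
Proof.
move=> z.
apply/(@cvgrPdist_lt _ _ _ (nbhs (z : R[i]^o)) (nbhs_filter (z : R[i]^o))) => e e0.
have e0' : 0 < e%:C :> R[i] by rewrite ltcR.
have H : nbhs (z : R[i]^o) (ball (z : R[i]^o) e%:C) by exact: nbhsx_ballx.
apply: (@filterS _ (nbhs (z : R[i]^o)) _ _ _ _ H) => u; rewrite -ball_normE /= => h.
by rewrite (le_lt_trans (dist_nc _ _))// -ltcR.
Qed.

Lemma compact_nc_bounded (K : set R[i]^o) : compact K ->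
  exists2 M : R, 0 < M & forall z, K z -> nc z <= M.
Proof.
move=> cK.
have [M [_ hM]] := compact_bounded
  (continuous_compact (continuous_subspaceT continuous_nc) cK).
exists (`|M| + 1); first by rewrite ltr_wpDl.
move=> z Kz; have hMM : M < `|M| + 1 by rewrite (le_lt_trans (ler_norm _))// ltrDl.
have : `|nc z| <= `|M| + 1 := hM _ hMM (nc z) (ex_intro2 _ _ z Kz erefl).
by rewrite ger0_norm// nc_ge0.
Qed.

Lemma uniform_cvg_nc (K : set R[i]^o) (F : nat -> R[i]^o -> R[i]^o) (G : R[i]^o -> R[i]^o) :
  (forall e : R, 0 < e -> \forall n \near \oo, forall z, K z -> nc (F n z - G z) < e) ->
  {uniform K, F @ \oo --> G}.
Proof.
move=> h A /uniform_nbhs[E [entE EA]].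
have [e e0 eE] : exists2 e : R, 0 < e & forall x y : R[i]^o, nc (y - x) < e -> E (x, y).
  move: entE; rewrite -entourage_ballE => -[[a b] /= ab aE].
  (* A positive radius in [R[i]] has imaginary part 0. *)
  have [a0 b0] : 0 < a /\ b = 0 by move: ab; rewrite ltcE /= => /andP[/eqP ->].
  exists a => // x y xy; apply: aE => /=.
  by rewrite b0 -ball_normE /= -/(_%:C) ltcR -ncC in xy *.
have := h e e0; apply: filterS => n hn.
by apply: EA => z Kz; apply: eE; exact: hn.
Qed.

End ComplexSeriesTests.

(** * Convergence of the expansion *)

Section Expansion.
Variables (R : realType) (arg : R[i] -> R) (mu nu : R) (f : R -> R) (j : nat -> R).
Local Notation lm := (@lebesgue_measure R).
Local Notation D := (`]0, 1[%classic : set (measurableTypeR R)).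
Hypothesis harg : arg_branch arg.
Hypotheses (mu1 : -1 < mu) (nu1 : -1 < nu) (munu : mu < nu + 2).
Hypothesis hf : lm.-integrable D (EFin \o f).
Hypothesis hfnu : nu < - 2^-1 ->
  (\int[lm]_(t in `]0%R, 1%R[) (t `^ (nu + 2^-1) * `|f t|)%:E < +oo)%E.
Hypothesis jmono : {homo j : m n / (m < n)%N >-> m < n}.
Hypothesis jz : forall x, (0 < x /\ bq mu x = 0) <-> exists m, j m = x.
Implicit Types (m n : nat) (x t : R) (w z : R[i]).

Local Notation P := (hankel_series nu f).
Local Notation Q := (bc mu).
Local Notation res := (residue P Q (sqz j)).
Local Notation term := (expansion_term arg nu mu f j).

Lemma bessel_domain_sq z : bessel_domain j z ->
  z != 0 /\ forall m, z ^+ 2 != sqz j m.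
Proof.
move=> [/eqP z0 h]; split=> // m; apply/eqP => E.
have : (z - (j m)%:C) * (z + (j m)%:C) = 0.
  by rewrite -subr_sqr E /sqz rmorphXn subrr.
have [h1 h2] := h m.
move=> /eqP; rewrite mulf_eq0 subr_eq0 addr_eq0 => /orP[] /eqP //.
Qed.

(** For zeros this large |z^2 - j^2| >= j^2 / 2, and with [residue_le] the term is of order j^(mu -
    nu - 3). As j grows at least linearly, the series converges because this exponent is below -1,
    which is mu < nu + 2. The constant is independent of z and M. *)
Lemma expansion_term_le : exists2 C, 0 < C & forall (M : R) z m,
  bessel_domain j z -> nc z <= M -> 2 * M ^+ 2 <= j m ^+ 2 ->
  nc (term z m) <= C * M * m.+1%:R `^ (- (1 + (1 - (mu - nu - 1)))).
Proof.
have [A A0 hA] := residue_le mu1 nu1 hf hfnu jmono jz.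
have [d [c [d0 _ _ jd]]] := j_gaps mu1 jmono jz.
set r := - (1 + _); have r0 : r <= 0 by rewrite /r; have := munu; lra.
exists (2 `^ (mu - nu) * A * 2 * d `^ r).
  by rewrite !mulr_gt0 ?powR_gt0.
move=> M z m /bessel_domain_sq[z0 hz] zM Mj.
have jm0 := j_gt0 jz m; have zm := hz m.
rewrite (expansion_termE harg mu1 nu1 hf hfnu jmono jz)//.
have s0 : sqz j m != 0 by rewrite -nc_gt0 nc_sqz exprn_gt0.
have h0 : z ^+ 2 - sqz j m != 0 by rewrite subr_eq0.
have -> : - ((2 `^ (mu - nu))%:C / z) * (res m * ((z ^+ 2 - sqz j m)^-1 + (sqz j m)^-1)) =
    - (2 `^ (mu - nu))%:C * (res m / sqz j m) * z * (z ^+ 2 - sqz j m)^-1.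
  move: (res m) ((2 `^ _)%:C) => a q; move: (sqz j m) s0 h0 => y s0 h0.
  by field; rewrite z0 s0 h0.
have M0 : 0 <= M by exact: le_trans (nc_ge0 z) zM.
rewrite !ncM !ncV ncN nc_real ger0_norm ?powR_ge0// nc_sqz.
have j2 : 0 < j m ^+ 2 by rewrite exprn_gt0.
have hd : j m ^+ 2 / 2 <= nc (z ^+ 2 - sqz j m).
  rewrite ncC; apply: le_trans (ler_ncB _ _); rewrite nc_sqz ncX.
  have : nc z ^+ 2 <= M ^+ 2 by rewrite lerXn2r ?nnegrE ?nc_ge0.
  by move: (j m ^+ 2) (nc z ^+ 2) (M ^+ 2) Mj => a b e; lra.
have hi : (nc (z ^+ 2 - sqz j m))^-1 <= 2 / j m ^+ 2.
  rewrite -[leRHS]invrK lef_pV2 ?posrE ?invr_gt0 ?divr_gt0// ?invf_div//.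
  by apply: lt_le_trans hd; rewrite divr_gt0.
have hp : j m `^ (mu - nu - 1) / j m ^+ 2 <= d `^ r * m.+1%:R `^ r.
  rewrite -(powR_mulrn 2 (ltW jm0)) -powRB ?(gt_eqF jm0) ?implybT//.
  have -> : mu - nu - 1 - 2 = r by rewrite /r; ring.
  by rewrite -powRM ?(ltW d0)//; apply: ler_npowR => //; rewrite mulr_gt0.
have q0 := powR_ge0 2 (mu - nu).
apply: (@le_trans _ _ (2 `^ (mu - nu) * (A * j m `^ (mu - nu - 1)) * M * (2 / j m ^+ 2))).
  apply: ler_pM; rewrite ?invr_ge0 ?mulr_ge0 ?invr_ge0 ?nc_ge0 ?(ltW j2)//.
  apply: ler_pM; rewrite ?mulr_ge0 ?invr_ge0 ?nc_ge0 ?(ltW j2)//.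
  by have := hA m; rewrite /residue ncM ncV => h; rewrite ler_wpM2l.
have -> : 2 `^ (mu - nu) * (A * j m `^ (mu - nu - 1)) * M * (2 / j m ^+ 2) =
    2 `^ (mu - nu) * A * 2 * M * (j m `^ (mu - nu - 1) / j m ^+ 2) by ring.
have -> : 2 `^ (mu - nu) * A * 2 * d `^ r * M * m.+1%:R `^ r =
    2 `^ (mu - nu) * A * 2 * M * (d `^ r * m.+1%:R `^ r) by ring.
by rewrite ler_wpM2l// !mulr_ge0// ltW.
Qed.

Let e1 : 0 < 1 - (mu - nu - 1). Proof. by have := munu; lra. Qed.

Lemma j_sq_large (B : R) : exists N, forall m, (N <= m)%N -> B <= j m ^+ 2.
Proof.
have [d [c [d0 _ _ jd]]] := j_gaps mu1 jmono jz.
exists (Num.bound ((1 + `|B|) / d)) => m Nm.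
have h : 1 + `|B| <= j m.
  apply: le_trans (jd m); rewrite mulrC -ler_pdivrMr//.
  have h0 : 0 <= (1 + `|B|) / d by rewrite divr_ge0 ?addr_ge0 ?(ltW d0).
  have := archi_boundP h0 => /ltW h1; rewrite (le_trans h1)// ler_nat.
  exact: leqW.
have B0 := normr_ge0 B; have B1 := ler_norm B.
by rewrite expr2; move: (`|B|) (j m) B0 B1 h => b x; nra.
Qed.

Lemma expansion_cvg_abs z : bessel_domain j z ->
  cvgn (series (fun m => nc (term z m))).
Proof.
move=> Dz; have [C C0 hC] := expansion_term_le.
have [N hN] := j_sq_large (2 * nc z ^+ 2).
pose w m : R := m.+1%:R `^ (- (1 + (1 - (mu - nu - 1)))).
have w0 m : 0 < w m by rewrite powR_gt0.
(* The sum absorbs the finitely many terms before N, so that the comparison with L w holds at every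
   index. *)
pose L := C * nc z + \sum_(i < N) nc (term z i) / w i.
have S0 : 0 <= \sum_(i < N) nc (term z i) / w i.
  by apply: sumr_ge0 => i _; rewrite divr_ge0 ?nc_ge0 ?(ltW (w0 _)).
have cw := cvgn_series_scale L (cvgn_series_powR e1).
apply: (@series_le_cvg R (fun m => nc (term z m)) (fun m => L * w m)) => //.
- by move=> m; exact: nc_ge0.
- by move=> m; rewrite mulr_ge0 ?(ltW (w0 _))// addr_ge0 ?mulr_ge0 ?nc_ge0 ?(ltW C0).
move=> m; have [Nm|mN] := leqP N m.
  apply: le_trans (hC _ _ _ Dz (lexx _) (hN m Nm)) _.
  by rewrite ler_wpM2r ?(ltW (w0 _))// lerDl.
rewrite -ler_pdivrMr// /L (bigD1 (Ordinal mN))//= addrCA lerDl.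
rewrite addr_ge0 ?mulr_ge0 ?nc_ge0 ?(ltW C0)//.
by apply: sumr_ge0 => i _; rewrite divr_ge0 ?nc_ge0 ?(ltW (w0 _)).
Qed.

Lemma expansion_clim z : bessel_domain j z ->
  clim (fun n => \sum_(k < n) (term z k : R[i])) ((coef_b nu mu f)%:C / z -
    hankel arg nu f z / (cpow arg z (nu - mu + 3 / 2) * bessel arg mu z)).
Proof.
move=> /bessel_domain_sq[z0 hz]; set q := (2 `^ (mu - nu))%:C : R[i].
rewrite (coef_bE mu1 nu1 hf hfnu) (hankel_quotientE mu harg nu1 hf hfnu z0) -/q.
have Qz : BQ mu (z ^+ 2) != 0.
  by apply/eqP => /(BQ_eq0 mu1 jz)[m E]; have := hz m; rewrite E eqxx.
have h := remainder_cvg mu1 nu1 munu hf hfnu jmono jz Qz.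
(* [remainder_cvg] concerns the first [n.+1] zeros. *)
apply: clim_unshiftS.
have E (a b : R[i]) : q * a / z - q * b / z = - (q / z) * (b - a - 0).
  by rewrite subr0; ring.
rewrite E.
have := climMl (- (q / z))
  (climB (clim_cst (ev P (z ^+ 2) / ev Q (z ^+ 2) - ev P 0 / ev Q 0)) h).
apply: clim_ext => n.
rewrite /pf_remainder opprB addrC subrK mulr_sumr; apply: eq_bigr => i _.
by rewrite (expansion_termE harg mu1 nu1 hf hfnu jmono jz).
Qed.

End Expansion.

Unset Implicit Arguments.

Theorem theorem2p1 (R : realType) (arg : R[i] -> R) (nu mu : R) (f : R -> R)
    (j : nat -> R)
    (harg : arg_branch arg)
    (hnu : -1 < nu) (hmu : -1 < mu < nu + 2)
    (hj : bessel_positive_zeros arg mu j)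
    (hf : lebesgue_measure.-integrable `]0, 1[ (EFin \o f))
    (hfnu : nu < - 2^-1 ->
      (\int[lebesgue_measure]_(t in `]0%R, 1%R[)
         (t `^ (nu + 2^-1) * `|f t|)%:E < +oo)%E) :
  let lambda : R := nu - mu + 3 / 2 in
  let D := bessel_domain j in
  let term := expansion_term arg nu mu f j in
  [/\ forall z : R[i], D z ->
        hankel arg nu f z / (cpow arg z lambda * bessel arg mu z) =
        (coef_b nu mu f)%:C / z - limn (series (term z)),
      forall z : R[i], D z ->
        cvgn (series (fun m => Normc.normc (term z m))) &
      forall K : set R[i]^o, compact K -> K `<=` D ->
        {uniform K, (fun n (z : R[i]^o) => series (term z) n) @ \oo -->
                    (fun z : R[i]^o => limn (series (term z)))}].
Proof.
move=> lambda D term; have [mu1 munu] := andP hmu.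
have [jmono hz] := hj.
have jz x : (0 < x /\ bq mu x = 0) <-> exists m, j m = x.
  rewrite -hz.
  (* The factors in front of [BQ] do not vanish for x > 0, so the zeros are the same for every
     branch. *)
  have H : 0 < x -> bessel arg mu x%:C = 0 <-> bq mu x = 0.
    move=> x0; have xn0 : x%:C != 0 :> R[i] by rewrite -nc_gt0 nc_real normr_gt0 gt_eqF.
    have p0 : (2 `^ (- mu))%:C != 0 :> R[i].
      by rewrite -nc_gt0 nc_real normr_gt0 gt_eqF// powR_gt0.
    rewrite (bessel_BQ harg)// -rmorphXn (BQ_bq mu1); split=> [/eqP|->]; last by rewrite mulr0.
    rewrite mulf_eq0 (negbTE (mulf_neq0 p0 (cpow_neq0 _ _ xn0))) /= => /eqP.
    by move=> /(congr1 (@complex.Re R)).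
  by split=> -[x0 h]; split=> //; apply/(H x0).
have limE z : D z -> limn (series (term z)) = (coef_b nu mu f)%:C / z -
    hankel arg nu f z / (cpow arg z lambda * bessel arg mu z).
  move=> Dz; apply: (@clim_lim R).
  by apply: clim_ext (expansion_clim harg mu1 hnu munu hf hfnu jmono jz Dz) => n; rewrite seriesE.
split.
- by move=> z Dz; rewrite limE// subKr.
- by move=> z Dz; exact: (expansion_cvg_abs harg mu1 hnu munu hf hfnu jmono jz).
move=> K cK KD; have [M M0 KM] := compact_nc_bounded cK.
have [C C0 hC] := expansion_term_le harg mu1 hnu munu hf hfnu jmono jz.
have [N hN] := j_sq_large mu1 jmono jz (2 * M ^+ 2).
pose v m : R := C * M * m.+1%:R `^ (- (1 + (1 - (mu - nu - 1)))).
have e1 : 0 < 1 - (mu - nu - 1) by lra.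
have cv : cvgn (series v) := cvgn_series_scale (C * M) (cvgn_series_powR e1).
have v0 m : 0 <= v m by rewrite mulr_ge0 ?powR_ge0// mulr_ge0 ?ltW.
apply: uniform_cvg_nc => e e0.
have := cv => /cvgrPdist_lt/(_ e e0) h.
near=> n => z Kz.
have Nn : (N <= n)%N by near: n; exact: nbhs_infty_ge.
have Dz := KD _ Kz.
rewrite limE// seriesE.
have := series_tail_le Nn (fun m Nm => hC M z m Dz (KM z Kz) (hN m Nm)) v0 cv
  (expansion_clim harg mu1 hnu munu hf hfnu jmono jz Dz).
move/le_lt_trans; apply; apply: le_lt_trans (ler_norm _) _.
by near: n; exact: h.
Unshelve. all: by end_near. Qed.
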